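(* Let $m>0$, let $\omega=\sqrt{m/(m+1)}$ and $q=2\pi/\omega$. Let $(\eta,u)$ be a solution of the dimensionless shallow water equations in the power-shaped bay with parameter $m$, with initial conditions $\eta(x,0)=\eta_0(x)$, $u(x,0)=u_0(x)$, whose shoreline run-up $R(t)$ is real analytic (with Taylor series convergent in the entire complex plane), and assume that the Carrier–Greenspan transformation is invertible (the wave does not break). Then $\eta_0$ and $u_0$ can be recovered exactly from $R$, as follows. (1) Let $\psi(0,\tau)=R(t)+\frac12(\partial_tR(t))^2$ and $\varphi(0,\tau)=-\partial_tR(t)$ with $\tau=t+\partial_tR(t)$, and let $\Psi(\xi)=\psi_{\rm even}(0,q\xi)$, $\Phi(\xi)=\varphi_{\rm even}(0,q\xi)$ be the even components (in $\tau$) of $\psi(0,\tau)$ and $\varphi(0,\tau)$ evaluated at $\tau=q\xi$. Then for all $\lambda>0$ $$\psi(\lambda^2,0)=\frac{2\sqrt{\pi}\,\Gamma(1+\frac1m)}{\lambda\,\Gamma(\frac1m+\frac12)}\int_0^{\lambda/\pi}\Big(1-\Big(\frac{\pi\xi}{\lambda}\Big)^2\Big)^{\frac1m-\frac12}\Psi(\xi)\,d\xi,$$ $$\varphi(\lambda^2,0)=\frac{2\sqrt{\pi}\,\Gamma(2+\frac1m)}{\lambda^{2+\frac2m}\,\Gamma(\frac32+\frac1m)}\int_0^{\lambda/\pi}\big(\lambda^2-\pi^2\xi^2\big)^{\frac1m+\frac12}\Phi(\xi)\,d\xi .$$ (2) The data $\psi(\cdot,0),\varphi(\cdot,0)$ on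 the line $\tau=0$ determine $\psi,\varphi$ on $\{\sigma\ge0,\ \tau\in\mathbb{R}\}$ as the solution of the linear system $$\partial_\tau\psi+\tfrac{m}{m+1}\sigma\,\partial_\sigma\varphi+\varphi=0,\qquad \partial_\tau\varphi+\partial_\sigma\psi=0 .$$ The curve $\tau=\gamma(\sigma)$ corresponding to $t=0$ is determined by $$\gamma(\sigma)=-\varphi(\sigma,\gamma(\sigma)),$$ and $\eta_0,u_0$ are given, parametrically in $\sigma\ge0$, by $$\eta_0(x)=\psi(\sigma,\gamma(\sigma))-\tfrac12\varphi^2(\sigma,\gamma(\sigma)),\qquad u_0(x)=\varphi(\sigma,\gamma(\sigma)),\qquad x=\sigma-\psi(\sigma,\gamma(\sigma))+\tfrac12\varphi^2(\sigma,\gamma(\sigma)).$$ In particular, the pair $(\eta_0,u_0)$ is uniquely determined by $R$.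
   Context: The dimensionless 1D shallow water equations in an inclined power-shaped bay $z(x,y)=-x+|y|^m$ with bay parameter $m>0$ are $$\partial_t\eta+u\,\partial_x(x+\eta)+\tfrac{m}{m+1}(x+\eta)\,\partial_x u=0,\qquad \partial_t u+u\,\partial_x u+\partial_x\eta=0,$$ where $\eta(x,t)$ is the water displacement and $u(x,t)$ the cross-section averaged velocity, considered on the wet region $x+\eta(x,t)\ge 0$; the shoreline is the free boundary $x+\eta(x,t)=0$. The (vertical) run-up $R(t)$ is the value of $\eta$ at the shoreline at time $t$; at the shoreline $u=-\partial_tR(t)$. The Carrier–Greenspan transformation (CGT) introduces $$\sigma=x+\eta(x,t),\quad \tau=t-u(x,t),\quad \varphi(\sigma,\tau)=u(x,t),\quad \psi(\sigma,\tau)=\eta(x,t)+\tfrac12u(x,t)^2 .$$ It is assumed invertible: $(x,t)\mapsto(\sigma,\tau)$ is one-to-one with non-vanishing Jacobians, from the wet region onto $\{\sigma\ge0,\ \tau\in\mathbb{R}\}$. The shoreline corresponds to $\sigma=0$. Under the CGT the shallow water equations become the linear system displayed in part (2) of the claim. Solutions $\psi,\varphi$ are assumed smooth on $[0,\infty)\times\mathbb{R}$, up to and including $\sigma=0$. The image of the line $t=0$ under the CGT is assumed to be the graph $\tau=\gamma(\sigma)$ of a function $\gamma$ of $\sigma\ge0$. The even component of a function $f$ on $\mathbb{R}$ is $f_{\rm even}(\tau)=\tfrac12(f(\tau)+f(-\tau))$. $\Gamma$ is the Euler Gamma function. *)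

(* Defs.v *)
From Stdlib Require Import Reals.
From Coquelicot Require Import Coquelicot.

Open Scope R_scope.

(** * Functions on the closed half-plane [0 <= sigma]

    A function on [0,oo) x R is a total [f : R -> R -> R], of which only the
    values at [0 <= sigma] are ever used. *)

(** Derivative in sigma relative to [0,oo): the ordinary one for [0 < sigma],
    the right one at [sigma = 0].  This is [is_derive] with the neighbourhood
    filter restricted to [0,oo). *)
Definition is_dsigma (f : R -> R -> R) (sigma tau l : R) : Prop :=
  @filterdiff R_AbsRing (AbsRing_NormedModule R_AbsRing) R_NormedModule
    (fun s : R => f s tau)
    (within (fun s : R => 0 <= s) (locally sigma))
    (fun h : R_AbsRing => scal h l).

Definition ex_dsigma (f : R -> R -> R) (sigma tau : R) : Prop :=
  exists l : R, is_dsigma f sigma tau l.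

Definition Dsigma (f : R -> R -> R) (sigma tau : R) : R :=
  iota (fun l : R => is_dsigma f sigma tau l).

Definition Dtau (f : R -> R -> R) (sigma tau : R) : R :=
  Derive (fun t : R => f sigma t) tau.

Definition continuous_halfplane (f : R -> R -> R) : Prop :=
  forall sigma tau : R, 0 <= sigma ->
    filterlim (fun p : R * R => f (fst p) (snd p))
      (within (fun p : R * R => 0 <= fst p) (locally (sigma, tau)))
      (locally (f sigma tau)).

Fixpoint Ck_halfplane (n : nat) (f : R -> R -> R) : Prop :=
  continuous_halfplane f /\
  match n with
  | O => True
  | S k =>
      (forall sigma tau : R, 0 <= sigma ->
         ex_dsigma f sigma tau /\ ex_derive (fun t : R => f sigma t) tau) /\
      Ck_halfplane k (Dsigma f) /\
      Ck_halfplane k (Dtau f)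
  end.

Definition smooth_halfplane (f : R -> R -> R) : Prop :=
  forall n : nat, Ck_halfplane n f.

Definition linear_system (m : R) (psi phi : R -> R -> R) : Prop :=
  forall sigma tau : R, 0 <= sigma ->
    Dtau psi sigma tau + m / (m + 1) * sigma * Dsigma phi sigma tau
      + phi sigma tau = 0 /\
    Dtau phi sigma tau + Dsigma psi sigma tau = 0.

(** * Shallow water equations

    [eta x t] and [u x t] are total; their values off the wet region are
    meaningless, except that dryness of [(x,t)] is recorded by
    [x + eta x t < 0]. *)

Definition wet (eta : R -> R -> R) (x t : R) : Prop := 0 <= x + eta x t.
Definition wet_interior (eta : R -> R -> R) (x t : R) : Prop :=
  0 < x + eta x t.
Definition shoreline (eta : R -> R -> R) (x t : R) : Prop :=
  x + eta x t = 0.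

Definition partial_x (f : R -> R -> R) (x t : R) : R := Derive (fun y : R => f y t) x.
Definition partial_t (f : R -> R -> R) (x t : R) : R := Derive (fun s : R => f x s) t.

(** The equations are imposed at [0 < x + eta x t], where ordinary partial
    derivatives make sense; the behaviour up to the shoreline is carried by
    the smoothness of [psi] and [phi] below. *)
Definition shallow_water (m : R) (eta u : R -> R -> R) : Prop :=
  forall x t : R, wet_interior eta x t ->
    differentiable_pt eta x t /\ differentiable_pt u x t /\
    partial_t eta x t + u x t * partial_x (fun y s : R => y + eta y s) x t
      + m / (m + 1) * (x + eta x t) * partial_x u x t = 0 /\
    partial_t u x t + u x t * partial_x u x t + partial_x eta x t = 0.

Definition is_runup (eta : R -> R -> R) (R0 : R -> R) : Prop :=
  (forall t : R, exists x : R, shoreline eta x t) /\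
  (forall x t : R, shoreline eta x t -> R0 t = eta x t).

Definition entire_on_reals (f : R -> R) : Prop :=
  exists a : nat -> R,
    CV_radius a = p_infty /\ forall t : R, is_pseries a t (f t).

(** * Carrier-Greenspan transformation *)

Definition cg_sigma (eta : R -> R -> R) (x t : R) : R := x + eta x t.
Definition cg_tau (u : R -> R -> R) (x t : R) : R := t - u x t.

Definition cg_variables (eta u psi phi : R -> R -> R) : Prop :=
  forall x t : R, wet eta x t ->
    phi (cg_sigma eta x t) (cg_tau u x t) = u x t /\
    psi (cg_sigma eta x t) (cg_tau u x t) = eta x t + / 2 * (u x t) ^ 2.

(** The inverse map [(sigma,tau) |-> (x,t)], expressed through [psi], [phi]. *)
Definition cg_x (psi phi : R -> R -> R) (sigma tau : R) : R :=
  sigma - psi sigma tau + / 2 * (phi sigma tau) ^ 2.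
Definition cg_t (phi : R -> R -> R) (sigma tau : R) : R :=
  tau + phi sigma tau.

Definition cg_jacobian (eta u : R -> R -> R) (x t : R) : R :=
  partial_x (cg_sigma eta) x t * partial_t (cg_tau u) x t
  - partial_t (cg_sigma eta) x t * partial_x (cg_tau u) x t.

Definition cg_inverse_jacobian (psi phi : R -> R -> R) (sigma tau : R) : R :=
  Dsigma (cg_x psi phi) sigma tau * Dtau (cg_t phi) sigma tau
  - Dtau (cg_x psi phi) sigma tau * Dsigma (cg_t phi) sigma tau.

Record cg_invertible (eta u psi phi : R -> R -> R) : Prop := {
  cg_injective : forall x t x' t' : R, wet eta x t -> wet eta x' t' ->
    cg_sigma eta x t = cg_sigma eta x' t' ->
    cg_tau u x t = cg_tau u x' t' -> x = x' /\ t = t';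
  cg_onto : forall sigma tau : R, 0 <= sigma ->
    exists x t : R, wet eta x t /\
      cg_sigma eta x t = sigma /\ cg_tau u x t = tau;
  cg_jacobian_neq0 : forall x t : R, wet_interior eta x t ->
    cg_jacobian eta u x t <> 0;
  cg_inverse_jacobian_neq0 : forall sigma tau : R, 0 <= sigma ->
    cg_inverse_jacobian psi phi sigma tau <> 0
}.

Definition is_initial_curve
    (eta u : R -> R -> R) (gamma : R -> R) : Prop :=
  forall sigma tau : R, 0 <= sigma ->
    ((exists x : R, wet eta x 0 /\
        cg_sigma eta x 0 = sigma /\ cg_tau u x 0 = tau)
     <-> tau = gamma sigma).

Record nonbreaking_wave (m : R) (R0 : R -> R) (eta u : R -> R -> R)
    (eta0 u0 : R -> R) (psi phi : R -> R -> R) (gamma : R -> R) : Prop := {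
  wave_equations : shallow_water m eta u;
  wave_eta0 : forall x : R, eta x 0 = eta0 x;
  wave_u0 : forall x : R, u x 0 = u0 x;
  wave_runup : is_runup eta R0;
  wave_runup_entire : entire_on_reals R0;
  wave_cg : cg_variables eta u psi phi;
  wave_psi_smooth : smooth_halfplane psi;
  wave_phi_smooth : smooth_halfplane phi;
  wave_invertible : cg_invertible eta u psi phi;
  wave_gamma : is_initial_curve eta u gamma
}.

(** * Constants and special functions *)

Definition even_part (f : R -> R) (tau : R) : R := / 2 * (f tau + f (- tau)).

(** Euler's integral; it converges for [0 < s]. *)
Definition Gamma (s : R) : R :=
  RInt_gen (fun t : R => Rpower t (s - 1) * exp (- t))
    (at_right 0) (Rbar_locally p_infty).

Definition bay_omega (m : R) : R := sqrt (m / (m + 1)).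
Definition bay_q (m : R) : R := 2 * PI / bay_omega m.

(** [c] is the convergent integral of [f] over [a,b), possibly improper at
    [b]: the kernel (1 - s^2)^(1/m - 1/2) is unbounded at [s = 1] when
    [2 < m]. *)
Definition is_RInt_left (f : R -> R) (a b c : R) : Prop :=
  is_RInt_gen f (at_point a) (at_left b) c.

(* Main.v *)
Require Import Defs.
From Stdlib Require Import Reals Lra Lia.
From Coquelicot Require Import Coquelicot.
Open Scope R_scope.

(** In the variables [l = sqrt sigma] and [y = tau / kappa], [kappa = 2 / omega], the
    combination [P = psi + (2 l / kappa) phi], extended to [l < 0] by evenness of [psi]
    and [phi] in [l], satisfies the single first-order equation
    [(d_l + d_y) P (l, y) = (k / 2 l) (P (- l, y) - P (l, y))] with [k = 1 + 2 / m].
    The mean [int cos^(2/m) th (1 - sin th) g (y + l sin th) dth] over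
    [- PI/2 < th < PI/2], normalized, solves the same equation with value [g] on [l = 0].
    A solution that is [O(l)] vanishes: integrating along the lines [y - l = const]
    improves the constant in the bound by the factor [k / (k + 2)] each time.  So [P] is
    this mean of the shoreline trace, and separating the even and odd parts in [l] gives
    the two recovery formulas and uniqueness from the trace.

    The constants come from [int_0^(PI/2) cos^p], compared with the quotient of Gamma
    values by a Bohr-Mollerup argument.  Uniqueness for data on [tau = 0] is an energy
    estimate with weight [l^k].  On the shoreline the Jacobian of the transformation is
    [(1 + phi_tau)^2], so [tau |-> tau + phi (0, tau)] has nonzero derivative, and
    differentiating [R (tau + phi) = psi - phi^2 / 2] yields [R' = - phi]. *)

(** At the shoreline the system degenerates: its characteristic speeds, plus and minus
    [omega sqrt sigma], vanish there. In [l = sqrt sigma] they become constant, a one-sided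
    derivative in [sigma] becomes an ordinary one, and even functions of [l] extend across the
    boundary, so the problem lives on a whole plane. The price is a coefficient [1 / l]; keeping the
    reflected value [P (- l, y)] beside [P (l, y)] yields one first-order equation, for which C1
    regularity is enough. The sign of the term [- P] helps instead: with [a = k / 2], [r ^ a] is an
    integrating factor, and a bound [M r] on the reflected term returns the bound [a / (a + 1) M r].
    The exponent [2 / m] is the kernel exponent [1 / m - 1 / 2] after the substitution
    [PI xi / lambda = sin th]: twice that exponent, plus one from the differential. Integrals that
    are improper for [m > 2] thus become proper ones, with a continuous weight for every [m > 0]. *)

(** * Real powers extended by zero *)

(* [Rpower x q] extended by [0] to [x <= 0], where [Rpower] takes the value [1]. *)
Definition pw (q x : R) : R := if Rlt_dec 0 x then Rpower x q else 0.

Lemma pw_pos (q x : R) : 0 < x -> pw q x = Rpower x q.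
Proof. intros H. unfold pw. destruct (Rlt_dec 0 x); [reflexivity | lra]. Qed.

Lemma pw_nonpos (q x : R) : x <= 0 -> pw q x = 0.
Proof. intros H. unfold pw. destruct (Rlt_dec 0 x); [lra | reflexivity]. Qed.

Lemma Rpower_gt_0 (x q : R) : 0 < Rpower x q.
Proof. apply exp_pos. Qed.

Lemma pw_ge_0 (q x : R) : 0 <= pw q x.
Proof.
unfold pw. destruct (Rlt_dec 0 x); [left; apply Rpower_gt_0 | lra].
Qed.

Lemma pw_succ (q x : R) : pw (q + 1) x = x * pw q x.
Proof.
destruct (Rlt_dec 0 x) as [H | H].
- rewrite 2!pw_pos, Rpower_plus, Rpower_1 by lra. ring.
- rewrite 2!pw_nonpos by lra. ring.
Qed.

Lemma locally_lt (x y : R) : x < y -> locally x (fun z => z < y).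
Proof. intros H. exact (open_lt y x H). Qed.

Lemma locally_gt (x y : R) : y < x -> locally x (fun z => y < z).
Proof. intros H. exact (open_gt y x H). Qed.

Lemma continuous_pw (q x : R) : 0 < q -> continuous (pw q) x.
Proof.
intros Hq. destruct (Rtotal_order x 0) as [H | [H | H]].
- apply continuous_ext_loc with (g := fun _ => 0).
  + generalize (locally_lt x 0 H). apply filter_imp.
    intros z Hz. rewrite pw_nonpos by lra. reflexivity.
  + apply continuous_const.
- subst x. apply continuity_pt_filterlim.
  intros eps Heps. exists (Rpower eps (/ q)). split.
  { apply Rpower_gt_0. }
  intros z [_ Hz]. simpl in *. unfold R_dist in *.
  rewrite (pw_nonpos q 0), Rminus_0_r in * by lra.
  rewrite Rabs_pos_eq by apply pw_ge_0.
  destruct (Rlt_dec 0 z) as [H | H].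
  + rewrite pw_pos by easy. rewrite Rabs_pos_eq in Hz by lra.
    replace eps with (Rpower (Rpower eps (/ q)) q).
    * unfold Rpower at 1 2. apply exp_increasing.
      apply Rmult_lt_compat_l; [easy | now apply ln_increasing].
    * rewrite Rpower_mult, Rinv_l, Rpower_1; lra.
  + rewrite pw_nonpos; lra.
- apply continuous_ext_loc with (g := fun z => Rpower z q).
  + generalize (locally_gt x 0 H). apply filter_imp.
    intros z Hz. rewrite pw_pos by lra. reflexivity.
  + apply (ex_derive_continuous (fun z => Rpower z q)).
    exists (q * Rpower x (q - 1)). apply is_derive_Reals.
    now apply derivable_pt_lim_power.
Qed.

(** Holds at every real [x], the junction 0 included, so that powers of [cos] can be integrated by
    parts up to the end points where [cos] vanishes. At 0 the difference quotient of [pw (q + 1)] is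
    [pw q h], and continuity of [pw q] concludes. *)
Lemma is_derive_pw (q x : R) :
  0 < q -> is_derive (pw (q + 1)) x ((q + 1) * pw q x).
Proof.
intros Hq. destruct (Rtotal_order x 0) as [H | [H | H]].
- rewrite pw_nonpos, Rmult_0_r by lra.
  apply is_derive_ext_loc with (f := fun _ => 0).
  + generalize (locally_lt x 0 H). apply filter_imp.
    intros z Hz. rewrite pw_nonpos by lra. reflexivity.
  + apply (is_derive_const 0).
- subst x. apply is_derive_Reals. intros eps Heps.
  pose proof (continuous_pw q 0 Hq) as Hc.
  apply continuity_pt_filterlim in Hc.
  destruct (Hc eps Heps) as [d [Hd Hlim]].
  exists (mkposreal d Hd). intros h Hh0 Hh.
  rewrite Rplus_0_l, pw_succ, (pw_nonpos q 0), (pw_nonpos _ 0) by lra.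
  replace ((h * pw q h - 0) / h - (q + 1) * 0) with (pw q h - 0)
    by (field; easy).
  rewrite <- (pw_nonpos q 0) by lra. apply Hlim.
  split.
  + split; [exact I | auto].
  + simpl. unfold R_dist. now rewrite Rminus_0_r.
- apply is_derive_ext_loc with (f := fun z => Rpower z (q + 1)).
  + generalize (locally_gt x 0 H). apply filter_imp.
    intros z Hz. rewrite pw_pos by lra. reflexivity.
  + rewrite pw_pos by easy. apply is_derive_Reals.
    pose proof (derivable_pt_lim_power x (q + 1) H) as Hp.
    replace (q + 1 - 1) with q in Hp by ring. exact Hp.
Qed.

(** * Riemann integrals of continuous functions *)

(* Equations between Coquelicot integrals live in a carrier that is only
   convertible to [R], which [ring] does not see. *)
Ltac eqR := match goal with |- ?a = ?b => change (@eq R a b) end.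

Lemma ex_RInt_cont (f : R -> R) (a b : R) :
  (forall x, continuous f x) -> ex_RInt f a b.
Proof. intros H. apply (ex_RInt_continuous (V := R_CompleteNormedModule)). auto. Qed.

Lemma RInt_Rplus (f g : R -> R) (a b : R) :
  ex_RInt f a b -> ex_RInt g a b ->
  RInt (fun x => f x + g x) a b = RInt f a b + RInt g a b.
Proof. exact (RInt_plus (V := R_CompleteNormedModule) f g a b). Qed.

Lemma RInt_Rminus (f g : R -> R) (a b : R) :
  ex_RInt f a b -> ex_RInt g a b ->
  RInt (fun x => f x - g x) a b = RInt f a b - RInt g a b.
Proof. exact (RInt_minus (V := R_CompleteNormedModule) f g a b). Qed.

Lemma RInt_Rmult (f : R -> R) (c a b : R) :
  ex_RInt f a b -> RInt (fun x => c * f x) a b = c * RInt f a b.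
Proof. exact (RInt_scal (V := R_CompleteNormedModule) f a b c). Qed.

Lemma RInt_eq (f g : R -> R) (a b : R) :
  (forall x, f x = g x) -> RInt f a b = RInt g a b.
Proof. intros H. apply RInt_ext. auto. Qed.

Lemma RInt_zero (a b : R) : RInt (fun _ : R => 0) a b = 0.
Proof.
rewrite (RInt_const (V := R_CompleteNormedModule)). apply Rmult_0_r.
Qed.

Lemma RInt_FTC (f df : R -> R) (a b : R) :
  (forall x, is_derive f x (df x)) -> (forall x, continuous df x) ->
  RInt df a b = f b - f a.
Proof.
intros Hd Hc. apply (is_RInt_unique (V := R_CompleteNormedModule)).
apply (is_RInt_derive (V := R_CompleteNormedModule)); auto.
Qed.

Lemma RInt_symmetric (f : R -> R) (a : R) :
  (forall x, continuous f x) ->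
  RInt f (- a) a = RInt (fun x => f x + f (- x)) 0 a.
Proof.
intros Hf.
assert (Hc : forall x, continuous (fun x => f (- x)) x).
{ intros x. apply (continuous_comp Ropp f); [| apply Hf].
  apply (continuous_opp (V := R_NormedModule) (fun x => x)), continuous_id. }
assert (H := RInt_comp_lin (V := R_CompleteNormedModule) f (-1) 0 0 a).
replace (-1 * 0 + 0) with 0 in H by ring.
replace (-1 * a + 0) with (- a) in H by ring.
specialize (H (ex_RInt_cont _ _ _ Hf)).
rewrite <- (RInt_Chasles (V := R_CompleteNormedModule) f (- a) 0 a)
  by now apply ex_RInt_cont.
rewrite <- (opp_RInt_swap (V := R_CompleteNormedModule) f 0 (- a))
  by now apply ex_RInt_cont.
rewrite RInt_Rplus by now apply ex_RInt_cont.
assert (E : opp (RInt f 0 (- a)) = RInt (fun x => f (- x)) 0 a).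
{ rewrite <- H, <- (RInt_opp (V := R_CompleteNormedModule)).
  - apply RInt_ext. intros x _. unfold opp, scal; simpl; unfold mult; simpl.
    replace (-1 * x + 0) with (- x) by ring. ring.
  - apply ex_RInt_cont. intros x.
    apply continuous_ext with (f := fun y => scal (-1) (f (- y))).
    + intros y. do 2 f_equal. ring.
    + apply (continuous_scal_r (V := R_NormedModule)), Hc. }
rewrite E. apply Rplus_comm.
Qed.

Lemma RInt_reflect (f : R -> R) (a : R) :
  (forall x, continuous f x) ->
  RInt (fun x => f (- x)) (- a) a = RInt f (- a) a.
Proof.
intros Hf. rewrite 2!RInt_symmetric; auto.
- apply RInt_eq. intros x. rewrite Ropp_involutive. ring.
- intros x. apply (continuous_comp Ropp f); [| apply Hf].
  apply (continuous_opp (V := R_NormedModule) (fun x => x)), continuous_id.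
Qed.

(** * Functions of two variables *)

Definition continuous_2d (F : R -> R -> R) : Prop :=
  forall x y, continuity_2d_pt F x y.

(** Uniform continuity on the square gives a step [d] over which [F] varies by less than 1. Walking
    from the origin to [(x, y)] along the segment in [n + 1] equal steps, with [n + 1 > L / d], adds
    at most [n + 1] to the value at the origin. *)
Lemma continuous_2d_bounded (F : R -> R -> R) (L : R) :
  continuous_2d F ->
  exists M, 0 <= M /\
    forall x y, Rabs x <= L -> Rabs y <= L -> Rabs (F x y) <= M.
Proof.
intros HF. destruct (Rlt_dec L 0) as [HL | HL].
{ exists 0. split; [lra |]. intros x y Hx.
  pose proof (Rabs_pos x). lra. }
destruct (uniform_continuity_2d F (- L) L (- L) L
  (fun x y _ _ => HF x y) (mkposreal 1 Rlt_0_1)) as [d Hd].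
simpl in Hd.
destruct (nfloor_ex (L / d)) as [n [_ Hn]].
{ apply Rdiv_le_0_compat; [lra | apply cond_pos]. }
assert (HN : 0 < INR n + 1) by (pose proof (pos_INR n); lra).
assert (Hstep : L / (INR n + 1) < d).
{ apply Rlt_div_l; [lra |]. apply Rlt_div_l in Hn; [| apply cond_pos]. lra. }
exists (Rabs (F 0 0) + (INR n + 1)). split.
{ pose proof (Rabs_pos (F 0 0)). lra. }
intros x y Hx Hy.
assert (Hscale : forall z t, Rabs z <= L -> 0 <= t <= 1 -> - L <= t * z <= L).
{ intros z t Hz Ht. apply Rabs_le_between. rewrite Rabs_mult.
  rewrite (Rabs_pos_eq t) by lra. pose proof (Rabs_pos z). nra. }
assert (Hincr : forall z i, Rabs z <= L ->
  Rabs (INR (S i) / (INR n + 1) * z - INR i / (INR n + 1) * z) < d).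
{ intros z i Hz. rewrite S_INR.
  replace (_ - _) with (/ (INR n + 1) * z) by (field; lra).
  rewrite Rabs_mult, Rabs_pos_eq by (left; apply Rinv_0_lt_compat; lra).
  apply Rle_lt_trans with (2 := Hstep). unfold Rdiv. rewrite Rmult_comm.
  apply Rmult_le_compat_r; [left; apply Rinv_0_lt_compat; lra | easy]. }
assert (Hi : forall i, (i <= S n)%nat -> 0 <= INR i / (INR n + 1) <= 1).
{ intros i Hi. apply le_INR in Hi. rewrite S_INR in Hi.
  pose proof (pos_INR i). split.
  - apply Rdiv_le_0_compat; lra.
  - apply Rle_div_l; lra. }
assert (Hwalk : forall i, (i <= S n)%nat ->
  Rabs (F (INR i / (INR n + 1) * x) (INR i / (INR n + 1) * y))
    <= Rabs (F 0 0) + INR i).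
{ induction i as [| i IH]; intros Hle.
  - simpl. replace (0 / (INR n + 1) * x) with 0 by (field; lra).
    replace (0 / (INR n + 1) * y) with 0 by (field; lra). lra.
  - specialize (IH (Nat.le_trans _ _ _ (Nat.le_succ_diag_r i) Hle)).
    assert (Hi' : (i <= S n)%nat) by lia.
    specialize (Hd (INR i / (INR n + 1) * x) (INR i / (INR n + 1) * y)
      (INR (S i) / (INR n + 1) * x) (INR (S i) / (INR n + 1) * y)
      (Hscale _ _ Hx (Hi i Hi')) (Hscale _ _ Hy (Hi i Hi'))
      (Hscale _ _ Hx (Hi _ Hle)) (Hscale _ _ Hy (Hi _ Hle))
      (Hincr x i Hx) (Hincr y i Hy)).
    rewrite S_INR at 3. apply Rabs_lt_between in Hd.
    apply Rabs_le_between in IH. apply Rabs_le_between. lra. }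
specialize (Hwalk (S n) (Nat.le_refl _)). rewrite S_INR in Hwalk.
replace ((INR n + 1) / (INR n + 1)) with 1 in Hwalk by (field; lra).
now rewrite 2!Rmult_1_l in Hwalk.
Qed.

Lemma continuous_bounded (g : R -> R) (L : R) :
  (forall x, continuous g x) ->
  exists M, 0 <= M /\ forall x, Rabs x <= L -> Rabs (g x) <= M.
Proof.
intros Hg.
destruct (continuous_2d_bounded (fun x _ => g x) L) as [M [HM H]].
{ intros x y. apply (continuity_1d_2d_pt_comp g (fun x _ => x)).
  - apply continuity_pt_filterlim, Hg.
  - apply continuity_2d_pt_id1. }
exists M. split; [easy |]. intros x Hx. now apply (H x x).
Qed.

Lemma continuous_2d_comp (F : R -> R -> R) (a b : R -> R) (x : R) :
  continuity_2d_pt F (a x) (b x) -> continuous a x -> continuous b x ->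
  continuous (fun t => F (a t) (b t)) x.
Proof.
intros HF Ha Hb. apply (continuous_comp_2 a b F); auto.
now apply continuity_2d_pt_filterlim.
Qed.

Lemma continuity_2d_pt_comp (F a b : R -> R -> R) (x y : R) :
  continuity_2d_pt F (a x y) (b x y) ->
  continuity_2d_pt a x y -> continuity_2d_pt b x y ->
  continuity_2d_pt (fun u v => F (a u v) (b u v)) x y.
Proof.
intros HF Ha Hb. apply continuity_2d_pt_filterlim.
apply (continuous_comp_2 (fun z : R * R => a (fst z) (snd z))
  (fun z : R * R => b (fst z) (snd z)) F).
- now apply (proj1 (continuity_2d_pt_filterlim _ _ _)).
- now apply (proj1 (continuity_2d_pt_filterlim _ _ _)).
- now apply continuity_2d_pt_filterlim.
Qed.

Lemma continuity_2d_pt_snd (g : R -> R) (x y : R) :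
  continuous g y -> continuity_2d_pt (fun _ v => g v) x y.
Proof.
intros Hg. apply (continuity_1d_2d_pt_comp g (fun _ v => v)).
- now apply continuity_pt_filterlim.
- apply continuity_2d_pt_id2.
Qed.

(** The partial derivatives are named functions rather than [Derive] terms, so that differential
    equations become plain identities usable by rewriting. *)
Definition C1_with (F Fx Fy : R -> R -> R) : Prop :=
  (forall x y, is_derive (fun u => F u y) x (Fx x y)) /\
  (forall x y, is_derive (fun v => F x v) y (Fy x y)) /\
  continuous_2d Fx /\ continuous_2d Fy.

Lemma differentiable_pt_lim_C1 (F Fx : R -> R -> R) (x y ly : R) :
  locally (x, y)
    (fun z => is_derive (fun u => F u (snd z)) (fst z) (Fx (fst z) (snd z))) ->
  is_derive (fun v => F x v) y ly -> continuity_2d_pt Fx x y ->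
  differentiable_pt_lim F x y (Fx x y) ly.
Proof.
intros Hx Hy Hc. apply filterdiff_differentiable_pt_lim.
apply (is_derive_filterdiff F x y Fx ly Hx Hy).
now apply continuity_2d_pt_filterlim.
Qed.

Lemma C1_with_differentiable (F Fx Fy : R -> R -> R) (x y : R) :
  C1_with F Fx Fy -> differentiable_pt_lim F x y (Fx x y) (Fy x y).
Proof.
intros (Hx & Hy & Hcx & Hcy). apply differentiable_pt_lim_C1; auto.
now apply filter_forall.
Qed.

Lemma C1_with_continuous (F Fx Fy : R -> R -> R) :
  C1_with F Fx Fy -> continuous_2d F.
Proof.
intros H x y. apply differentiable_continuity_pt.
exists (Fx x y), (Fy x y). now apply C1_with_differentiable.
Qed.

Lemma is_derive_C1_comp (F Fx Fy : R -> R -> R) (a b : R -> R) (x la lb : R) :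
  C1_with F Fx Fy -> is_derive a x la -> is_derive b x lb ->
  is_derive (fun t => F (a t) (b t)) x
    (Fx (a x) (b x) * la + Fy (a x) (b x) * lb).
Proof.
intros HF Ha Hb. apply is_derive_Reals.
apply derivable_pt_lim_comp_2d; [now apply C1_with_differentiable | |];
  now apply is_derive_Reals.
Qed.

Lemma is_derive_RInt_param_cont (F dF : R -> R -> R) (a b x : R) :
  (forall r t, is_derive (fun u => F u t) r (dF r t)) ->
  continuous_2d dF -> (forall r t, continuous (F r) t) ->
  is_derive (fun r => RInt (F r) a b) x (RInt (dF x) a b).
Proof.
intros HD Hc HF.
assert (HE : forall r t, Derive (fun u => F u t) r = dF r t).
{ intros r t. apply is_derive_unique, HD. }
rewrite <- (RInt_ext (fun t => Derive (fun u => F u t) x) (dF x))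
  by (intros t _; apply HE).
apply is_derive_RInt_param.
- apply filter_forall. intros r t _. exists (dF r t). apply HD.
- intros t _. apply continuity_2d_pt_ext with (f := dF).
  + intros r s. symmetry. apply HE.
  + apply Hc.
- apply filter_forall. intros r. now apply ex_RInt_cont.
Qed.

Lemma Rabs_increment_le (f df : R -> R) (a b M : R) :
  (forall x, is_derive f x (df x)) ->
  (forall x, Rmin a b <= x <= Rmax a b -> Rabs (df x) <= M) ->
  Rabs (f b - f a) <= M * Rabs (b - a).
Proof.
intros Hd HM. destruct (MVT_gen f a b df) as [c [Hc Heq]].
- auto.
- intros x _. apply continuity_pt_filterlim.
  apply (ex_derive_continuous f). exists (df x). apply Hd.
- rewrite Heq, Rabs_mult. apply Rmult_le_compat_r; [apply Rabs_pos | auto].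
Qed.

(** * Euler's Gamma function *)

Lemma continuous_Rpower (q t : R) : 0 < t -> continuous (fun x => Rpower x q) t.
Proof.
intros Ht. apply (ex_derive_continuous (fun x => Rpower x q)).
exists (q * Rpower t (q - 1)). apply is_derive_Reals.
now apply derivable_pt_lim_power.
Qed.

Lemma ex_RInt_pos (f : R -> R) (a b : R) :
  (forall t, 0 < t -> continuous f t) -> 0 < a -> a <= b -> ex_RInt f a b.
Proof.
intros Hf Ha Hab. apply (ex_RInt_continuous (V := R_CompleteNormedModule)).
intros z. rewrite Rmin_left, Rmax_right by easy. intros Hz. apply Hf. lra.
Qed.

(** For a nonnegative integrand the integral grows with the interval, so the supremum over all
    [[a, b]] is also the limit. *)
Lemma is_RInt_gen_bounded (f : R -> R) (M : R) :
  (forall t, 0 < t -> continuous f t) -> (forall t, 0 < t -> 0 <= f t) ->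
  (forall a b, 0 < a -> a <= b -> RInt f a b <= M) ->
  exists l, is_RInt_gen f (at_right 0) (Rbar_locally p_infty) l /\
    forall a b, 0 < a -> a <= b -> RInt f a b <= l.
Proof.
intros Hc Hpos HM.
destruct (completeness (fun z => exists a b, 0 < a /\ a <= b /\ z = RInt f a b))
  as [l [Hub Hlub]].
{ exists M. intros z (a & b & Ha & Hab & ->). auto. }
{ exists (RInt f 1 1), 1, 1. repeat split; lra. }
assert (Hl : forall a b, 0 < a -> a <= b -> RInt f a b <= l).
{ intros a b Ha Hab. apply Hub. now exists a, b. }
exists l. split; [| exact Hl].
intros P [eps HP].
assert (Hex : exists a0 b0, 0 < a0 /\ a0 <= b0 /\ l - eps < RInt f a0 b0).
{ apply Classical_Prop.NNPP. intros Hn.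
  assert (Hle : l <= l - eps).
  { apply Hlub. intros z (a & b & Ha & Hab & ->).
    apply Rnot_lt_le. intros Hlt. apply Hn. now exists a, b. }
  pose proof (cond_pos eps). lra. }
destruct Hex as (a0 & b0 & Ha0 & Hab0 & Hlt).
exists (fun a => 0 < a < a0) (fun b => b0 < b).
- exists (mkposreal a0 Ha0). intros a Ha Ha'. split; [easy |].
  apply Rabs_lt_between in Ha. simpl in Ha. unfold minus, plus, opp in Ha.
  simpl in Ha. lra.
- exists b0. auto.
- intros a b Ha Hb. simpl.
  exists (RInt f a b). split.
  { apply (RInt_correct (V := R_CompleteNormedModule)), ex_RInt_pos; lra || auto. }
  apply HP. apply Rabs_lt_between. unfold minus, plus, opp; simpl.
  assert (H : RInt f a0 b0 <= RInt f a b).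
  { rewrite <- (RInt_Chasles (V := R_CompleteNormedModule) f a a0 b),
      <- (RInt_Chasles (V := R_CompleteNormedModule) f a0 b0 b);
      try (apply ex_RInt_pos; lra || auto).
    unfold plus; simpl.
    assert (0 <= RInt f a a0).
    { apply RInt_ge_0; [lra | apply ex_RInt_pos; lra || auto |].
      intros; apply Hpos; lra. }
    assert (0 <= RInt f b0 b).
    { apply RInt_ge_0; [lra | apply ex_RInt_pos; lra || auto |].
      intros; apply Hpos; lra. }
    lra. }
  assert (RInt f a b <= l) by (apply Hl; lra).
  split; lra.
Qed.

Lemma is_RInt_gen_ge_0 (f : R -> R) (l : R) :
  (forall t, 0 < t -> 0 <= f t) ->
  is_RInt_gen f (at_right 0) (Rbar_locally p_infty) l -> 0 <= l.
Proof.
intros Hpos Hf. apply Rnot_lt_le. intros Hl.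
destruct (Hf (fun z => z < 0) (locally_lt l 0 Hl)) as [Q S [d HQ] [N HS] HQS].
pose proof (cond_pos d) as Hd.
destruct (HQS (d / 2) (Rmax (N + 1) d)) as [z [Hz Hz0]].
- apply HQ; [| lra]. apply Rabs_lt_between. unfold minus, plus, opp; simpl. lra.
- apply HS. pose proof (Rmax_l (N + 1) d). lra.
- simpl in Hz. pose proof (Rmax_r (N + 1) d).
  assert (Hge : 0 <= z); [| lra].
  rewrite <- (is_RInt_unique (V := R_CompleteNormedModule) _ _ _ _ Hz).
  apply RInt_ge_0; [lra | now exists z |]. intros t Ht. apply Hpos. lra.
Qed.

Lemma is_RInt_gen_FTC (F f : R -> R) (la lb : R) :
  (forall t, 0 < t -> is_derive F t (f t)) ->
  (forall t, 0 < t -> continuous f t) ->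
  filterlim F (at_right 0) (locally la) ->
  filterlim F (Rbar_locally p_infty) (locally lb) ->
  is_RInt_gen f (at_right 0) (Rbar_locally p_infty) (lb - la).
Proof.
intros Hd Hc Hla Hlb.
assert (Hev : filter_prod (at_right 0) (Rbar_locally p_infty)
  (fun ab => 0 < fst ab /\ 0 < snd ab)).
{ exists (fun a => 0 < a) (fun b => 0 < b); [| now exists 0 | auto].
  now exists (mkposreal 1 Rlt_0_1). }
assert (Hmin : forall a b x, 0 < a /\ 0 < b -> Rmin a b <= x -> 0 < x).
{ intros a b x [Ha Hb] Hx. apply Rlt_le_trans with (2 := Hx).
  now apply Rmin_glb_lt. }
apply (is_RInt_gen_ext (V := R_NormedModule) (Derive F) f).
- revert Hev. apply filter_imp. intros [a b] Hab x Hx. simpl in *.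
  apply is_derive_unique, Hd. apply (Hmin a b); [easy | lra].
- apply is_RInt_gen_Derive; auto.
  + revert Hev. apply filter_imp. intros [a b] Hab x Hx. simpl in *.
    exists (f x). apply Hd. now apply (Hmin a b).
  + revert Hev. apply filter_imp. intros [a b] Hab x Hx. simpl in *.
    assert (Hx0 : 0 < x) by now apply (Hmin a b).
    apply continuous_ext_loc with (g := f); [| now apply Hc].
    generalize (locally_gt x 0 Hx0). apply filter_imp.
    intros z Hz. symmetry. now apply is_derive_unique, Hd.
Qed.

Definition Gamma_integrand (s t : R) : R := Rpower t (s - 1) * exp (- t).

Lemma continuous_Gamma_integrand (s t : R) :
  0 < t -> continuous (Gamma_integrand s) t.
Proof.
intros Ht.
apply (continuous_mult (K := R_AbsRing) (fun x => Rpower x (s - 1)) (fun x => exp (- x))).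
- now apply continuous_Rpower.
- apply (ex_derive_continuous (fun x => exp (- x))). auto_derive. easy.
Qed.

Lemma Gamma_integrand_gt_0 (s t : R) : 0 < Gamma_integrand s t.
Proof. apply Rmult_lt_0_compat; apply exp_pos. Qed.

(** [t ^ q * exp (- t)] is largest at [t = q]; in logarithms this is [ln (t / q) <= t / q - 1]. The
    extra factor [exp (- q)] is dropped from the bound. *)
Lemma Rpower_le_exp (q t : R) : 0 < q -> 0 < t -> Rpower t q <= Rpower q q * exp t.
Proof.
intros Hq Ht. unfold Rpower. rewrite <- exp_plus.
assert (H : q * ln t <= q * ln q + t).
{ assert (Hln : ln (t / q) <= t / q - 1).
  { assert (Htq : 0 < t / q) by now apply Rdiv_lt_0_compat.
    pose proof (exp_ineq1_le (ln (t / q))) as He.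
    rewrite exp_ln in He; lra. }
  rewrite ln_div in Hln by easy.
  apply Rmult_le_compat_l with (r := q) in Hln; [| lra].
  replace (q * (t / q - 1)) with (t - q) in Hln by (field; lra). lra. }
destruct H as [H | H].
- left. now apply exp_increasing.
- right. now f_equal.
Qed.

(* With [K] bounding [(1 + t^s)^2 exp (-t)], the integrand is dominated by
   [K t^(s-1) / (1 + t^s)^2], the derivative of [- K / (s (1 + t^s))]. *)
Lemma RInt_Gamma_integrand_bounded (s : R) : 0 < s ->
  exists M, forall a b, 0 < a -> a <= b -> RInt (Gamma_integrand s) a b <= M.
Proof.
intros Hs. set (K := 2 + 2 * Rpower (2 * s) (2 * s)).
assert (HK : 0 < K) by (unfold K; pose proof (Rpower_gt_0 (2 * s) (2 * s)); lra).
exists (K / s). intros a b Ha Hab.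
set (F := fun t => - (K / s) * / (1 + Rpower t s)).
set (f := fun t => K * Rpower t (s - 1) / (1 + Rpower t s) ^ 2).
assert (Hd : forall t, 0 < t -> is_derive F t (f t)).
{ intros t Ht. pose proof (Rpower_gt_0 t s).
  assert (Hp : is_derive (fun x => Rpower x s) t (s * Rpower t (s - 1)))
    by now apply is_derive_Reals, derivable_pt_lim_power.
  unfold F, f. auto_derive; [repeat split; [now eexists; exact Hp | lra] |].
  replace (Derive (fun x => Rpower x s) t) with (s * Rpower t (s - 1))
    by (symmetry; now apply is_derive_unique).
  field. lra. }
assert (Hfc : forall t, 0 < t -> continuous f t).
{ intros t Ht. pose proof (Rpower_gt_0 t s). unfold f, Rdiv.
  apply (continuous_mult (K := R_AbsRing) (fun x => K * Rpower x (s - 1))).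
  - apply (continuous_mult (K := R_AbsRing) (fun x => K)); [apply continuous_const |].
    now apply continuous_Rpower.
  - apply (continuous_comp (fun x => Rpower x s) (fun z => / (1 + z) ^ 2)).
    + now apply continuous_Rpower.
    + apply (ex_derive_continuous (fun z => / (1 + z) ^ 2)). auto_derive.
      assert (0 < 1 + Rpower t s) by lra. nra. }
apply Rle_trans with (RInt f a b).
- apply RInt_le; [easy | | |].
  + apply ex_RInt_pos; auto. intros; now apply continuous_Gamma_integrand.
  + now apply ex_RInt_pos.
  + intros t Ht. unfold Gamma_integrand, f.
    assert (Ht0 : 0 < t) by lra.
    pose proof (Rpower_gt_0 t s) as Hts.
    pose proof (Rpower_gt_0 t (s - 1)) as Hts1.
    (* With [T = t ^ s], [(1 + T) ^ 2 <= 2 + 2 T ^ 2], and [T ^ 2 = t ^ (2 s)] is at most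
       [(2 s) ^ (2 s) * exp t]; this is where the value of [K] comes from. *)
    assert (HKt : (1 + Rpower t s) ^ 2 <= K * exp t).
    { pose proof (Rpower_le_exp (2 * s) t ltac:(lra) Ht0) as H2.
      replace (Rpower t (2 * s)) with (Rpower t s * Rpower t s) in H2
        by (rewrite <- Rpower_plus; f_equal; ring).
      assert (1 <= exp t) by (pose proof (exp_ineq1_le t); lra).
      pose proof (pow2_ge_0 (1 - Rpower t s)). unfold K. nra. }
    rewrite exp_Ropp. pose proof (exp_pos t) as Het.
    assert (Hsq : 0 < (1 + Rpower t s) ^ 2) by (apply pow_lt; lra).
    apply Rmult_le_reg_r with (exp t * (1 + Rpower t s) ^ 2);
      [now apply Rmult_lt_0_compat |].
    replace (_ * / exp t * _)
      with (Rpower t (s - 1) * (1 + Rpower t s) ^ 2) by (field; lra).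
    replace (_ / _ * _) with (Rpower t (s - 1) * (K * exp t)) by (field; lra).
    apply Rmult_le_compat_l; lra.
- assert (HF : RInt f a b = F b - F a).
  { apply (is_RInt_unique (V := R_CompleteNormedModule)).
    apply (is_RInt_derive (V := R_CompleteNormedModule));
      rewrite Rmin_left, Rmax_right by easy; intros x Hx;
      [apply Hd | apply Hfc]; lra. }
  rewrite HF. unfold F.
  pose proof (Rpower_gt_0 b s). pose proof (Rpower_gt_0 a s).
  assert (0 < K / s) by now apply Rdiv_lt_0_compat.
  assert (0 < / (1 + Rpower b s)) by (apply Rinv_0_lt_compat; lra).
  assert (/ (1 + Rpower a s) < 1).
  { rewrite <- Rinv_1 at 2. apply Rinv_lt_contravar; lra. }
  nra.
Qed.

Lemma is_RInt_gen_Gamma (s : R) : 0 < s ->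
  is_RInt_gen (Gamma_integrand s) (at_right 0) (Rbar_locally p_infty) (Gamma s)
  /\ forall a b, 0 < a -> a <= b -> RInt (Gamma_integrand s) a b <= Gamma s.
Proof.
intros Hs. destruct (RInt_Gamma_integrand_bounded s Hs) as [M HM].
destruct (is_RInt_gen_bounded (Gamma_integrand s) M) as [l [Hl Hle]]; auto.
- intros; now apply continuous_Gamma_integrand.
- intros; left; apply Gamma_integrand_gt_0.
- replace (Gamma s) with l; [easy |]. symmetry.
  apply (is_RInt_gen_unique (V := R_CompleteNormedModule)
    (Fa := at_right 0) (Fb := Rbar_locally p_infty) _ _ Hl).
Qed.

Lemma Gamma_gt_0 (s : R) : 0 < s -> 0 < Gamma s.
Proof.
intros Hs. destruct (is_RInt_gen_Gamma s Hs) as [_ Hle].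
apply Rlt_le_trans with (2 := Hle 1 2 Rlt_0_1 ltac:(lra)).
apply RInt_gt_0; [lra | intros; apply Gamma_integrand_gt_0 |].
intros x Hx. apply continuous_Gamma_integrand. lra.
Qed.

(** Integration by parts against [- t ^ s * exp (- t)], which vanishes at both ends: at 0 by
    continuity of [pw s], at infinity because it is bounded by [K / t] with
    [K = (s + 1) ^ (s + 1)]. *)
Lemma Gamma_succ (s : R) : 0 < s -> Gamma (s + 1) = s * Gamma s.
Proof.
intros Hs.
assert (H1 : is_RInt_gen
  (fun t => minus (Gamma_integrand (s + 1) t) (scal s (Gamma_integrand s t)))
  (at_right 0) (Rbar_locally p_infty) (minus (Gamma (s + 1)) (scal s (Gamma s)))).
{ apply (is_RInt_gen_minus (V := R_NormedModule)).
  - apply is_RInt_gen_Gamma. lra.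
  - apply (is_RInt_gen_scal (V := R_NormedModule)).
    now apply is_RInt_gen_Gamma. }
assert (H0 : is_RInt_gen
  (fun t => minus (Gamma_integrand (s + 1) t) (scal s (Gamma_integrand s t)))
  (at_right 0) (Rbar_locally p_infty) (0 - 0)).
{ apply (is_RInt_gen_FTC (fun t => - (Rpower t s * exp (- t)))).
  - intros t Ht. unfold minus, plus, opp, scal; simpl. unfold mult; simpl.
    unfold Gamma_integrand.
    assert (Hp : is_derive (fun x => Rpower x s) t (s * Rpower t (s - 1)))
      by now apply is_derive_Reals, derivable_pt_lim_power.
    auto_derive; [now eexists; exact Hp |].
    replace (Derive (fun x => Rpower x s) t) with (s * Rpower t (s - 1))
      by (symmetry; now apply is_derive_unique).
    replace (s + 1 - 1) with s by ring. ring.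
  - intros t Ht. apply (continuous_minus (V := R_NormedModule)).
    + now apply continuous_Gamma_integrand.
    + apply (continuous_scal_r (V := R_NormedModule)).
      now apply continuous_Gamma_integrand.
  - assert (Hz : continuous (fun t => - (pw s t * exp (- t))) 0).
    { apply (continuous_opp (V := R_NormedModule) (fun t => pw s t * exp (- t))).
      apply (continuous_mult (K := R_AbsRing) (pw s)); [now apply continuous_pw |].
      apply (ex_derive_continuous (fun x => exp (- x))). auto_derive. easy. }
    unfold continuous in Hz. rewrite (pw_nonpos s 0), Rmult_0_l, Ropp_0 in Hz by lra.
    apply filterlim_within_ext with (f := fun t => - (pw s t * exp (- t))).
    + intros t Ht. now rewrite pw_pos.
    + intros P HP. apply filter_le_within, Hz, HP.
  - set (K := Rpower (s + 1) (s + 1)).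
    assert (HK : 0 < K) by apply Rpower_gt_0.
    intros P [eps HP]. pose proof (cond_pos eps) as Heps.
    exists (K / eps). intros t Ht. apply HP.
    assert (HKe : 0 < K / eps) by now apply Rdiv_lt_0_compat.
    assert (Ht0 : 0 < t) by lra.
    unfold ball; simpl; unfold AbsRing_ball; simpl.
    unfold abs, minus, plus, opp; simpl.
    rewrite Ropp_0, Rplus_0_r, Rabs_Ropp, exp_Ropp.
    pose proof (exp_pos t) as Het. pose proof (Rpower_gt_0 t s) as Hts.
    rewrite Rabs_pos_eq
      by (left; apply Rmult_lt_0_compat; [easy | now apply Rinv_0_lt_compat]).
    pose proof (Rpower_le_exp (s + 1) t ltac:(lra) Ht0) as Hle.
    rewrite Rpower_plus, Rpower_1 in Hle by easy. fold K in Hle.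
    apply Rlt_div_l in Ht; [| easy].
    apply Rmult_lt_reg_r with (t * exp t); [nra |].
    replace (_ * / exp t * (t * exp t)) with (Rpower t s * t) by (field; lra).
    nra. }
pose proof (is_RInt_gen_unique (V := R_CompleteNormedModule)
  (Fa := at_right 0) (Fb := Rbar_locally p_infty) _ _ H1) as E1.
pose proof (is_RInt_gen_unique (V := R_CompleteNormedModule)
  (Fa := at_right 0) (Fb := Rbar_locally p_infty) _ _ H0) as E0.
assert (E : minus (Gamma (s + 1)) (scal s (Gamma s)) = 0 - 0)
  by (rewrite <- E1; exact E0).
unfold minus, plus, opp, scal in E; simpl in E. unfold mult in E; simpl in E. lra.
Qed.

(* Integrated form of [2 t^(s-1/2) <= theta t^(s-1) + t^s / theta]; optimizing
   over [theta] gives midpoint log-convexity. *)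
Lemma Gamma_midpoint (s theta : R) : 0 < s -> 0 < theta ->
  2 * Gamma (s + / 2) <= theta * Gamma s + / theta * Gamma (s + 1).
Proof.
intros Hs Hth.
assert (H : is_RInt_gen
  (fun t => minus (plus (scal theta (Gamma_integrand s t))
                        (scal (/ theta) (Gamma_integrand (s + 1) t)))
                  (scal 2 (Gamma_integrand (s + / 2) t)))
  (at_right 0) (Rbar_locally p_infty)
  (minus (plus (scal theta (Gamma s)) (scal (/ theta) (Gamma (s + 1))))
         (scal 2 (Gamma (s + / 2))))).
{ apply (is_RInt_gen_minus (V := R_NormedModule));
    [apply (is_RInt_gen_plus (V := R_NormedModule)) |];
    apply (is_RInt_gen_scal (V := R_NormedModule));
    apply is_RInt_gen_Gamma; lra. }
apply is_RInt_gen_ge_0 in H.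
- unfold minus, plus, opp, scal in H; simpl in H. unfold mult in H; simpl in H. lra.
- intros t Ht. unfold minus, plus, opp, scal; simpl. unfold mult; simpl.
  unfold Gamma_integrand.
  replace (s + 1 - 1) with (s - 1 + / 2 + / 2) by field.
  replace (s + / 2 - 1) with (s - 1 + / 2) by field.
  rewrite !(Rpower_plus _ _ t).
  pose proof (Rpower_gt_0 t (s - 1)) as Hp.
  set (r := Rpower t (/ 2)). set (w := Rpower t (s - 1)) in *.
  pose proof (exp_pos (- t)) as He.
  replace (_ + - _) with (w * exp (- t) * / theta * (theta - r) ^ 2)
    by (field; lra).
  apply Rmult_le_pos; [| apply pow2_ge_0].
  left. apply Rmult_lt_0_compat; [nra | now apply Rinv_0_lt_compat].
Qed.

(** Since [Gamma (s + 1) = s * Gamma s], the choice [theta = sqrt s] makes the two terms on the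
    right of [Gamma_midpoint] equal. *)
Lemma Gamma_half_step_le (s : R) : 0 < s -> Gamma (s + / 2) <= sqrt s * Gamma s.
Proof.
intros Hs. pose proof (sqrt_lt_R0 s Hs) as Hr.
pose proof (Gamma_midpoint s (sqrt s) Hs Hr) as H.
rewrite Gamma_succ in H by easy.
replace (/ sqrt s * (s * Gamma s)) with (sqrt s * Gamma s) in H; [lra |].
symmetry. transitivity (/ sqrt s * ((sqrt s * sqrt s) * Gamma s)).
- now rewrite sqrt_sqrt by lra.
- field. lra.
Qed.

(** * Wallis integrals with a real exponent *)

Definition cosw (p th : R) : R := pw p (cos th).
Definition wallis (p : R) : R := RInt (cosw p) 0 (PI / 2).

Lemma continuous_cosw (p th : R) : 0 < p -> continuous (cosw p) th.
Proof.
intros Hp. apply (continuous_comp cos (pw p)).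
- apply continuous_cos.
- now apply continuous_pw.
Qed.

Lemma cosw_succ (p th : R) : cosw (p + 1) th = cos th * cosw p th.
Proof. apply pw_succ. Qed.

Lemma is_derive_cosw (p th : R) :
  0 < p -> is_derive (cosw (p + 1)) th (- (p + 1) * sin th * cosw p th).
Proof.
intros Hp. replace (- (p + 1) * sin th * cosw p th)
  with (scal (- sin th) ((p + 1) * pw p (cos th)))
  by (unfold scal, cosw; simpl; unfold mult; simpl; ring).
apply (is_derive_comp (K := R_AbsRing) (V := R_NormedModule) (pw (p + 1)) cos).
- now apply is_derive_pw.
- apply is_derive_cos.
Qed.

Lemma cos_gt_0_quarter (th : R) : 0 < th < PI / 2 -> 0 < cos th.
Proof. intros H. apply cos_gt_0; lra. Qed.

Lemma wallis_gt_0 (p : R) : 0 < p -> 0 < wallis p.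
Proof.
intros Hp. pose proof PI_RGT_0. apply RInt_gt_0.
- lra.
- intros x Hx. unfold cosw. rewrite pw_pos by now apply cos_gt_0_quarter.
  apply Rpower_gt_0.
- intros; now apply continuous_cosw.
Qed.

Lemma wallis_decreasing (p r : R) : 0 < p -> p <= r -> wallis r <= wallis p.
Proof.
intros Hp Hpr. pose proof PI_RGT_0. apply RInt_le.
- lra.
- apply ex_RInt_cont. intros; apply continuous_cosw; lra.
- apply ex_RInt_cont. intros; apply continuous_cosw; lra.
- intros x Hx. pose proof (cos_gt_0_quarter x Hx) as Hc.
  unfold cosw. rewrite 2!pw_pos by easy.
  unfold Rpower.
  assert (Hln : ln (cos x) <= 0).
  { destruct (COS_bound x) as [_ [Hlt | Heq]].
    - left. rewrite <- ln_1. now apply ln_increasing.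
    - rewrite Heq, ln_1. lra. }
  destruct (Rle_lt_or_eq_dec (r * ln (cos x)) (p * ln (cos x))) as [Hl | Hl].
  + nra.
  + left. now apply exp_increasing.
  + rewrite Hl. lra.
Qed.

Lemma cosw_0_half_pi (p : R) : cosw p (PI / 2) = 0.
Proof. unfold cosw. rewrite cos_PI2. apply pw_nonpos. lra. Qed.

(** The derivative of [sin * cos ^ (p + 1)] is [(p + 2) cos ^ (p + 2) - (p + 1) cos ^ p], and this
    function vanishes at both end points. *)
Lemma wallis_succ2 (p : R) : 0 < p -> wallis (p + 2) = (p + 1) / (p + 2) * wallis p.
Proof.
intros Hp.
assert (Hc : forall th, continuous (cosw p) th) by (intros; now apply continuous_cosw).
assert (Hc2 : forall th, continuous (cosw (p + 2)) th)
  by (intros; apply continuous_cosw; lra).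
assert (H : RInt (fun th => (p + 2) * cosw (p + 2) th - (p + 1) * cosw p th) 0 (PI / 2)
  = sin (PI / 2) * cosw (p + 1) (PI / 2) - sin 0 * cosw (p + 1) 0).
{ apply (RInt_FTC (fun th => sin th * cosw (p + 1) th)).
  - intros th.
    replace (_ - _) with
      (plus (mult (cos th) (cosw (p + 1) th))
            (mult (sin th) (- (p + 1) * sin th * cosw p th))).
    + apply (is_derive_mult (K := R_AbsRing) sin (cosw (p + 1))).
      * apply is_derive_sin.
      * now apply is_derive_cosw.
      * intros; apply Rmult_comm.
    + unfold plus, mult; simpl. replace (p + 2) with (p + 1 + 1) by ring.
      rewrite !cosw_succ. pose proof (sin2_cos2 th) as E. unfold Rsqr in E.
      replace (sin th * (- (p + 1) * sin th * cosw p th))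
        with (- (p + 1) * (sin th * sin th) * cosw p th) by ring.
      replace (sin th * sin th) with (1 - cos th * cos th) by lra. ring.
  - intros th. apply (continuous_minus (V := R_NormedModule));
      apply (continuous_scal_r (V := R_NormedModule)); auto. }
rewrite RInt_Rminus, 2!RInt_Rmult, cosw_0_half_pi, sin_0 in H;
  try (apply ex_RInt_cont; intros); auto;
  try (apply (continuous_scal_r (V := R_NormedModule)); auto).
fold (wallis (p + 2)) (wallis p) in H.
apply Rmult_eq_reg_l with (p + 2); [| lra].
replace ((p + 2) * ((p + 1) / (p + 2) * wallis p)) with ((p + 1) * wallis p)
  by (field; lra).
lra.
Qed.

Lemma wallis_1 : wallis 1 = 1.
Proof.
pose proof PI_RGT_0. unfold wallis.
rewrite (RInt_ext _ cos).
- rewrite (RInt_FTC sin cos).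
  + rewrite sin_PI2, sin_0. ring.
  + apply is_derive_sin.
  + apply continuous_cos.
- intros x. rewrite Rmin_left, Rmax_right by lra. intros Hx.
  unfold cosw. rewrite pw_pos by now apply cos_gt_0_quarter.
  apply Rpower_1. now apply cos_gt_0_quarter.
Qed.

Lemma wallis_2 : wallis 2 = PI / 4.
Proof.
pose proof PI_RGT_0. unfold wallis.
rewrite (RInt_ext _ (fun x => cos x * cos x)).
- rewrite (RInt_FTC (fun x => (x + sin x * cos x) / 2) (fun x => cos x * cos x)).
  + rewrite sin_0, cos_PI2. field.
  + intros x. auto_derive; [easy |].
    pose proof (sin2_cos2 x) as E. unfold Rsqr in E. lra.
  + intros x. apply (ex_derive_continuous (fun x => cos x * cos x)).
    auto_derive. easy.
- intros x. rewrite Rmin_left, Rmax_right by lra. intros Hx.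
  pose proof (cos_gt_0_quarter x Hx) as Hc.
  unfold cosw. rewrite pw_pos by easy.
  replace 2 with (1 + 1) by ring. now rewrite Rpower_plus, Rpower_1.
Qed.

(** [wallis p] divided by its expected value, up to the factor [sqrt PI / 2]: a quotient to be shown
    independent of [p]. *)
Definition wallis_Gamma (p : R) : R :=
  wallis p * Gamma (p / 2 + 1) / Gamma (p / 2 + / 2).

Lemma wallis_Gamma_gt_0 (p : R) : 0 < p -> 0 < wallis_Gamma p.
Proof.
intros Hp. apply Rdiv_lt_0_compat; [apply Rmult_lt_0_compat |].
- now apply wallis_gt_0.
- apply Gamma_gt_0. lra.
- apply Gamma_gt_0. lra.
Qed.

Lemma wallis_Gamma_succ2 (p : R) : 0 < p -> wallis_Gamma (p + 2) = wallis_Gamma p.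
Proof.
intros Hp. unfold wallis_Gamma. rewrite wallis_succ2 by easy.
replace ((p + 2) / 2 + 1) with (p / 2 + 1 + 1) by field.
replace ((p + 2) / 2 + / 2) with (p / 2 + / 2 + 1) by field.
rewrite (Gamma_succ (p / 2 + 1)), (Gamma_succ (p / 2 + / 2)) by lra.
pose proof (Gamma_gt_0 (p / 2 + / 2) ltac:(lra)).
field. lra.
Qed.

Lemma wallis_Gamma_periodic (p : R) (n : nat) :
  0 < p -> wallis_Gamma (p + 2 * INR n) = wallis_Gamma p.
Proof.
intros Hp. induction n as [| n IH].
- simpl. f_equal. ring.
- rewrite S_INR, <- IH. pose proof (pos_INR n).
  rewrite <- (wallis_Gamma_succ2 (p + 2 * INR n)) by lra. f_equal. ring.
Qed.

(** [Gamma_half_step_le] at [p / 2] and at [p / 2 + / 2] encloses the Gamma quotient. The ratio of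
    the two bounds tends to 1 as [p] grows, so comparisons made at large [p] become sharp. *)
Lemma wallis_Gamma_bounds (p : R) : 0 < p ->
  wallis p * sqrt (p / 2) <= wallis_Gamma p <= wallis p * sqrt (p / 2 + / 2).
Proof.
intros Hp. pose proof (wallis_gt_0 p Hp) as HW.
pose proof (Gamma_gt_0 (p / 2 + / 2) ltac:(lra)) as HG.
unfold wallis_Gamma.
replace (wallis p * Gamma (p / 2 + 1) / Gamma (p / 2 + / 2))
  with (wallis p * (Gamma (p / 2 + 1) / Gamma (p / 2 + / 2))) by (field; lra).
split; apply Rmult_le_compat_l; try lra.
- apply Rle_div_r; [easy |]. rewrite Gamma_succ by lra.
  pose proof (Gamma_half_step_le (p / 2) ltac:(lra)) as H.
  pose proof (sqrt_lt_R0 (p / 2) ltac:(lra)) as Hs.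
  apply Rmult_le_compat_l with (r := sqrt (p / 2)) in H; [| lra].
  rewrite <- Rmult_assoc, sqrt_sqrt in H by lra. exact H.
- apply Rle_div_l; [easy |].
  pose proof (Gamma_half_step_le (p / 2 + / 2) ltac:(lra)) as H.
  replace (p / 2 + / 2 + / 2) with (p / 2 + 1) in H by field. exact H.
Qed.

(** By periodicity the comparison may be made at [p + 2 n] and [r + 2 n]. There the bounds and the
    monotonicity of [wallis] give [b ^ 2 (p + 2 n) <= a ^ 2 (r + 2 n + 1)], where [a] and [b] are
    the values at [p] and [r]; for large [n] this excludes [a < b]. *)
Lemma wallis_Gamma_decreasing (p r : R) :
  0 < p -> p <= r -> wallis_Gamma r <= wallis_Gamma p.
Proof.
intros Hp Hpr. pose proof (wallis_Gamma_gt_0 p Hp) as Hhp.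
pose proof (wallis_Gamma_gt_0 r ltac:(lra)) as Hhr.
apply Rnot_lt_le. intros Hlt.
set (a := wallis_Gamma p) in *. set (b := wallis_Gamma r) in *.
assert (Hn : forall n, b * b * (p + 2 * INR n) <= a * a * (r + 2 * INR n + 1)).
{ intros n. pose proof (pos_INR n).
  destruct (wallis_Gamma_bounds (p + 2 * INR n) ltac:(lra)) as [H1 _].
  destruct (wallis_Gamma_bounds (r + 2 * INR n) ltac:(lra)) as [_ H2].
  rewrite wallis_Gamma_periodic in H1, H2 by lra. fold a in H1. fold b in H2.
  pose proof (wallis_decreasing (p + 2 * INR n) (r + 2 * INR n) ltac:(lra) ltac:(lra)) as H3.
  pose proof (wallis_gt_0 (r + 2 * INR n) ltac:(lra)) as H4.
  set (P := (p + 2 * INR n) / 2) in *.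
  set (Q := (r + 2 * INR n) / 2 + / 2) in *.
  assert (HP : 0 < P) by (unfold P; lra). assert (HQ : 0 < Q) by (unfold Q; lra).
  pose proof (sqrt_lt_R0 P HP) as HsP. pose proof (sqrt_lt_R0 Q HQ) as HsQ.
  assert (H5 : b * sqrt P <= a * sqrt Q).
  { apply Rle_trans with (wallis (p + 2 * INR n) * sqrt Q * sqrt P).
    - apply Rmult_le_compat_r; [lra |]. apply Rle_trans with (1 := H2).
      apply Rmult_le_compat_r; lra.
    - replace (wallis (p + 2 * INR n) * sqrt Q * sqrt P)
        with (wallis (p + 2 * INR n) * sqrt P * sqrt Q) by ring.
      apply Rmult_le_compat_r; lra. }
  assert (H6 : (b * sqrt P) * (b * sqrt P) <= (a * sqrt Q) * (a * sqrt Q)).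
  { apply Rmult_le_compat; try easy; apply Rmult_le_pos; lra. }
  replace (b * sqrt P * (b * sqrt P)) with (b * b * (sqrt P * sqrt P)) in H6 by ring.
  replace (a * sqrt Q * (a * sqrt Q)) with (a * a * (sqrt Q * sqrt Q)) in H6 by ring.
  rewrite 2!sqrt_sqrt in H6 by lra. unfold P, Q in H6. lra. }
assert (Hd : 0 < b * b - a * a) by nra.
destruct (nfloor_ex (a * a * (r + 1) / (b * b - a * a))) as [n [_ Hfl]].
{ apply Rdiv_le_0_compat; [| easy]. apply Rmult_le_pos; nra. }
specialize (Hn (S n)). rewrite S_INR in Hn.
apply Rlt_div_l in Hfl; [| easy]. pose proof (pos_INR n). nra.
Qed.

(** A periodic function that never increases is constant: shifting [r] by an even integer beyond [p]
    gives one inequality, exchanging the roles gives the other. *)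
Lemma wallis_Gamma_constant (p r : R) :
  0 < p -> 0 < r -> wallis_Gamma p = wallis_Gamma r.
Proof.
assert (H : forall p r, 0 < p -> 0 < r -> wallis_Gamma r <= wallis_Gamma p).
{ clear p r. intros p r Hp Hr.
  destruct (nfloor_ex p ltac:(lra)) as [n [_ Hn]].
  rewrite <- (wallis_Gamma_periodic r (S n)) by easy.
  apply wallis_Gamma_decreasing; [easy |]. rewrite S_INR.
  pose proof (pos_INR n). lra. }
intros Hp Hr. apply Rle_antisym; auto.
Qed.

(* The common value [h] satisfies [h^2 = h(1) h(2) = PI / 4]. *)
Lemma wallis_eq_Gamma (p : R) : 0 < p ->
  wallis p = sqrt PI / 2 * Gamma (p / 2 + / 2) / Gamma (p / 2 + 1).
Proof.
intros Hp. pose proof PI_RGT_0 as HPI.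
assert (Hsq : wallis_Gamma p * wallis_Gamma p = PI / 4).
{ rewrite (wallis_Gamma_constant p 1) at 1 by lra.
  rewrite (wallis_Gamma_constant p 2) by lra.
  unfold wallis_Gamma. rewrite wallis_1, wallis_2.
  replace (1 / 2 + / 2) with 1 by field. replace (2 / 2 + 1) with (1 + 1) by field.
  replace (2 / 2 + / 2) with (1 / 2 + 1) by field. rewrite (Gamma_succ 1) by lra.
  pose proof (Gamma_gt_0 1 Rlt_0_1). pose proof (Gamma_gt_0 (1 / 2 + 1) ltac:(lra)).
  field. lra. }
pose proof (wallis_Gamma_gt_0 p Hp) as Hh.
assert (E : wallis_Gamma p = sqrt PI / 2).
{ pose proof (sqrt_sqrt PI ltac:(lra)). pose proof (sqrt_lt_R0 PI HPI). nra. }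
rewrite <- E. unfold wallis_Gamma.
pose proof (Gamma_gt_0 (p / 2 + 1) ltac:(lra)).
pose proof (Gamma_gt_0 (p / 2 + / 2) ltac:(lra)). field. lra.
Qed.

(** * The Dunkl transform *)

(** With [t = sin th] the weight is [(1 - t ^ 2) ^ ((p - 1) / 2) * (1 - t) dt]: up to normalization,
    the rank-one Dunkl intertwining operator of multiplicity [(p + 1) / 2], acting in [l] on the
    travelling wave [g (y - l)]. *)
Definition dunkl (p : R) (g : R -> R) (l y : R) : R :=
  RInt (fun th => cosw p th * (1 - sin th) * g (y + l * sin th)) (- (PI / 2)) (PI / 2).

Definition cosw_mass (p : R) : R := RInt (cosw p) (- (PI / 2)) (PI / 2).

Lemma cosw_even (p th : R) : cosw p (- th) = cosw p th.
Proof. unfold cosw. now rewrite cos_neg. Qed.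

Lemma cosw_0_opp_half_pi (p : R) : cosw p (- (PI / 2)) = 0.
Proof. rewrite cosw_even. apply cosw_0_half_pi. Qed.

Lemma cosw_succ2 (p th : R) : cosw (p + 2) th = cos th * cos th * cosw p th.
Proof. replace (p + 2) with (p + 1 + 1) by ring. rewrite 2!cosw_succ. ring. Qed.

Lemma continuous_sin_shift (g : R -> R) (y l th : R) :
  (forall x, continuous g x) -> continuous (fun t => g (y + l * sin t)) th.
Proof.
intros Hg. apply (continuous_comp (fun t => y + l * sin t) g); [| apply Hg].
apply (ex_derive_continuous (fun t => y + l * sin t)). auto_derive. easy.
Qed.

Lemma continuous_Rmult (f g : R -> R) (x : R) :
  continuous f x -> continuous g x -> continuous (fun t => f t * g t) x.
Proof. apply (continuous_mult (K := R_AbsRing)). Qed.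

Lemma continuous_smooth_weight (a : R -> R) (p : R) (g : R -> R) (y l th : R) :
  0 < p -> (forall x, continuous a x) -> (forall x, continuous g x) ->
  continuous (fun t => cosw p t * a t * g (y + l * sin t)) th.
Proof.
intros Hp Ha Hg. apply continuous_Rmult.
- apply continuous_Rmult; [now apply continuous_cosw | apply Ha].
- now apply continuous_sin_shift.
Qed.

Lemma continuous_1_minus_sin (th : R) : continuous (fun t => 1 - sin t) th.
Proof. apply (ex_derive_continuous (fun t => 1 - sin t)). auto_derive. easy. Qed.

Lemma cosw_mass_wallis (p : R) : 0 < p -> cosw_mass p = 2 * wallis p.
Proof.
intros Hp. unfold cosw_mass, wallis.
assert (Hc : forall x, continuous (cosw p) x) by (intros; now apply continuous_cosw).
rewrite RInt_symmetric, <- RInt_Rmult by (easy || now apply ex_RInt_cont).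
apply RInt_eq. intros x. rewrite cosw_even. ring.
Qed.

Lemma cosw_mass_gt_0 (p : R) : 0 < p -> 0 < cosw_mass p.
Proof.
intros Hp. rewrite cosw_mass_wallis by easy. pose proof (wallis_gt_0 p Hp). lra.
Qed.

(** Integration by parts with [cos ^ (p + 1)], which vanishes at both ends. It trades a factor [sin]
    for a derivative of [g] and two more powers of [cos]; the exponent [q + 2] in the formula for
    [f] comes from here. *)
Lemma RInt_cosw_sin_parts (p : R) (g dg : R -> R) (y l : R) :
  0 < p -> (forall x, is_derive g x (dg x)) -> (forall x, continuous dg x) ->
  (p + 1) * RInt (fun th => cosw p th * sin th * g (y + l * sin th))
              (- (PI / 2)) (PI / 2)
  = l * RInt (fun th => cosw (p + 2) th * dg (y + l * sin th)) (- (PI / 2)) (PI / 2).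
Proof.
intros Hp Hg Hdg.
assert (Hgc : forall x, continuous g x).
{ intros x. apply (ex_derive_continuous g). exists (dg x). apply Hg. }
assert (Hc1 : forall th, continuous (fun th => cosw p th * sin th * g (y + l * sin th)) th).
{ intros th. apply continuous_smooth_weight; auto. apply continuous_sin. }
assert (Hc2 : forall th, continuous (fun th => cosw (p + 2) th * dg (y + l * sin th)) th).
{ intros th. apply continuous_Rmult.
  - apply continuous_cosw. lra.
  - now apply continuous_sin_shift. }
assert (H : RInt (fun th => l * (cosw (p + 2) th * dg (y + l * sin th))
    - (p + 1) * (cosw p th * sin th * g (y + l * sin th))) (- (PI / 2)) (PI / 2)
  = cosw (p + 1) (PI / 2) * g (y + l * sin (PI / 2))
    - cosw (p + 1) (- (PI / 2)) * g (y + l * sin (- (PI / 2)))).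
{ apply (RInt_FTC (fun th => cosw (p + 1) th * g (y + l * sin th))).
  - intros th. replace (_ - _) with
      (plus (mult (- (p + 1) * sin th * cosw p th) (g (y + l * sin th)))
            (mult (cosw (p + 1) th) (scal (l * cos th) (dg (y + l * sin th))))).
    + apply (is_derive_mult (K := R_AbsRing) (cosw (p + 1))
        (fun th => g (y + l * sin th))).
      * now apply is_derive_cosw.
      * apply (is_derive_comp (K := R_AbsRing) (V := R_NormedModule) g
          (fun t => y + l * sin t)); [apply Hg |].
        auto_derive; [easy | ring].
      * intros; apply Rmult_comm.
    + unfold plus, mult, scal; simpl. unfold mult; simpl.
      rewrite cosw_succ, cosw_succ2. ring.
  - intros th. apply (continuous_minus (V := R_NormedModule));
      apply (continuous_scal_r (V := R_NormedModule)); auto. }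
rewrite RInt_Rminus, 2!RInt_Rmult, cosw_0_half_pi, cosw_0_opp_half_pi in H;
  try (apply ex_RInt_cont; intros); auto;
  try (apply (continuous_scal_r (V := R_NormedModule)); auto).
lra.
Qed.

Lemma dunkl_opp (p : R) (g : R -> R) (l y : R) :
  0 < p -> (forall x, continuous g x) ->
  dunkl p g (- l) y
  = RInt (fun th => cosw p th * (1 + sin th) * g (y + l * sin th)) (- (PI / 2)) (PI / 2).
Proof.
intros Hp Hg. unfold dunkl. rewrite <- RInt_reflect.
- apply RInt_eq. intros x. rewrite cosw_even, sin_neg.
  replace (y + - l * - sin x) with (y + l * sin x) by ring. ring.
- intros x. apply continuous_smooth_weight; auto. apply continuous_1_minus_sin.
Qed.

Lemma dunkl_sum (p : R) (g : R -> R) (l y : R) :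
  0 < p -> (forall x, continuous g x) ->
  dunkl p g l y + dunkl p g (- l) y
  = 2 * RInt (fun th => cosw p th * g (y + l * sin th)) (- (PI / 2)) (PI / 2).
Proof.
intros Hp Hg. rewrite dunkl_opp by easy. unfold dunkl.
rewrite <- RInt_Rmult, <- RInt_Rplus.
- apply RInt_eq. intros x. ring.
- apply ex_RInt_cont. intros x. apply continuous_smooth_weight; auto.
  apply continuous_1_minus_sin.
- apply ex_RInt_cont. intros x. apply continuous_smooth_weight; auto.
  intros t. apply (ex_derive_continuous (fun t => 1 + sin t)). auto_derive. easy.
- apply ex_RInt_cont. intros x. apply continuous_Rmult; [now apply continuous_cosw |].
  now apply continuous_sin_shift.
Qed.

Lemma dunkl_diff (p : R) (g : R -> R) (l y : R) :
  0 < p -> (forall x, continuous g x) ->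
  dunkl p g (- l) y - dunkl p g l y
  = 2 * RInt (fun th => cosw p th * sin th * g (y + l * sin th)) (- (PI / 2)) (PI / 2).
Proof.
intros Hp Hg. rewrite dunkl_opp by easy. unfold dunkl.
rewrite <- RInt_Rmult, <- RInt_Rminus.
- apply RInt_eq. intros x. ring.
- apply ex_RInt_cont. intros x. apply continuous_smooth_weight; auto.
  intros t. apply (ex_derive_continuous (fun t => 1 + sin t)). auto_derive. easy.
- apply ex_RInt_cont. intros x. apply continuous_smooth_weight; auto.
  apply continuous_1_minus_sin.
- apply ex_RInt_cont. intros x. apply continuous_smooth_weight; auto.
  apply continuous_sin.
Qed.

(** Along a line [y - l = const] the argument of [g] moves at speed [1 + sin th], and
    [(1 - sin th) * (1 + sin th) = cos th ^ 2] raises the weight to [cosw (p + 2)]. Integrating by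
    parts backwards removes the derivative of [g], at the price of the factor [/ l], and leaves the
    odd part in [l]. *)
Lemma is_derive_dunkl_line (p : R) (g dg : R -> R) (y l : R) :
  0 < p -> (forall x, is_derive g x (dg x)) -> (forall x, continuous dg x) ->
  l <> 0 ->
  is_derive (fun r => dunkl p g r (y + r)) l
    ((p + 1) / 2 / l * (dunkl p g (- l) (y + l) - dunkl p g l (y + l))).
Proof.
intros Hp Hg Hdg Hl.
assert (Hgc : forall x, continuous g x).
{ intros x. apply (ex_derive_continuous g). exists (dg x). apply Hg. }
rewrite dunkl_diff by easy.
replace ((p + 1) / 2 / l * (2 * _)) with (/ l * ((p + 1) *
  RInt (fun th => cosw p th * sin th * g (y + l + l * sin th)) (- (PI / 2)) (PI / 2)))
  by (field; easy).
rewrite (RInt_cosw_sin_parts p g dg) by easy.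
rewrite <- Rmult_assoc, Rinv_l, Rmult_1_l by easy.
replace (RInt _ _ _) with (RInt (fun th =>
  cosw p th * (1 - sin th) * ((1 + sin th) * dg (y + l + l * sin th)))
  (- (PI / 2)) (PI / 2)).
- apply (is_derive_RInt_param_cont
    (fun r th => cosw p th * (1 - sin th) * g (y + r + r * sin th))
    (fun r th => cosw p th * (1 - sin th) * ((1 + sin th) * dg (y + r + r * sin th)))).
  + intros r th.
    apply (is_derive_scal (fun u => g (y + u + u * sin th))).
    apply (is_derive_comp (K := R_AbsRing) (V := R_NormedModule) g
      (fun u => y + u + u * sin th)); [apply Hg |].
    auto_derive; [easy | ring].
  + intros r th. apply continuity_2d_pt_mult; [| apply continuity_2d_pt_mult].
    * apply (continuity_2d_pt_snd (fun t => cosw p t * (1 - sin t))).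
      apply continuous_Rmult; [now apply continuous_cosw | apply continuous_1_minus_sin].
    * apply (continuity_2d_pt_snd (fun t => 1 + sin t)).
      apply (ex_derive_continuous (fun t => 1 + sin t)). auto_derive. easy.
    * apply (continuity_1d_2d_pt_comp dg (fun u v => y + u + u * sin v)).
      -- apply continuity_pt_filterlim, Hdg.
      -- repeat apply continuity_2d_pt_plus;
           [apply continuity_2d_pt_const | apply continuity_2d_pt_id1 |].
         apply continuity_2d_pt_mult; [apply continuity_2d_pt_id1 |].
         apply continuity_2d_pt_snd, continuous_sin.
  + intros r th. apply continuous_smooth_weight; auto. apply continuous_1_minus_sin.
- apply RInt_eq. intros x. rewrite cosw_succ2.
  pose proof (sin2_cos2 x) as E. unfold Rsqr in E.
  replace (cos x * cos x) with ((1 - sin x) * (1 + sin x)) by nra. ring.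
Qed.

Lemma dunkl_0 (p : R) (g : R -> R) (y : R) :
  0 < p -> (forall x, continuous g x) -> dunkl p g 0 y = cosw_mass p * g y.
Proof.
intros Hp Hg. pose proof (dunkl_sum p g 0 y Hp Hg) as H. rewrite Ropp_0 in H.
replace (RInt _ _ _) with (g y * cosw_mass p) in H; [lra |].
unfold cosw_mass. rewrite <- RInt_Rmult.
- apply RInt_eq. intros x. rewrite Rmult_0_l, Rplus_0_r. ring.
- apply ex_RInt_cont. intros; now apply continuous_cosw.
Qed.

(** Supplies the [O(l)] bound required for uniqueness: the argument of [g] is displaced by at most
    [Rabs l] and stays within [2 * L], where [dg] is bounded. *)
Lemma dunkl_0_increment_le (p : R) (g dg : R -> R) (L : R) :
  0 < p -> (forall x, is_derive g x (dg x)) -> (forall x, continuous dg x) ->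
  exists M, 0 <= M /\ forall l y, Rabs l <= L -> Rabs y <= L ->
    Rabs (dunkl p g l y - dunkl p g 0 y) <= M * Rabs l.
Proof.
intros Hp Hg Hdg. pose proof PI_RGT_0 as HPI.
assert (Hgc : forall x, continuous g x).
{ intros x. apply (ex_derive_continuous g). exists (dg x). apply Hg. }
destruct (continuous_bounded dg (2 * L) Hdg) as (K & HK & HdgK).
destruct (continuous_bounded (fun th => cosw p th * (1 - sin th)) (PI / 2))
  as (N & HN & HwN).
{ intros x. apply continuous_Rmult;
    [now apply continuous_cosw | apply continuous_1_minus_sin]. }
exists (PI * (N * K)). split.
{ apply Rmult_le_pos; [lra | now apply Rmult_le_pos]. }
intros l y Hl Hy. unfold dunkl.
rewrite <- RInt_Rminus
  by (apply ex_RInt_cont; intros x; apply continuous_smooth_weight; auto;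
      apply continuous_1_minus_sin).
replace (PI * (N * K) * Rabs l) with ((PI / 2 - - (PI / 2)) * (N * (K * Rabs l))) by field.
apply abs_RInt_le_const; [lra | |].
- apply ex_RInt_cont. intros x. apply (continuous_minus (V := R_NormedModule));
    apply continuous_smooth_weight; auto; apply continuous_1_minus_sin.
- intros th Hth. rewrite <- Rmult_minus_distr_l, Rabs_mult.
  apply Rmult_le_compat; try apply Rabs_pos.
  + apply HwN. apply Rabs_le_between. lra.
  + rewrite Rmult_0_l, Rplus_0_r.
    assert (Hsl : Rabs (l * sin th) <= Rabs l).
    { rewrite Rabs_mult. pose proof (SIN_bound th) as Hs.
      apply Rabs_le_between in Hs. pose proof (Rabs_pos l). nra. }
    apply Rle_trans with (K * Rabs (y + l * sin th - y)).
    * apply (Rabs_increment_le g dg); auto. intros x Hx. apply HdgK.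
      apply Rabs_le_between in Hy. apply Rabs_le_between in Hl.
      apply Rabs_le_between in Hsl.
      assert (HlL : Rabs l <= L) by now apply Rabs_le_between.
      apply Rabs_le_between.
      unfold Rmin, Rmax in Hx; destruct (Rle_dec y (y + l * sin th)); lra.
    * replace (y + l * sin th - y) with (l * sin th) by ring.
      now apply Rmult_le_compat_l.
Qed.

(** * Uniqueness for the first-order equation with reflection *)

(* [r^a pi(r)] has derivative [a r^(a-1) chi(r)]. *)
Lemma fuchsian_line_le (a M L : R) (pi chi : R -> R) :
  0 < a -> 0 <= M -> 0 < L ->
  (forall r, 0 < r <= L -> is_derive pi r (a / r * (chi r - pi r))) ->
  (forall r, 0 < r <= L -> Rabs (chi r) <= M * r) ->
  (forall r, 0 < r <= L -> Rabs (pi r) <= M * r) ->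
  Rabs (pi L) <= a / (a + 1) * M * L.
Proof.
intros Ha HM HL Hd Hchi Hpi.
set (z := fun r => Rpower r a * pi r).
set (w := fun r => a / (a + 1) * M * Rpower r (a + 1)).
assert (Hpow : forall q r, 0 < r -> is_derive (fun x => Rpower x q) r (q * Rpower r (q - 1)))
  by (intros; now apply is_derive_Reals, derivable_pt_lim_power).
assert (Hz : forall r, 0 < r <= L -> is_derive z r (a * Rpower r (a - 1) * chi r)).
{ intros r Hr. replace (a * Rpower r (a - 1) * chi r) with
    (plus (mult (a * Rpower r (a - 1)) (pi r))
          (mult (Rpower r a) (a / r * (chi r - pi r)))).
  - apply (is_derive_mult (K := R_AbsRing) (fun x => Rpower x a) pi);
      [apply Hpow; lra | now apply Hd | intros; apply Rmult_comm].
  - unfold plus, mult; simpl.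
    replace (Rpower r a) with (Rpower r (a - 1) * r).
    + field. lra.
    + rewrite <- (Rpower_1 r) at 2 by lra. rewrite <- Rpower_plus. f_equal. ring. }
assert (Hw : forall r, 0 < r -> is_derive w r (a * M * Rpower r a)).
{ intros r Hr. replace (a * M * Rpower r a)
    with (a / (a + 1) * M * ((a + 1) * Rpower r (a + 1 - 1))).
  - apply (is_derive_scal (fun x => Rpower x (a + 1))). now apply Hpow.
  - replace (a + 1 - 1) with a by ring. field. lra. }
assert (Hder : forall r, 0 < r <= L ->
  Rabs (a * Rpower r (a - 1) * chi r) <= a * M * Rpower r a).
{ intros r Hr. pose proof (Rpower_gt_0 r (a - 1)).
  assert (E : Rpower r a = Rpower r (a - 1) * r).
  { rewrite <- (Rpower_1 r) at 3 by lra. rewrite <- Rpower_plus. f_equal. ring. }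
  rewrite Rabs_mult, (Rabs_pos_eq (a * _)) by nra. rewrite E.
  replace (a * M * (Rpower r (a - 1) * r)) with (a * Rpower r (a - 1) * (M * r)) by ring.
  apply Rmult_le_compat_l; [nra | now apply Hchi]. }
(* [w] is a primitive of the bound on the derivative of [z], so [z - w] and [- z - w] are both
   nonincreasing away from 0. *)
assert (Hmono : forall e s, 0 < e < L -> s = 1 \/ s = -1 ->
  s * z L - w L <= s * z e - w e).
{ intros e s He Hs.
  destruct (MVT_gen (fun r => s * z r - w r) e L
    (fun r => s * (a * Rpower r (a - 1) * chi r) - a * M * Rpower r a))
    as [c [Hc Heq]]; rewrite ?Rmin_left, ?Rmax_right in * by lra.
  - intros r Hr. apply (is_derive_minus (V := R_NormedModule) (fun r => s * z r) w).
    + apply (is_derive_scal z). apply Hz. lra.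
    + apply Hw. lra.
  - intros r Hr. apply continuity_pt_filterlim.
    apply (ex_derive_continuous (fun r => s * z r - w r)).
    eexists. apply (is_derive_minus (V := R_NormedModule) (fun r => s * z r) w).
    + apply (is_derive_scal z). apply Hz. lra.
    + apply Hw. lra.
  - pose proof (Hder c ltac:(lra)) as Hdc. apply Rabs_le_between in Hdc.
    set (d := a * Rpower c (a - 1) * chi c) in *. clearbody d.
    assert (s * d - a * M * Rpower c a <= 0) by (destruct Hs; subst; lra). nra. }
assert (HzL : Rabs (z L) <= w L).
{ apply Rnot_lt_le. intros Hlt.
  (* In place of a limit [e -> 0]: since [e <= / 2] gives [e ^ a <= 1], [Rabs (z e) <= M * e], and
     the last bound on [e] makes this at most half of the assumed excess [Rabs (z L) - w L]. *)
  set (e := Rmin (Rmin (L / 2) (/ 2)) ((Rabs (z L) - w L) / (M + 1) / 2)).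
  assert (Hfrac : 0 < (Rabs (z L) - w L) / (M + 1)) by (apply Rdiv_lt_0_compat; lra).
  assert (He : 0 < e) by (repeat apply Rmin_glb_lt; lra).
  assert (He1 : e <= L / 2)
    by (unfold e; eapply Rle_trans; [apply Rmin_l | apply Rmin_l]).
  assert (He2 : e <= / 2)
    by (unfold e; eapply Rle_trans; [apply Rmin_l | apply Rmin_r]).
  assert (He3 : e <= (Rabs (z L) - w L) / (M + 1) / 2) by apply Rmin_r.
  assert (Hze : Rabs (z e) <= M * e).
  { unfold z. rewrite Rabs_mult, Rabs_pos_eq by (left; apply Rpower_gt_0).
    assert (Rpower e a <= 1).
    { rewrite <- (Rpower_O e) by easy. unfold Rpower.
      assert (ln e < 0) by (rewrite <- ln_1; apply ln_increasing; lra).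
      left. apply exp_increasing. nra. }
    pose proof (Rpower_gt_0 e a). pose proof (Hpi e ltac:(lra)).
    pose proof (Rabs_pos (pi e)). nra. }
  assert (Hwe : 0 <= w e).
  { unfold w. pose proof (Rpower_gt_0 e (a + 1)).
    apply Rmult_le_pos; [apply Rmult_le_pos |]; try lra.
    left. apply Rdiv_lt_0_compat; lra. }
  assert (HLe : Rabs (z L) - w L <= Rabs (z e)).
  { pose proof (Hmono e 1 ltac:(lra) (or_introl eq_refl)).
    pose proof (Hmono e (-1) ltac:(lra) (or_intror eq_refl)).
    pose proof (Rle_abs (z e)). pose proof (Rle_abs (- z e)) as Hm.
    rewrite Rabs_Ropp in Hm.
    unfold Rabs at 1; destruct (Rcase_abs (z L)); lra. }
  assert ((M + 1) * e <= (Rabs (z L) - w L) / 2).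
  { apply Rmult_le_compat_l with (r := M + 1) in He3; [| lra].
    replace ((M + 1) * ((Rabs (z L) - w L) / (M + 1) / 2))
      with ((Rabs (z L) - w L) / 2) in He3 by (field; lra). easy. }
  lra. }
pose proof (Rpower_gt_0 L a) as HLa.
apply Rmult_le_reg_l with (Rpower L a); [easy |].
unfold z, w in HzL. rewrite Rabs_mult, Rabs_pos_eq in HzL by lra.
rewrite Rpower_plus, Rpower_1 in HzL by easy. lra.
Qed.

Lemma Rabs_sign_case (l : R) : l <> 0 ->
  exists e, (e = 1 \/ e = -1) /\ l = e * Rabs l.
Proof.
intros Hl. unfold Rabs. destruct (Rcase_abs l).
- exists (-1). split; [now right | ring].
- exists 1. split; [now left | ring].
Qed.

(** The region [Rabs l + Rabs y <= L] contains, with each point, the part of its line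
    [y - l = const] leading to [l = 0], and also the mirror image of that part under [l -> - l]. The
    induction therefore runs at fixed [L], the previous bound being applied to the reflected
    value. *)
Theorem dunkl_equation_unique (a : R) (H : R -> R -> R) :
  0 < a ->
  (forall l y, l <> 0 ->
     is_derive (fun r => H r (y + r)) l (a / l * (H (- l) (y + l) - H l (y + l)))) ->
  (forall L, exists M, 0 <= M /\ forall l y, Rabs l <= L -> Rabs y <= L ->
     Rabs (H l y) <= M * Rabs l) ->
  forall l y, H l y = 0.
Proof.
intros Ha Hd Hb l0 y0. set (L := Rabs l0 + Rabs y0).
destruct (Hb L) as (M & HM & HbL).
set (q := a / (a + 1)).
assert (Hq : 0 <= q < 1).
{ split; [apply Rdiv_le_0_compat; lra | apply Rlt_div_l; lra]. }
assert (Hn : forall n l y, Rabs l + Rabs y <= L -> Rabs (H l y) <= q ^ n * M * Rabs l).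
{ induction n as [| n IH]; intros l y Hly.
  - simpl. rewrite Rmult_1_l. apply HbL.
    + pose proof (Rabs_pos y). lra.
    + pose proof (Rabs_pos l). lra.
  - destruct (Req_dec l 0) as [-> | Hl].
    { assert (H0 : Rabs (H 0 y) <= M * Rabs 0)
        by (apply HbL; rewrite ?Rabs_R0 in *; pose proof (Rabs_pos y); lra).
      rewrite Rabs_R0, Rmult_0_r in *. exact H0. }
    destruct (Rabs_sign_case l Hl) as (e & He & Hle).
    pose proof (Rabs_pos_lt l Hl) as Hl0.
    assert (Habs : forall r s, 0 < r -> s = e \/ s = - e -> Rabs (s * r) = r).
    { intros r s Hr Hs. rewrite Rabs_mult, (Rabs_pos_eq r) by lra.
      replace (Rabs s) with 1; [ring |].
      destruct He as [-> | ->]; destruct Hs as [-> | ->];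
        unfold Rabs; destruct (Rcase_abs _); lra. }
    assert (Hreg : forall r s, 0 < r <= Rabs l -> s = e \/ s = - e ->
      Rabs (s * r) + Rabs (y - l + e * r) <= L).
    { intros r s Hr Hs. apply Rle_trans with (2 := Hly).
      rewrite Habs by (easy || lra).
      replace (y - l + e * r) with (y + e * (r - Rabs l)) by (rewrite Hle at 2; ring).
      pose proof (Rabs_triang y (e * (r - Rabs l))) as Ht.
      replace (Rabs (e * (r - Rabs l))) with (Rabs l - r) in Ht; [lra |].
      rewrite Rabs_mult, (Rabs_left1 (r - Rabs l)) by lra.
      replace (Rabs e) with 1; [ring |].
      destruct He as [-> | ->]; unfold Rabs; destruct (Rcase_abs _); lra. }
    assert (Hend : H l y = H (e * Rabs l) (y - l + e * Rabs l)).
    { rewrite <- Hle. f_equal. ring. }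
    rewrite Hend.
    replace (q ^ S n * M * Rabs l) with (a / (a + 1) * (q ^ n * M) * Rabs l)
      by (unfold q; simpl; ring).
    apply (fuchsian_line_le a (q ^ n * M) (Rabs l)
      (fun r => H (e * r) (y - l + e * r)) (fun r => H (- e * r) (y - l + e * r)));
      auto.
    + apply Rmult_le_pos; [apply pow_le; lra | easy].
    + intros r Hr. assert (He0 : e <> 0) by lra.
      replace (a / r * _) with (scal e (a / (e * r) *
        (H (- (e * r)) (y - l + e * r) - H (e * r) (y - l + e * r)))).
      * apply (is_derive_comp (K := R_AbsRing) (V := R_NormedModule)
          (fun s => H s (y - l + s)) (fun r => e * r)).
        -- apply Hd. apply Rmult_integral_contrapositive. lra.
        -- auto_derive; [easy | ring].
      * replace (- e * r) with (- (e * r)) by ring.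
        unfold scal; simpl. unfold mult; simpl. field. lra.
    + intros r Hr.
      pose proof (IH (- e * r) (y - l + e * r) (Hreg r (- e) Hr (or_intror eq_refl))) as E.
      rewrite Habs in E by (auto; lra). exact E.
    + intros r Hr.
      pose proof (IH (e * r) (y - l + e * r) (Hreg r e Hr (or_introl eq_refl))) as E.
      rewrite Habs in E by (auto; lra). exact E. }
apply Rabs_eq_0, Rle_antisym; [| apply Rabs_pos].
assert (Hlim : is_lim_seq (fun n => q ^ n * (M * Rabs l0)) (Rbar_mult 0 (M * Rabs l0))).
{ apply is_lim_seq_scal_r, is_lim_seq_geom. rewrite Rabs_pos_eq; lra. }
simpl in Hlim. rewrite Rmult_0_l in Hlim.
assert (Hc : is_lim_seq (fun _ => Rabs (H l0 y0)) (Rabs (H l0 y0)))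
  by apply is_lim_seq_const.
apply (is_lim_seq_le _ _ _ _ (fun n => Rle_trans _ _ _ (Hn n l0 y0 (Rle_refl _))
  (Req_le _ _ (Rmult_assoc _ _ _))) Hc Hlim).
Qed.

(** * The linear system in the variables [l = sqrt sigma], [y = tau / kappa] *)

(** In terms of [F = l * f] the equations are [p_l + F_y = 0] and [F_l + (k / l) F + p_y = 0].
    Written with the even function [f] they stay regular at [l = 0], where the second one reads
    [(k + 1) * f + p_y = 0]. *)
Definition lifted_system (k : R) (p f : R -> R -> R) : Prop :=
  exists px py fx fy : R -> R -> R,
    C1_with p px py /\ C1_with f fx fy /\
    (forall l y, p (- l) y = p l y) /\ (forall l y, f (- l) y = f l y) /\
    (forall l y, px l y + l * fy l y = 0) /\
    (forall l y, l * fx l y + (k + 1) * f l y + py l y = 0).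

Lemma lifted_system_minus (k : R) (p f p' f' : R -> R -> R) :
  lifted_system k p f -> lifted_system k p' f' ->
  lifted_system k (fun l y => p l y - p' l y) (fun l y => f l y - f' l y).
Proof.
intros (px & py & fx & fy & (Hp1 & Hp2 & Hp3 & Hp4) & (Hf1 & Hf2 & Hf3 & Hf4)
  & Ep & Ef & E1 & E2).
intros (px' & py' & fx' & fy' & (Hp1' & Hp2' & Hp3' & Hp4')
  & (Hf1' & Hf2' & Hf3' & Hf4') & Ep' & Ef' & E1' & E2').
exists (fun l y => px l y - px' l y), (fun l y => py l y - py' l y),
  (fun l y => fx l y - fx' l y), (fun l y => fy l y - fy' l y).
split; [| split; [| split; [| split; [| split]]]].
- split; [| split; [| split]].
  + intros x y. now apply (is_derive_minus (V := R_NormedModule)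
      (fun u => p u y) (fun u => p' u y)).
  + intros x y. now apply (is_derive_minus (V := R_NormedModule) (p x) (p' x)).
  + intros x y. now apply continuity_2d_pt_minus.
  + intros x y. now apply continuity_2d_pt_minus.
- split; [| split; [| split]].
  + intros x y. now apply (is_derive_minus (V := R_NormedModule)
      (fun u => f u y) (fun u => f' u y)).
  + intros x y. now apply (is_derive_minus (V := R_NormedModule) (f x) (f' x)).
  + intros x y. now apply continuity_2d_pt_minus.
  + intros x y. now apply continuity_2d_pt_minus.
- intros l y. now rewrite Ep, Ep'.
- intros l y. now rewrite Ef, Ef'.
- intros l y. specialize (E1 l y). specialize (E1' l y). lra.
- intros l y. specialize (E2 l y). specialize (E2' l y). lra.
Qed.

Lemma is_derive_shift (y l : R) : is_derive (fun r => y + r) l 1.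
Proof. auto_derive; [easy | ring]. Qed.

Lemma is_derive_Rid (l : R) : is_derive (fun r : R => r) l 1.
Proof. apply (is_derive_id (K := R_AbsRing)). Qed.

Theorem lifted_system_dunkl (q : R) (p f : R -> R -> R) : 0 < q ->
  lifted_system (q + 1) p f ->
  forall l y, p l y + l * f l y = / cosw_mass q * dunkl q (p 0) l y.
Proof.
intros Hq (px & py & fx & fy & HCp & HCf & Ep & Ef & E1 & E2).
pose proof (C1_with_continuous _ _ _ HCf) as Hfc.
pose proof HCp as (Hpx & Hpy & Hpxc & Hpyc).
pose proof (cosw_mass_gt_0 q Hq) as HW.
assert (Hdg : forall x, continuous (py 0) x).
{ intros x. apply (continuous_2d_comp py (fun _ => 0) (fun t => t));
    [apply Hpyc | apply continuous_const | apply continuous_id]. }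
assert (Hgc : forall x, continuous (p 0) x).
{ intros x. apply (ex_derive_continuous (p 0)). exists (py 0 x). apply Hpy. }
set (H := fun l y => p l y + l * f l y - / cosw_mass q * dunkl q (p 0) l y).
assert (HH : forall l y, H l y = 0); [| intros l y; specialize (HH l y); unfold H in HH; lra].
apply (dunkl_equation_unique ((q + 1) / 2) H).
- lra.
- intros l y Hl. unfold H. rewrite Ep, Ef.
  replace ((q + 1) / 2 / l * _) with
    (minus (plus (px l (y + l) * 1 + py l (y + l) * 1)
       (plus (mult 1 (f l (y + l))) (mult l (fx l (y + l) * 1 + fy l (y + l) * 1))))
     (/ cosw_mass q * ((q + 1) / 2 / l *
        (dunkl q (p 0) (- l) (y + l) - dunkl q (p 0) l (y + l))))).
  + apply (is_derive_minus (V := R_NormedModule)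
      (fun r => p r (y + r) + r * f r (y + r))).
    * apply (is_derive_plus (V := R_NormedModule) (fun r => p r (y + r))).
      -- apply (is_derive_C1_comp p px py (fun r => r) (fun r => y + r));
           [easy | apply is_derive_Rid | apply is_derive_shift].
      -- apply (is_derive_mult (K := R_AbsRing) (fun r => r) (fun r => f r (y + r))).
         ++ apply is_derive_Rid.
         ++ apply (is_derive_C1_comp f fx fy (fun r => r) (fun r => y + r));
              [easy | apply is_derive_Rid | apply is_derive_shift].
         ++ intros; apply Rmult_comm.
    * apply (is_derive_scal (fun r => dunkl q (p 0) r (y + r))).
      now apply is_derive_dunkl_line with (dg := py 0).
  + unfold minus, plus, opp, mult; simpl.
    specialize (E1 l (y + l)). specialize (E2 l (y + l)).
    replace (px l (y + l)) with (- (l * fy l (y + l))) by lra.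
    replace (py l (y + l)) with (- (l * fx l (y + l)) - (q + 1 + 1) * f l (y + l)) by lra.
    field. lra.
(* [p] moves by [O(l)] because [px] is bounded, [l * f] is [O(l)], and so is the increment of the
   transform; the values at [l = 0] cancel by [dunkl_0]. *)
- intros L.
  destruct (continuous_2d_bounded px L Hpxc) as (A & HA & HpxA).
  destruct (continuous_2d_bounded f L Hfc) as (B & HB & HfB).
  destruct (dunkl_0_increment_le q (p 0) (py 0) L Hq (Hpy 0) Hdg) as (C & HC & HdC).
  assert (HiW : 0 < / cosw_mass q) by now apply Rinv_0_lt_compat.
  exists (A + B + / cosw_mass q * C). split; [nra |].
  intros l y Hl Hy. unfold H.
  specialize (HdC l y Hl Hy). rewrite dunkl_0 in HdC by easy.
  assert (H1 : Rabs (p l y - p 0 y) <= A * Rabs (l - 0)).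
  { apply (Rabs_increment_le (fun u => p u y) (fun u => px u y)); [intros; apply Hpx |].
    intros x Hx. apply HpxA; [| easy]. apply Rabs_le_between in Hl.
    apply Rabs_le_between. unfold Rmin, Rmax in Hx. destruct (Rle_dec 0 l); lra. }
  rewrite Rminus_0_r in H1.
  assert (H2 : Rabs (l * f l y) <= B * Rabs l).
  { rewrite Rabs_mult, Rmult_comm. apply Rmult_le_compat_r; [apply Rabs_pos | auto]. }
  replace (p l y + l * f l y - / cosw_mass q * dunkl q (p 0) l y)
    with ((p l y - p 0 y) + l * f l y
      + - (/ cosw_mass q * (dunkl q (p 0) l y - cosw_mass q * p 0 y))) by (field; lra).
  eapply Rle_trans; [apply Rabs_triang |].
  eapply Rle_trans; [apply Rplus_le_compat_r, Rabs_triang |].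
  rewrite Rabs_Ropp, (Rabs_mult (/ _)), (Rabs_pos_eq (/ _)) by lra.
  apply Rmult_le_compat_l with (r := / cosw_mass q) in HdC; [lra | lra].
Qed.

Lemma lifted_system_continuous_trace (k : R) (p f : R -> R -> R) :
  lifted_system k p f ->
  (forall l y, continuous (p l) y) /\ (forall l y, continuous (f l) y).
Proof.
intros (px & py & fx & fy & HCp & HCf & _).
split; intros l y.
- apply (ex_derive_continuous (p l)). exists (py l y). apply HCp.
- apply (ex_derive_continuous (f l)). exists (fy l y). apply HCf.
Qed.

Theorem lifted_system_mean_p (q : R) (p f : R -> R -> R) : 0 < q ->
  lifted_system (q + 1) p f ->
  forall l y, cosw_mass q * p l y =
    RInt (fun th => cosw q th * p 0 (y + l * sin th)) (- (PI / 2)) (PI / 2).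
Proof.
intros Hq Hsys l y.
pose proof (lifted_system_dunkl q p f Hq Hsys l y) as H1.
pose proof (lifted_system_dunkl q p f Hq Hsys (- l) y) as H2.
destruct (lifted_system_continuous_trace _ _ _ Hsys) as [Hpc _].
destruct Hsys as (px & py & fx & fy & HCp & HCf & Ep & Ef & E1 & E2).
rewrite Ep, Ef in H2.
pose proof (dunkl_sum q (p 0) l y Hq (Hpc 0)) as H3.
pose proof (cosw_mass_gt_0 q Hq) as HW.
apply Rmult_eq_reg_l with 2; [| lra]. rewrite <- H3.
replace (dunkl q (p 0) l y) with (cosw_mass q * (p l y + l * f l y))
  by (rewrite H1; field; lra).
replace (dunkl q (p 0) (- l) y) with (cosw_mass q * (p l y + - l * f l y))
  by (rewrite H2; field; lra).
ring.
Qed.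

(** The odd part in [l] expresses [l * f] by an integral of [sin] times the trace of [p].
    Integration by parts replaces this trace by its derivative, and the second equation on [l = 0]
    turns that into [- (q + 2)] times the trace of [f]. Division by [l] ends the computation. *)
Theorem lifted_system_mean_f (q : R) (p f : R -> R -> R) : 0 < q ->
  lifted_system (q + 1) p f ->
  forall l y, l <> 0 -> cosw_mass (q + 2) * f l y =
    RInt (fun th => cosw (q + 2) th * f 0 (y + l * sin th)) (- (PI / 2)) (PI / 2).
Proof.
intros Hq Hsys l y Hl.
pose proof (lifted_system_dunkl q p f Hq Hsys l y) as H1.
pose proof (lifted_system_dunkl q p f Hq Hsys (- l) y) as H2.
destruct (lifted_system_continuous_trace _ _ _ Hsys) as [Hpc Hfc].
destruct Hsys as (px & py & fx & fy & (Hpx & Hpy & Hpxc & Hpyc) & HCf & Ep & Ef & E1 & E2).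
rewrite Ep, Ef in H2.
pose proof (dunkl_diff q (p 0) l y Hq (Hpc 0)) as H3.
pose proof (cosw_mass_gt_0 q Hq) as HW.
assert (Hdg : forall x, continuous (py 0) x).
{ intros x. apply (continuous_2d_comp py (fun _ => 0) (fun t => t));
    [apply Hpyc | apply continuous_const | apply continuous_id]. }
pose proof (RInt_cosw_sin_parts q (p 0) (py 0) y l Hq (Hpy 0) Hdg) as H4.
set (S := RInt (fun th => cosw q th * sin th * p 0 (y + l * sin th)) (- (PI / 2)) (PI / 2)) in *.
set (J := RInt (fun th => cosw (q + 2) th * f 0 (y + l * sin th)) (- (PI / 2)) (PI / 2)).
assert (H5 : RInt (fun th => cosw (q + 2) th * py 0 (y + l * sin th))
  (- (PI / 2)) (PI / 2) = - (q + 2) * J).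
{ unfold J. rewrite <- RInt_Rmult.
  - apply RInt_eq. intros x. specialize (E2 0 (y + l * sin x)).
    replace (py 0 (y + l * sin x)) with (- (q + 2) * f 0 (y + l * sin x)) by lra. ring.
  - apply ex_RInt_cont. intros x. apply continuous_Rmult.
    + apply continuous_cosw. lra.
    + apply continuous_sin_shift, Hfc. }
rewrite H5 in H4.
assert (H6 : cosw_mass (q + 2) = (q + 1) / (q + 2) * cosw_mass q).
{ rewrite 2!cosw_mass_wallis, wallis_succ2 by lra. ring. }
assert (H7 : cosw_mass q * (l * f l y) = - S).
{ replace (dunkl q (p 0) l y) with (cosw_mass q * (p l y + l * f l y)) in H3
    by (rewrite H1; field; lra).
  replace (dunkl q (p 0) (- l) y) with (cosw_mass q * (p l y + - l * f l y)) in H3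
    by (rewrite H2; field; lra).
  lra. }
rewrite H6. apply Rmult_eq_reg_l with (l * (q + 2));
  [| apply Rmult_integral_contrapositive; lra].
replace (l * (q + 2) * ((q + 1) / (q + 2) * cosw_mass q * f l y))
  with ((q + 1) * (cosw_mass q * (l * f l y))) by (field; lra).
rewrite H7. lra.
Qed.

(** Only the trace of [p] is prescribed; on [l = 0] the second equation, [(q + 2) * f + py = 0],
    makes the trace of [f] vanish as well. *)
Theorem lifted_system_trace_unique (q : R) (p f : R -> R -> R) : 0 < q ->
  lifted_system (q + 1) p f -> (forall y, p 0 y = 0) ->
  forall l y, p l y = 0 /\ f l y = 0.
Proof.
intros Hq Hsys H0.
destruct (lifted_system_continuous_trace _ _ _ Hsys) as [Hpc Hfc].
assert (Hf0 : forall y, f 0 y = 0).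
{ intros y. destruct Hsys as (px & py & fx & fy & (_ & Hpy & _) & _ & _ & _ & _ & E2).
  specialize (E2 0 y). specialize (Hpy 0 y).
  assert (Hz : py 0 y = 0).
  { rewrite <- (is_derive_unique _ _ _ Hpy), (Derive_ext _ (fun _ => 0)) by easy.
    apply Derive_const. }
  rewrite Hz in E2. apply Rmult_eq_reg_l with (q + 2); lra. }
assert (Hint : forall r l y g, (forall x, g x = 0) ->
  RInt (fun th => cosw r th * g (y + l * sin th)) (- (PI / 2)) (PI / 2) = 0).
{ intros r l y g Hg. rewrite (RInt_eq _ (fun _ => 0)).
  - apply RInt_zero.
  - intros x. rewrite Hg. ring. }
intros l y. split.
- apply Rmult_eq_reg_l with (cosw_mass q).
  + rewrite (lifted_system_mean_p q p f), Hint by easy. ring.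
  + pose proof (cosw_mass_gt_0 q Hq). lra.
- destruct (Req_dec l 0) as [-> | Hl]; [apply Hf0 |].
  apply Rmult_eq_reg_l with (cosw_mass (q + 2)).
  + rewrite (lifted_system_mean_f q p f), Hint by easy. ring.
  + pose proof (cosw_mass_gt_0 (q + 2)). lra.
Qed.

(** * Uniqueness for the Cauchy problem *)

(** A C1 cutoff: [pos2 (L - l - y)] vanishes for [l + y >= L], so the energy on a shrinking interval
    is an integral over the fixed interval [[0, L]], and can be differentiated under the integral
    sign. *)
Definition pos2 (z : R) : R := Rmax 0 z * Rmax 0 z.

Lemma is_derive_pos2 (z : R) : is_derive pos2 z (2 * Rmax 0 z).
Proof.
destruct (Rtotal_order z 0) as [H | [H | H]].
- rewrite Rmax_left, Rmult_0_r by lra.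
  apply is_derive_ext_loc with (f := fun _ => 0).
  + generalize (locally_lt z 0 H). apply filter_imp.
    intros t Ht. unfold pos2. rewrite Rmax_left by lra. symmetry. apply Rmult_0_r.
  + apply (is_derive_const 0).
- subst z. rewrite Rmax_left, Rmult_0_r by lra. apply is_derive_Reals.
  intros eps Heps. exists (mkposreal eps Heps). intros h Hh Hhe. simpl in Hhe.
  unfold pos2. rewrite Rplus_0_l, (Rmax_left 0 0) by lra.
  unfold Rmax. destruct (Rle_dec 0 h).
  + replace ((h * h - 0 * 0) / h - 0) with h by (field; easy). easy.
  + replace ((0 * 0 - 0 * 0) / h - 0) with 0 by (field; easy). now rewrite Rabs_R0.
- rewrite Rmax_right by lra.
  apply is_derive_ext_loc with (f := fun t => t * t).
  + generalize (locally_gt z 0 H). apply filter_imp.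
    intros t Ht. unfold pos2. rewrite Rmax_right by lra. reflexivity.
  + auto_derive; [easy | ring].
Qed.

Lemma continuous_Rmax_0 (z : R) : continuous (Rmax 0) z.
Proof.
apply continuous_ext with (f := fun t => (t + Rabs t) / 2).
- intros t. unfold Rmax, Rabs. destruct (Rle_dec 0 t), (Rcase_abs t); lra.
- apply continuous_Rmult; [| apply continuous_const].
  apply (continuous_plus (V := R_NormedModule) (fun t => t)).
  + apply continuous_id.
  + apply continuous_Rabs.
Qed.

(* The weighted energy over the shrinking interval [0 <= l <= L - y]; the weight
   [l^k] absorbs the term of order zero and the flux [2 l^k p v] vanishes at both
   ends. *)
Lemma lifted_system_energy (k L : R) (p f : R -> R -> R) : 1 < k -> 0 < L ->
  lifted_system k p f -> (forall l, 0 <= l -> p l 0 = 0 /\ f l 0 = 0) ->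
  forall y, 0 <= y ->
  RInt (fun l => pos2 (L - l - y) * pw k l * (p l y * p l y + l * f l y * (l * f l y)))
    0 L <= 0.
Proof.
intros Hk HL (px & py & fx & fy & HCp & HCf & _ & _ & E1 & E2) Hinit.
pose proof (C1_with_continuous _ _ _ HCp) as Hpc.
pose proof (C1_with_continuous _ _ _ HCf) as Hfc.
destruct HCp as (Hpx & Hpy & Hpxc & Hpyc). destruct HCf as (Hfx & Hfy & Hfxc & Hfyc).
set (F := fun y l =>
  pos2 (L - l - y) * pw k l * (p l y * p l y + l * f l y * (l * f l y))).
set (dF := fun y l =>
  (-2 * Rmax 0 (L - l - y) * pw k l) * (p l y * p l y + l * f l y * (l * f l y))
  + pos2 (L - l - y) * pw k l
    * (2 * (p l y * py l y) + 2 * (l * l) * (f l y * fy l y))).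
set (flux := fun y l => pos2 (L - l - y) * pw k l * (2 * (l * (p l y * f l y)))).
set (dflux := fun y l =>
  (-2 * Rmax 0 (L - l - y) * pw k l + pos2 (L - l - y) * (k * pw (k - 1) l))
    * (2 * (l * (p l y * f l y)))
  + pos2 (L - l - y) * pw k l * (2 * (p l y * f l y
      + l * (px l y * f l y + p l y * fx l y)))).
assert (Hpwc : forall l, continuous (pw k) l) by (intros; apply continuous_pw; lra).
assert (Hpwd : forall l, is_derive (pw k) l (k * pw (k - 1) l)).
{ intros l. replace k with (k - 1 + 1) at 1 2 by ring. apply is_derive_pw. lra. }
assert (Hpos2 : forall z, continuous pos2 z).
{ intros z. apply (ex_derive_continuous pos2). exists (2 * Rmax 0 z).
  apply is_derive_pos2. }
assert (Hd1 : forall y l, is_derive (fun u => F u l) y (dF y l)).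
{ intros y l. unfold F, dF.
  pose proof (is_derive_pos2 (L - l + - y)) as Hz.
  pose proof (Hpy l y) as H1. pose proof (Hfy l y) as H2.
  auto_derive; [repeat apply conj; try exact I;
    first [eexists; exact Hz | eexists; exact H1 | eexists; exact H2] |].
  replace (Derive (fun x => pos2 x) (L - l + - y)) with (2 * Rmax 0 (L - l - y))
    by (symmetry; now apply is_derive_unique).
  replace (Derive (fun x => p l x) y) with (py l y)
    by (symmetry; now apply is_derive_unique).
  replace (Derive (fun x => f l x) y) with (fy l y)
    by (symmetry; now apply is_derive_unique).
  change (L - l + - y) with (L - l - y). ring. }
assert (Hd2 : forall y l, is_derive (flux y) l (dflux y l)).
{ intros y l. unfold flux, dflux.
  pose proof (is_derive_pos2 (L + - l + - y)) as Hz.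
  pose proof (Hpx l y) as H1. pose proof (Hfx l y) as H2. pose proof (Hpwd l) as H3.
  auto_derive; [repeat apply conj; try exact I;
    first [eexists; exact Hz | eexists; exact H1 | eexists; exact H2
      | eexists; exact H3] |].
  replace (Derive (fun x => pos2 x) (L + - l + - y)) with (2 * Rmax 0 (L - l - y))
    by (symmetry; now apply is_derive_unique).
  replace (Derive (fun x => p x y) l) with (px l y)
    by (symmetry; now apply is_derive_unique).
  replace (Derive (fun x => f x y) l) with (fx l y)
    by (symmetry; now apply is_derive_unique).
  replace (Derive (fun x => pw k x) l) with (k * pw (k - 1) l)
    by (symmetry; now apply is_derive_unique).
  change (L + - l + - y) with (L - l - y). ring. }
assert (Hswap : forall G, continuous_2d G -> continuous_2d (fun y l => G l y)).
{ intros G HG y l. apply (continuity_2d_pt_comp G (fun _ v => v) (fun u _ => u));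
    [apply HG | apply continuity_2d_pt_id2 | apply continuity_2d_pt_id1]. }
assert (Hlin : continuous_2d (fun y l => L - l - y)).
{ intros y l. repeat apply continuity_2d_pt_minus;
    [apply continuity_2d_pt_const | apply continuity_2d_pt_id2 | apply continuity_2d_pt_id1]. }
assert (Hc1 : continuous_2d (fun y l => pos2 (L - l - y))).
{ intros y l. apply (continuity_1d_2d_pt_comp pos2 (fun y l => L - l - y));
    [apply continuity_pt_filterlim, Hpos2 | apply Hlin]. }
assert (Hc2 : continuous_2d (fun y l => Rmax 0 (L - l - y))).
{ intros y l. apply (continuity_1d_2d_pt_comp (Rmax 0) (fun y l => L - l - y));
    [apply continuity_pt_filterlim, continuous_Rmax_0 | apply Hlin]. }
assert (Hc3 : continuous_2d (fun y l => pw k l))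
  by (intros y l; now apply continuity_2d_pt_snd).
assert (Hc4 : continuous_2d (fun y l => pw (k - 1) l))
  by (intros y l; apply continuity_2d_pt_snd, continuous_pw; lra).
assert (Hc5 : continuous_2d (fun y l : R => l))
  by (intros y l; apply continuity_2d_pt_id2).
assert (Hconst : forall c : R, continuous_2d (fun y l : R => c))
  by (intros c y l; apply continuity_2d_pt_const).
assert (HM : forall A B, continuous_2d A -> continuous_2d B ->
  continuous_2d (fun y l => A y l * B y l))
  by (intros A B HA HB y l; now apply continuity_2d_pt_mult).
assert (HP : forall A B, continuous_2d A -> continuous_2d B ->
  continuous_2d (fun y l => A y l + B y l))
  by (intros A B HA HB y l; now apply continuity_2d_pt_plus).
apply Hswap in Hpc, Hfc, Hpxc, Hpyc, Hfxc, Hfyc.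
assert (HFc : continuous_2d F) by (unfold F; auto 10).
assert (HdFc : continuous_2d dF).
{ unfold dF. apply HP; repeat apply HM; auto; repeat apply HP; auto. }
assert (Hdfluxc : continuous_2d dflux).
{ unfold dflux. apply HP; repeat apply HM; auto; repeat apply HP; auto. }
assert (Hsec : forall G, continuous_2d G -> forall y l, continuous (G y) l).
{ intros G HG y l. apply (continuous_2d_comp G (fun _ => y) (fun t => t));
    [apply HG | apply continuous_const | apply continuous_id]. }
set (E := fun y => RInt (F y) 0 L).
assert (HEd : forall y, is_derive E y (RInt (dF y) 0 L)).
{ intros y. apply is_derive_RInt_param_cont; auto. }
assert (Hflux : forall y, 0 <= y -> RInt (dflux y) 0 L = 0).
{ intros y Hy. rewrite (RInt_FTC (flux y) (dflux y)) by auto.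
  unfold flux, pos2. rewrite Rmax_left, (pw_nonpos k 0) by lra. eqR. ring. }
assert (Hneg : forall y, 0 <= y -> RInt (dF y) 0 L <= 0).
{ intros y Hy.
  assert (Hadd : RInt (dF y) 0 L = RInt (fun l => dF y l + dflux y l) 0 L).
  { rewrite RInt_Rplus, Hflux by (easy || (apply ex_RInt_cont; auto)).
    symmetry. apply Rplus_0_r. }
  rewrite Hadd. apply Rle_trans with (2 := Req_le _ _ (RInt_zero 0 L)).
  apply RInt_le; [lra | | |].
  - apply ex_RInt_cont. intros l.
    apply (continuous_plus (V := R_NormedModule) (dF y) (dflux y)); auto.
  - apply ex_RInt_cont. intros; apply continuous_const.
  - intros l Hl.
    (* The cutoff recedes at the characteristic speed, so its two derivatives complete the square
       [(p + l f) ^ 2]. All other terms cancel by the two equations, the derivative of the weight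
       [l ^ k] taking care of the term of order zero. *)
    replace (dF y l + dflux y l) with
      (- (2 * Rmax 0 (L - l - y) * pw k l * (p l y + l * f l y) ^ 2)).
    + assert (0 <= Rmax 0 (L - l - y)) by apply Rmax_l.
      assert (0 <= pw k l) by apply pw_ge_0.
      assert (0 <= Rmax 0 (L - l - y) * pw k l) by now apply Rmult_le_pos.
      pose proof (pow2_ge_0 (p l y + l * f l y)). nra.
    + unfold dF, dflux.
      replace (pw k l) with (l * pw (k - 1) l)
        by (rewrite <- pw_succ; f_equal; ring).
      specialize (E1 l y). specialize (E2 l y).
      replace (px l y) with (- (l * fy l y)) by lra.
      replace (py l y) with (- (l * fx l y) - (k + 1) * f l y) by lra.
      ring. }
assert (HE0 : E 0 = 0).
{ unfold E. rewrite (RInt_ext _ (fun _ => 0)).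
  - apply RInt_zero.
  - intros l. rewrite Rmin_left, Rmax_right by lra. intros Hl.
    unfold F. destruct (Hinit l ltac:(lra)) as [-> ->]. eqR. ring. }
intros y Hy. fold (F y). fold (E y).
destruct (MVT_gen E 0 y (fun y => RInt (dF y) 0 L)) as [c [Hc Heq]].
- auto.
- intros x _. apply continuity_pt_filterlim. apply (ex_derive_continuous E).
  eexists. apply HEd.
- rewrite Rmin_left, Rmax_right in Hc by lra.
  pose proof (Hneg c ltac:(lra)). nra.
Qed.

Lemma RInt_le_0_zero (g : R -> R) (a b x : R) :
  (forall t, continuous g t) -> (forall t, 0 <= g t) ->
  RInt g a b <= 0 -> a < x < b -> g x = 0.
Proof.
intros Hc Hpos Hint Hx. apply Rle_antisym; [| apply Hpos]. apply Rnot_lt_le. intros Hgx.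
pose proof (Hc x) as Hcx. apply continuity_pt_filterlim in Hcx.
destruct (Hcx (g x / 2) ltac:(lra)) as (d & Hd & Hlim).
set (e := Rmin d (Rmin (x - a) (b - x)) / 2).
assert (Hmin : 0 < Rmin d (Rmin (x - a) (b - x))) by (repeat apply Rmin_glb_lt; lra).
assert (He : 0 < e) by (unfold e; lra).
assert (Hed : e < d).
{ unfold e. pose proof (Rmin_l d (Rmin (x - a) (b - x))). lra. }
assert (Hexa : e < x - a /\ e < b - x).
{ pose proof (Rmin_r d (Rmin (x - a) (b - x))).
  pose proof (Rmin_l (x - a) (b - x)). pose proof (Rmin_r (x - a) (b - x)).
  unfold e. lra. }
assert (Hmid : 0 < RInt g (x - e) (x + e)).
{ apply RInt_gt_0; [lra | | auto]. intros t Ht.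
  destruct (Req_dec t x) as [-> | Htx]; [lra |].
  assert (Hdist : Rabs (g t - g x) < g x / 2).
  { apply Hlim. split; [split; [exact I | auto] |].
    simpl. unfold R_dist. apply Rabs_lt_between. lra. }
  apply Rabs_lt_between in Hdist. lra. }
rewrite <- (RInt_Chasles (V := R_CompleteNormedModule) g a (x - e) b) in Hint
  by now apply ex_RInt_cont.
rewrite <- (RInt_Chasles (V := R_CompleteNormedModule) g (x - e) (x + e) b) in Hint
  by now apply ex_RInt_cont.
unfold plus in Hint; simpl in Hint.
assert (0 <= RInt g a (x - e)) by (apply RInt_ge_0; auto; [lra | now apply ex_RInt_cont]).
assert (0 <= RInt g (x + e) b) by (apply RInt_ge_0; auto; [lra | now apply ex_RInt_cont]).
lra.
Qed.

Lemma lifted_system_cauchy_future (k : R) (p f : R -> R -> R) : 1 < k ->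
  lifted_system k p f -> (forall l, 0 <= l -> p l 0 = 0 /\ f l 0 = 0) ->
  forall l y, 0 < l -> 0 <= y -> p l y = 0 /\ f l y = 0.
Proof.
intros Hk Hsys Hinit l y Hl Hy.
(* Places [(l, y)] inside the support of the cutoff, with [L - l - y = 1]. *)
set (L := l + y + 1). assert (HL : 0 < L) by (unfold L; lra).
pose proof (lifted_system_energy k L p f Hk HL Hsys Hinit y Hy) as HE.
destruct Hsys as (px & py & fx & fy & HCp & HCf & _).
pose proof (C1_with_continuous _ _ _ HCp) as Hpc.
pose proof (C1_with_continuous _ _ _ HCf) as Hfc.
assert (Hpcl : forall t, continuous (fun t => p t y) t).
{ intros t. apply (continuous_2d_comp p (fun t => t) (fun _ => y));
    [apply Hpc | apply continuous_id | apply continuous_const]. }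
assert (Hfcl : forall t, continuous (fun t => t * f t y) t).
{ intros t. apply continuous_Rmult; [apply continuous_id |].
  apply (continuous_2d_comp f (fun t => t) (fun _ => y));
    [apply Hfc | apply continuous_id | apply continuous_const]. }
apply RInt_le_0_zero with (x := l) in HE.
- assert (H1 : 0 < pos2 (L - l - y) * pw k l).
  { apply Rmult_lt_0_compat.
    - unfold pos2, L. rewrite Rmax_right by lra. nra.
    - rewrite pw_pos by easy. apply Rpower_gt_0. }
  apply Rmult_integral in HE. destruct HE as [HE | HE]; [lra |].
  assert (Hp0 : p l y = 0) by nra.
  assert (Hf0 : l * f l y = 0) by nra.
  split; [easy |]. apply Rmult_integral in Hf0. lra.
- intros t. apply continuous_Rmult; [apply continuous_Rmult |].
  + apply (continuous_comp (fun t => L - t - y) pos2).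
    * apply (ex_derive_continuous (fun t => L - t - y)). auto_derive. easy.
    * apply (ex_derive_continuous pos2). eexists. apply is_derive_pos2.
  + apply continuous_pw. lra.
  + apply (continuous_plus (V := R_NormedModule) (fun t => p t y * p t y));
      apply continuous_Rmult; auto.
- intros t. apply Rmult_le_pos; [apply Rmult_le_pos |].
  + unfold pos2. pose proof (Rmax_l 0 (L - t - y)). now apply Rmult_le_pos.
  + apply pw_ge_0.
  + nra.
- unfold L. lra.
Qed.

(** Time reversal, under which [f] changes sign like a velocity; it carries the estimate for
    [y >= 0] over to negative [y]. *)
Lemma lifted_system_reverse (k : R) (p f : R -> R -> R) :
  lifted_system k p f -> lifted_system k (fun l y => p l (- y)) (fun l y => - f l (- y)).
Proof.
intros (px & py & fx & fy & (Hp1 & Hp2 & Hp3 & Hp4) & (Hf1 & Hf2 & Hf3 & Hf4)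
  & Ep & Ef & E1 & E2).
assert (Hc : forall G, continuous_2d G -> continuous_2d (fun l y => G l (- y))).
{ intros G HG l y. apply (continuity_2d_pt_comp G (fun u _ => u) (fun _ v => - v));
    [apply HG | apply continuity_2d_pt_id1 |].
  apply continuity_2d_pt_opp, continuity_2d_pt_id2. }
assert (Hd : forall G dG y, (forall x, is_derive G x (dG x)) ->
  is_derive (fun v => G (- v)) y (- dG (- y))).
{ intros G dG y HG. replace (- dG (- y)) with (scal (-1) (dG (- y)))
    by (unfold scal; simpl; unfold mult; simpl; ring).
  apply (is_derive_comp (K := R_AbsRing) (V := R_NormedModule) G Ropp); [apply HG |].
  auto_derive; [easy | ring]. }
exists (fun l y => px l (- y)), (fun l y => - py l (- y)),
  (fun l y => - fx l (- y)), (fun l y => - - fy l (- y)).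
split; [| split; [| split; [| split; [| split]]]].
- split; [| split; [| split]].
  + intros; apply Hp1.
  + intros; now apply Hd.
  + now apply Hc.
  + intros x y. apply continuity_2d_pt_opp. now apply (Hc py).
- split; [| split; [| split]].
  + intros x y. now apply (is_derive_opp (V := R_NormedModule) (fun u => f u (- y))).
  + intros x y. apply (is_derive_opp (V := R_NormedModule) (fun v => f x (- v))).
    now apply Hd.
  + intros x y. apply continuity_2d_pt_opp. now apply (Hc fx).
  + intros x y. apply continuity_2d_pt_opp, continuity_2d_pt_opp. now apply (Hc fy).
- intros; apply Ep.
- intros; now rewrite Ef.
- intros l y. specialize (E1 l (- y)). lra.
- intros l y. specialize (E2 l (- y)). lra.
Qed.

Theorem lifted_system_cauchy_unique (k : R) (p f : R -> R -> R) : 1 < k ->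
  lifted_system k p f -> (forall l, 0 <= l -> p l 0 = 0 /\ f l 0 = 0) ->
  forall l y, 0 < l -> p l y = 0 /\ f l y = 0.
Proof.
intros Hk Hsys Hinit l y Hl. destruct (Rle_dec 0 y) as [Hy | Hy].
- now apply (lifted_system_cauchy_future k).
- destruct (lifted_system_cauchy_future k _ _ Hk (lifted_system_reverse _ _ _ Hsys))
    with (l := l) (y := - y) as [H1 H2]; [| easy | lra |].
  + intros r Hr. rewrite Ropp_0. destruct (Hinit r Hr) as [-> ->].
    split; [easy | ring].
  + rewrite Ropp_involutive in H1, H2. split; [easy | lra].
Qed.

(** * Calculus on the closed half-plane *)

Lemma is_dsigma_eps (f : R -> R -> R) (sigma tau l : R) : 0 <= sigma ->
  is_dsigma f sigma tau l <->
  (forall eps, 0 < eps -> exists d, 0 < d /\ forall s, 0 <= s -> Rabs (s - sigma) < d ->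
     Rabs (f s tau - f sigma tau - (s - sigma) * l) <= eps * Rabs (s - sigma)).
Proof.
intros Hsigma. split.
- intros [_ H] eps Heps.
  destruct (H sigma (fun P HP => filter_le_within _ P HP) (mkposreal eps Heps))
    as [d Hd].
  exists d. split; [apply cond_pos |]. intros s Hs Hsd. exact (Hd s Hsd Hs).
- intros H. split.
  { apply (is_linear_scal_l (K := R_AbsRing) (V := R_NormedModule)). }
  intros x Hx eps.
  (* [filterdiff] quantifies over all limit points of the filter. Since [sigma] belongs to every set
     of this filter, it is the only one. *)
  assert (x = sigma) as ->.
  { apply Classical_Prop.NNPP. intros Hne.
    assert (Hpos : 0 < Rabs (sigma - x) / 2).
    { apply Rdiv_lt_0_compat; [apply Rabs_pos_lt | ]; lra. }
    destruct (Hx (fun s => Rabs (s - x) < Rabs (sigma - x) / 2)) as [d Hd].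
    - exists (mkposreal _ Hpos). intros s Hs. exact Hs.
    - specialize (Hd sigma (ball_center sigma d) Hsigma). simpl in Hd. lra. }
  destruct (H eps (cond_pos eps)) as (d & Hd & Hs).
  exists (mkposreal d Hd). intros s Hsd Hs0. exact (Hs s Hs0 Hsd).
Qed.

Lemma is_dsigma_unique (f : R -> R -> R) (sigma tau l1 l2 : R) : 0 <= sigma ->
  is_dsigma f sigma tau l1 -> is_dsigma f sigma tau l2 -> l1 = l2.
Proof.
intros Hsigma H1 H2. rewrite is_dsigma_eps in H1, H2 by easy.
apply Classical_Prop.NNPP. intros Hne.
assert (Hpos : 0 < Rabs (l1 - l2)) by (apply Rabs_pos_lt; lra).
destruct (H1 (Rabs (l1 - l2) / 4) ltac:(lra)) as (d1 & Hd1 & Hs1).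
destruct (H2 (Rabs (l1 - l2) / 4) ltac:(lra)) as (d2 & Hd2 & Hs2).
set (h := Rmin d1 d2 / 2).
assert (Hmin : 0 < Rmin d1 d2) by now apply Rmin_glb_lt.
pose proof (Rmin_l d1 d2). pose proof (Rmin_r d1 d2).
assert (Hh : 0 < h < d1 /\ h < d2) by (unfold h; lra).
assert (Habs : Rabs (sigma + h - sigma) = h).
{ replace (sigma + h - sigma) with h by ring. apply Rabs_pos_eq. lra. }
specialize (Hs1 (sigma + h) ltac:(lra)). specialize (Hs2 (sigma + h) ltac:(lra)).
rewrite Habs in Hs1, Hs2. specialize (Hs1 ltac:(lra)). specialize (Hs2 ltac:(lra)).
replace (sigma + h - sigma) with h in Hs1, Hs2 by ring.
set (D := f (sigma + h) tau - f sigma tau) in *.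
assert (H3 : Rabs (h * (l1 - l2)) <= Rabs (l1 - l2) / 2 * h).
{ replace (h * (l1 - l2)) with ((D - h * l2) - (D - h * l1)) by ring.
  eapply Rle_trans; [apply Rabs_triang |]. rewrite Rabs_Ropp. lra. }
rewrite Rabs_mult, (Rabs_pos_eq h) in H3 by lra. nra.
Qed.

Lemma Dsigma_eq (f : R -> R -> R) (sigma tau l : R) : 0 <= sigma ->
  is_dsigma f sigma tau l -> Dsigma f sigma tau = l.
Proof.
intros Hsigma H. apply (iota_unique (V := R_CompleteNormedModule)); [| exact H].
intros y Hy. now apply (is_dsigma_unique f sigma tau).
Qed.

Lemma Dsigma_correct (f : R -> R -> R) (sigma tau : R) : 0 <= sigma ->
  ex_dsigma f sigma tau -> is_dsigma f sigma tau (Dsigma f sigma tau).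
Proof. intros Hsigma [l Hl]. now rewrite (Dsigma_eq f sigma tau l). Qed.

Lemma is_derive_dsigma (f : R -> R -> R) (sigma tau l : R) : 0 < sigma ->
  is_dsigma f sigma tau l -> is_derive (fun s => f s tau) sigma l.
Proof.
intros Hsigma H. rewrite is_dsigma_eps in H by lra.
apply is_derive_Reals. intros eps Heps.
destruct (H (eps / 2) ltac:(lra)) as (d & Hd & Hs).
exists (mkposreal (Rmin d sigma) (Rmin_glb_lt _ _ _ Hd Hsigma)).
intros h Hh Hhd. simpl in Hhd.
pose proof (Rmin_l d sigma). pose proof (Rmin_r d sigma).
pose proof (Rabs_pos_lt h Hh) as Hh0.
assert (Hh1 : Rabs h < sigma) by lra. apply Rabs_lt_between in Hh1.
specialize (Hs (sigma + h) ltac:(lra)).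
replace (sigma + h - sigma) with h in Hs by ring. specialize (Hs ltac:(lra)).
replace ((f (sigma + h) tau - f sigma tau) / h - l)
  with ((f (sigma + h) tau - f sigma tau - h * l) * / h) by (field; easy).
rewrite Rabs_mult, Rabs_inv.
apply Rle_lt_trans with (eps / 2); [| lra].
apply Rmult_le_reg_r with (Rabs h); [easy |].
rewrite Rmult_assoc, Rinv_l, Rmult_1_r by lra. easy.
Qed.

(** [u ^ 2] never leaves [[0, oo)], so even at [l = 0] the one-sided derivative of [f] yields a
    two-sided derivative in [u]. The error splits into the one from [f] and the term [h * D] left by
    [(2 l + h) * D]. *)
Lemma is_derive_dsigma_sqr (f : R -> R -> R) (l tau D : R) :
  is_dsigma f (l ^ 2) tau D -> is_derive (fun u => f (u ^ 2) tau) l (2 * l * D).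
Proof.
intros H. rewrite is_dsigma_eps in H by apply pow2_ge_0.
apply is_derive_Reals. intros eps Heps.
set (N := 2 * Rabs l + 1).
assert (HN : 0 < N) by (unfold N; pose proof (Rabs_pos l); lra).
set (K := Rabs D + 1).
assert (HK : 0 < K) by (unfold K; pose proof (Rabs_pos D); lra).
destruct (H (eps / (4 * N))) as (d & Hd & Hs); [apply Rdiv_lt_0_compat; lra |].
assert (Hdelta : 0 < Rmin 1 (Rmin (d / N) (eps / (2 * K)))).
{ repeat apply Rmin_glb_lt; try apply Rdiv_lt_0_compat; lra. }
exists (mkposreal _ Hdelta). intros h Hh Hhd. simpl in Hhd.
assert (H1 : Rabs h < 1) by (eapply Rlt_le_trans; [exact Hhd | apply Rmin_l]).
assert (H2 : Rabs h < d / N).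
{ eapply Rlt_le_trans; [exact Hhd |]. eapply Rle_trans; [apply Rmin_r | apply Rmin_l]. }
assert (H3 : Rabs h < eps / (2 * K)).
{ eapply Rlt_le_trans; [exact Hhd |]. eapply Rle_trans; [apply Rmin_r | apply Rmin_r]. }
apply Rlt_div_r in H2; [| easy]. apply Rlt_div_r in H3; [| lra].
pose proof (Rabs_pos_lt h Hh) as Hh0.
assert (Hsq : (l + h) ^ 2 - l ^ 2 = h * (2 * l + h)) by ring.
assert (HNl : Rabs (2 * l + h) <= N).
{ eapply Rle_trans; [apply Rabs_triang |]. rewrite Rabs_mult, (Rabs_pos_eq 2) by lra.
  unfold N. lra. }
specialize (Hs ((l + h) ^ 2) (pow2_ge_0 _)). rewrite Hsq, Rabs_mult in Hs.
assert (Hlt : Rabs h * Rabs (2 * l + h) < d).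
{ apply Rle_lt_trans with (2 := H2). apply Rmult_le_compat_l; lra. }
specialize (Hs Hlt).
set (E := f ((l + h) ^ 2) tau - f (l ^ 2) tau - h * (2 * l + h) * D) in *.
replace ((f ((l + h) ^ 2) tau - f (l ^ 2) tau) / h - 2 * l * D) with (E * / h + h * D)
  by (unfold E; field; easy).
apply Rle_lt_trans with (1 := Rabs_triang _ _).
rewrite 2!Rabs_mult, Rabs_inv.
assert (HE : Rabs E * / Rabs h <= eps / 4).
{ apply Rmult_le_reg_r with (Rabs h); [easy |].
  rewrite Rmult_assoc, Rinv_l, Rmult_1_r by lra.
  apply Rle_trans with (1 := Hs).
  replace (eps / 4 * Rabs h) with (eps / (4 * N) * (Rabs h * N)) by (field; lra).
  apply Rmult_le_compat_l; [left; apply Rdiv_lt_0_compat; lra |].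
  apply Rmult_le_compat_l; lra. }
assert (HD : Rabs h * Rabs D <= Rabs h * K) by (apply Rmult_le_compat_l; unfold K; lra).
lra.
Qed.

Lemma continuous_halfplane_sqr (G : R -> R -> R) (kappa : R) :
  continuous_halfplane G -> continuous_2d (fun l y => G (l ^ 2) (kappa * y)).
Proof.
intros HG l y. apply continuity_2d_pt_filterlim. simpl fst. simpl snd.
apply (filterlim_comp _ _ _ (fun z : R * R => (fst z ^ 2, kappa * snd z))
  (fun z : R * R => G (fst z) (snd z)) _
  (within (fun p : R * R => 0 <= fst p) (locally (l ^ 2, kappa * y)))).
- intros P HP.
  assert (Hc : filterlim (fun z : R * R => (fst z ^ 2, kappa * snd z))
    (locally (l, y)) (locally (l ^ 2, kappa * y))).
  { apply (continuous_comp_2 (fun z : R * R => fst z ^ 2) (fun z : R * R => kappa * snd z)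
      (fun a b => (a, b))).
    - apply (continuous_comp fst (fun a => a ^ 2)); [apply continuous_fst |].
      apply (ex_derive_continuous (fun a => a ^ 2)). auto_derive. easy.
    - apply (continuous_comp snd (fun b => kappa * b)); [apply continuous_snd |].
      apply (ex_derive_continuous (fun b => kappa * b)). auto_derive. easy.
    - apply continuous_ext with (f := fun z : R * R => z);
        [now intros [] | apply continuous_id]. }
  specialize (Hc _ HP). unfold filtermap in *. revert Hc. apply filter_imp.
  intros z Hz. exact (Hz (pow2_ge_0 (fst z))).
- apply HG, pow2_ge_0.
Qed.

Lemma C1_with_sqr (f : R -> R -> R) (kappa : R) : Ck_halfplane 1 f ->
  C1_with (fun l y => f (l ^ 2) (kappa * y))
    (fun l y => 2 * l * Dsigma f (l ^ 2) (kappa * y))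
    (fun l y => kappa * Dtau f (l ^ 2) (kappa * y)).
Proof.
intros (_ & Hex & [Hs _] & [Ht _]). split; [| split; [| split]].
- intros l y. apply (is_derive_dsigma_sqr f).
  apply Dsigma_correct; [apply pow2_ge_0 | apply Hex, pow2_ge_0].
- intros l y. apply (is_derive_comp (K := R_AbsRing) (V := R_NormedModule)
    (f (l ^ 2)) (fun v => kappa * v)).
  + apply Derive_correct. now apply Hex, pow2_ge_0.
  + auto_derive; [easy | ring].
- intros l y. apply continuity_2d_pt_mult.
  + apply continuity_2d_pt_mult; [apply continuity_2d_pt_const | apply continuity_2d_pt_id1].
  + now apply (continuous_halfplane_sqr (Dsigma f) kappa).
- intros l y. apply continuity_2d_pt_mult; [apply continuity_2d_pt_const |].
  now apply (continuous_halfplane_sqr (Dtau f) kappa).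
Qed.

(** * Passage from the linear system to the lifted one *)

(** Along characteristics [sigma] changes at rate plus or minus [omega sqrt sigma], hence
    [sqrt sigma] at rate [omega / 2]; measuring [tau] in units of [2 / omega] makes this speed 1.
    The constant of the recovery formulas is [bay_q m = PI * cg_kappa m]. *)
Definition cg_kappa (m : R) : R := 2 / bay_omega m.

Lemma bay_omega_gt_0 (m : R) : 0 < m -> 0 < bay_omega m.
Proof. intros Hm. apply sqrt_lt_R0, Rdiv_lt_0_compat; lra. Qed.

Lemma cg_kappa_gt_0 (m : R) : 0 < m -> 0 < cg_kappa m.
Proof. intros Hm. apply Rdiv_lt_0_compat; [lra | now apply bay_omega_gt_0]. Qed.

Lemma cg_kappa_sqr (m : R) : 0 < m -> cg_kappa m * cg_kappa m = 4 * (m + 1) / m.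
Proof.
intros Hm. pose proof (bay_omega_gt_0 m Hm) as Ho.
assert (E : bay_omega m * bay_omega m = m / (m + 1)).
{ apply sqrt_sqrt. left. apply Rdiv_lt_0_compat; lra. }
unfold cg_kappa.
replace (2 / bay_omega m * (2 / bay_omega m)) with (4 / (bay_omega m * bay_omega m))
  by (field; lra).
rewrite E. field. lra.
Qed.

(** The terms with [Dsigma phi] match because [kappa ^ 2 = 4 (m + 1) / m]. Those of order zero match
    when [k + 1 = kappa ^ 2 / 2 = 2 + 2 / m], which fixes [k]. *)
Theorem linear_system_lift (m : R) (psi phi : R -> R -> R) : 0 < m ->
  Ck_halfplane 1 psi -> Ck_halfplane 1 phi -> linear_system m psi phi ->
  lifted_system (2 / m + 1) (fun l y => psi (l ^ 2) (cg_kappa m * y))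
    (fun l y => 2 / cg_kappa m * phi (l ^ 2) (cg_kappa m * y)).
Proof.
intros Hm Hpsi Hphi Hsys.
pose proof (cg_kappa_gt_0 m Hm) as Hk. pose proof (cg_kappa_sqr m Hm) as Hk2.
set (kap := cg_kappa m) in *.
destruct (C1_with_sqr phi kap Hphi) as (H1 & H2 & H3 & H4).
do 4 eexists. split; [exact (C1_with_sqr psi kap Hpsi) |].
split; [| split; [| split; [| split]]].
- split; [| split; [| split]].
  + intros l y. apply (is_derive_scal (fun u => phi (u ^ 2) (kap * y))). apply H1.
  + intros l y. apply (is_derive_scal (fun v => phi (l ^ 2) (kap * v))). apply H2.
  + intros l y. apply continuity_2d_pt_mult; [apply continuity_2d_pt_const | apply H3].
  + intros l y. apply continuity_2d_pt_mult; [apply continuity_2d_pt_const | apply H4].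
- intros l y. now replace ((- l) ^ 2) with (l ^ 2) by ring.
- intros l y. now replace ((- l) ^ 2) with (l ^ 2) by ring.
- intros l y. destruct (Hsys (l ^ 2) (kap * y) (pow2_ge_0 l)) as [_ E].
  cbv beta. replace (Dtau phi (l ^ 2) (kap * y)) with (- Dsigma psi (l ^ 2) (kap * y)) by lra.
  field. lra.
- intros l y. destruct (Hsys (l ^ 2) (kap * y) (pow2_ge_0 l)) as [E _].
  cbv beta. set (A := Dsigma phi (l ^ 2) (kap * y)) in *.
  set (B := phi (l ^ 2) (kap * y)) in *.
  replace (Dtau psi (l ^ 2) (kap * y)) with (- (m / (m + 1) * l ^ 2 * A) - B) by lra.
  apply Rmult_eq_reg_l with kap; [| lra].
  replace (kap * _) with (4 * l ^ 2 * A + 2 * (2 / m + 1 + 1) * B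
    - (kap * kap) * (m / (m + 1) * l ^ 2 * A + B)) by (field; lra).
  rewrite Hk2. field. lra.
Qed.

Lemma continuous_zero_right (h : R -> R) :
  continuous h 0 -> (forall l, 0 < l -> h l = 0) -> h 0 = 0.
Proof.
intros Hc H0. apply Classical_Prop.NNPP. intros Hne.
apply continuity_pt_filterlim in Hc.
destruct (Hc (Rabs (h 0)) (Rabs_pos_lt _ Hne)) as (d & Hd & Hlim).
specialize (Hlim (d / 2)). simpl in Hlim. unfold R_dist in Hlim.
rewrite H0, !Rminus_0_r, Rminus_0_l, Rabs_Ropp in Hlim by lra.
assert (Hx : Rabs (h 0) < Rabs (h 0)); [| lra].
apply Hlim. split; [split; [exact I | lra] |]. rewrite Rabs_pos_eq; lra.
Qed.

Lemma sqrt_lift (sigma kappa tau : R) : 0 <= sigma -> 0 < kappa ->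
  sigma = sqrt sigma ^ 2 /\ tau = kappa * (tau / kappa).
Proof. intros Hs Hk. split; [now rewrite pow2_sqrt | field; lra]. Qed.

Theorem linear_system_trace_unique (m : R) (psi phi psi' phi' : R -> R -> R) : 0 < m ->
  Ck_halfplane 1 psi -> Ck_halfplane 1 phi -> linear_system m psi phi ->
  Ck_halfplane 1 psi' -> Ck_halfplane 1 phi' -> linear_system m psi' phi' ->
  (forall tau, psi' 0 tau = psi 0 tau) ->
  forall sigma tau, 0 <= sigma ->
    psi' sigma tau = psi sigma tau /\ phi' sigma tau = phi sigma tau.
Proof.
intros Hm Hpsi Hphi Hsys Hpsi' Hphi' Hsys' Htr sigma tau Hsigma.
pose proof (cg_kappa_gt_0 m Hm) as Hk.
assert (Hq : 0 < 2 / m) by (apply Rdiv_lt_0_compat; lra).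
pose proof (lifted_system_minus _ _ _ _ _
  (linear_system_lift m psi' phi' Hm Hpsi' Hphi' Hsys')
  (linear_system_lift m psi phi Hm Hpsi Hphi Hsys)) as Hd.
destruct (lifted_system_trace_unique (2 / m) _ _ Hq Hd) with
  (l := sqrt sigma) (y := tau / cg_kappa m) as [H1 H2].
- intros y. replace (0 ^ 2) with 0 by ring. rewrite Htr. ring.
- destruct (sqrt_lift sigma (cg_kappa m) tau Hsigma Hk) as [E1 E2].
  rewrite <- E1, <- E2 in H1, H2. split; [lra |].
  rewrite <- Rmult_minus_distr_l in H2. apply Rmult_integral in H2.
  destruct H2 as [H2 | H2]; [| lra].
  assert (0 < 2 / cg_kappa m) by (apply Rdiv_lt_0_compat; lra). lra.
Qed.

(** The energy weight vanishes at [l = 0], so the estimate settles only [l > 0]. Continuity then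
    gives the trace of [psi] on [sigma = 0], and uniqueness from the trace covers everything
    else. *)
Theorem linear_system_cauchy_unique (m : R) (psi phi psi' phi' : R -> R -> R) : 0 < m ->
  Ck_halfplane 1 psi -> Ck_halfplane 1 phi -> linear_system m psi phi ->
  Ck_halfplane 1 psi' -> Ck_halfplane 1 phi' -> linear_system m psi' phi' ->
  (forall sigma, 0 <= sigma -> psi' sigma 0 = psi sigma 0 /\ phi' sigma 0 = phi sigma 0) ->
  forall sigma tau, 0 <= sigma ->
    psi' sigma tau = psi sigma tau /\ phi' sigma tau = phi sigma tau.
Proof.
intros Hm Hpsi Hphi Hsys Hpsi' Hphi' Hsys' Hini.
pose proof (cg_kappa_gt_0 m Hm) as Hk.
assert (Hq : 0 < 2 / m) by (apply Rdiv_lt_0_compat; lra).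
pose proof (linear_system_lift m psi' phi' Hm Hpsi' Hphi' Hsys') as Hl'.
pose proof (linear_system_lift m psi phi Hm Hpsi Hphi Hsys) as Hl.
pose proof (lifted_system_minus _ _ _ _ _ Hl' Hl) as Hd.
assert (Hpos : forall l y, 0 < l -> psi' (l ^ 2) (cg_kappa m * y)
  = psi (l ^ 2) (cg_kappa m * y)).
{ intros l y H.
  destruct (lifted_system_cauchy_unique (2 / m + 1) _ _ ltac:(lra) Hd) with
    (l := l) (y := y) as [H1 _]; [| easy | lra].
  intros r _. rewrite Rmult_0_r.
  destruct (Hini (r ^ 2) (pow2_ge_0 r)) as [-> ->]. split; ring. }
apply (linear_system_trace_unique m); auto. intros tau.
destruct Hd as (px & _ & _ & _ & (Hpx & _) & _).
set (y := tau / cg_kappa m).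
assert (Htau : tau = cg_kappa m * y) by (unfold y; field; lra). rewrite Htau.
set (h := fun l => psi' (l ^ 2) (cg_kappa m * y) - psi (l ^ 2) (cg_kappa m * y)).
assert (H0 : h 0 = 0).
{ apply continuous_zero_right.
  - apply (ex_derive_continuous h). exists (px 0 y). apply Hpx.
  - intros l H. unfold h. rewrite Hpos by easy. ring. }
unfold h in H0. replace (0 ^ 2) with 0 in H0 by ring. lra.
Qed.

(** * From the shallow water equations to the linear system *)

Lemma locally_fst_gt_0 (sigma tau : R) : 0 < sigma ->
  locally (sigma, tau) (fun z : R * R => 0 < fst z).
Proof.
intros H. exact (continuous_fst sigma tau _ (locally_gt sigma 0 H)).
Qed.

Lemma halfplane_differentiable (f : R -> R -> R) (sigma tau : R) : 0 < sigma ->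
  Ck_halfplane 1 f ->
  differentiable_pt_lim f sigma tau (Dsigma f sigma tau) (Dtau f sigma tau).
Proof.
intros Hsigma (_ & Hex & [Hs _] & _). apply differentiable_pt_lim_C1.
- generalize (locally_fst_gt_0 sigma tau Hsigma). apply filter_imp.
  intros [s t] H. simpl in *. apply is_derive_dsigma; [easy |].
  apply Dsigma_correct; [lra | apply Hex; lra].
- apply Derive_correct. apply Hex. lra.
- apply continuity_2d_pt_filterlim. intros P HP.
  pose proof (Hs sigma tau ltac:(lra) P HP) as H. unfold filtermap, within in *.
  generalize (filter_and _ _ H (locally_fst_gt_0 sigma tau Hsigma)).
  apply filter_imp. intros z [Hz Hz0]. apply Hz. lra.
Qed.

Lemma differentiable_pt_lim_inj (f : R -> R -> R) (x y a b a' b' : R) :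
  differentiable_pt_lim f x y a b -> differentiable_pt_lim f x y a' b' ->
  a = a' /\ b = b'.
Proof.
intros H H'. apply differentiable_pt_lim_unique in H, H'.
destruct H as [<- <-], H' as [<- <-]. easy.
Qed.

Lemma cg_sigma_differentiable (eta : R -> R -> R) (x t a b : R) :
  differentiable_pt_lim eta x t a b ->
  differentiable_pt_lim (cg_sigma eta) x t (1 + a) b.
Proof.
intros H eps. generalize (H eps). apply locally_2d_impl, locally_2d_forall.
intros s r Hsr. unfold cg_sigma.
replace (s + eta s r - (x + eta x t) - ((1 + a) * (s - x) + b * (r - t)))
  with (eta s r - eta x t - (a * (s - x) + b * (r - t))) by ring. easy.
Qed.

Lemma cg_tau_differentiable (u : R -> R -> R) (x t a b : R) :
  differentiable_pt_lim u x t a b ->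
  differentiable_pt_lim (cg_tau u) x t (- a) (1 - b).
Proof.
intros H eps. generalize (H eps). apply locally_2d_impl, locally_2d_forall.
intros s r Hsr. unfold cg_tau.
replace (r - u s r - (t - u x t) - (- a * (s - x) + (1 - b) * (r - t)))
  with (- (u s r - u x t - (a * (s - x) + b * (r - t)))) by ring.
now rewrite Rabs_Ropp.
Qed.

Lemma bernoulli_differentiable (eta u : R -> R -> R) (x t a b p w : R) :
  differentiable_pt_lim eta x t a b -> differentiable_pt_lim u x t p w ->
  differentiable_pt_lim (fun x t => eta x t + / 2 * (u x t) ^ 2) x t
    (a + u x t * p) (b + u x t * w).
Proof.
intros Heta Hu.
assert (H : differentiable_pt_lim (fun e v => e + / 2 * v ^ 2) (eta x t) (u x t)
  1 (u x t)).
{ apply (differentiable_pt_lim_C1 (fun e v => e + / 2 * v ^ 2) (fun _ _ => 1)).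
  - apply filter_forall. intros z. auto_derive; [easy | ring].
  - auto_derive; [easy | field].
  - apply continuity_2d_pt_const. }
pose proof (differentiable_pt_lim_comp _ _ _ _ _ _ _ _ _ _ _ H Heta Hu) as Hc.
now rewrite 2!Rmult_1_l in Hc.
Qed.

Lemma locally_2d_wet (eta : R -> R -> R) (x t : R) :
  differentiable_pt eta x t -> wet_interior eta x t ->
  locally_2d (fun y s => wet eta y s) x t.
Proof.
intros Hd Hw. apply differentiable_continuity_pt in Hd.
assert (Hc : continuity_2d_pt (fun y s => y + eta y s) x t)
  by (apply continuity_2d_pt_plus; [apply continuity_2d_pt_id1 | easy]).
generalize (Hc (mkposreal _ Hw)). apply locally_2d_impl, locally_2d_forall.
intros y s H. simpl in H. apply Rabs_lt_between in H. unfold wet. lra.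
Qed.

(* The four chain rules are solved for the derivatives of [psi] and [phi] by
   Cramer's rule, dividing by the Jacobian [a d + b p]. *)
Lemma cg_cramer (a b p w s c u psi_s psi_t phi_s phi_t : R) :
  a * (1 - w) - b * - p <> 0 ->
  p = phi_s * a + phi_t * - p -> w = phi_s * b + phi_t * (1 - w) ->
  a - 1 + u * p = psi_s * a + psi_t * - p ->
  b + u * w = psi_s * b + psi_t * (1 - w) ->
  b + u * a + c * s * p = 0 -> w + u * p + (a - 1) = 0 ->
  psi_t + c * s * phi_s + u = 0 /\ phi_t + psi_s = 0.
Proof.
intros HJ E1 E2 E3 E4 S1 S2. set (J := a * (1 - w) - b * - p) in *.
assert (F1 : J * phi_s = p).
{ replace (J * phi_s) with ((phi_s * a + phi_t * - p) * (1 - w)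
    + p * (phi_s * b + phi_t * (1 - w))) by (unfold J; ring).
  rewrite <- E1, <- E2. ring. }
assert (F2 : J * phi_t = a * w - b * p).
{ replace (J * phi_t) with (a * (phi_s * b + phi_t * (1 - w))
    - b * (phi_s * a + phi_t * - p)) by (unfold J; ring).
  rewrite <- E1, <- E2. ring. }
assert (F3 : J * psi_s = (a - 1 + u * p) * (1 - w) + p * (b + u * w)).
{ rewrite E3, E4. unfold J. ring. }
assert (F4 : J * psi_t = a * (b + u * w) - b * (a - 1 + u * p)).
{ rewrite E3, E4. unfold J. ring. }
assert (Hw : w = - (u * p) - (a - 1)) by lra.
assert (Hcsp : c * s * p = - b - u * a) by lra.
split; apply Rmult_eq_reg_l with J; try easy.
- replace (J * (psi_t + c * s * phi_s + u))
    with (J * psi_t + c * s * (J * phi_s) + J * u) by ring.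
  rewrite F1, F4, Hcsp. unfold J. rewrite Hw. ring.
- rewrite Rmult_plus_distr_l, F2, F3, Hw. ring.
Qed.

(** Points near a wet interior point are wet, so the identities defining [psi] and [phi] can be
    differentiated there. Comparing with the derivatives of [u] and [eta + u ^ 2 / 2] gives the four
    relations of [cg_cramer], and surjectivity reaches every [sigma > 0]. *)
Theorem nonbreaking_wave_linear_system (m : R) (R0 : R -> R) (eta u : R -> R -> R)
    (eta0 u0 : R -> R) (psi phi : R -> R -> R) (gamma : R -> R) :
  nonbreaking_wave m R0 eta u eta0 u0 psi phi gamma -> linear_system m psi phi.
Proof.
intros [Hswe _ _ _ _ Hcg Hpsi Hphi [_ Honto HJ _] _].
specialize (Hpsi 1%nat). specialize (Hphi 1%nat).
assert (Hint : forall sigma tau, 0 < sigma ->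
  Dtau psi sigma tau + m / (m + 1) * sigma * Dsigma phi sigma tau + phi sigma tau = 0 /\
  Dtau phi sigma tau + Dsigma psi sigma tau = 0).
{ intros sigma tau Hsigma.
  destruct (Honto sigma tau ltac:(lra)) as (x & t & Hw & Hs & Ht).
  assert (Hwi : wet_interior eta x t).
  { unfold wet_interior. unfold cg_sigma in Hs. now rewrite Hs. }
  specialize (HJ x t Hwi).
  destruct (Hswe x t Hwi) as (Deta & Du & S1 & S2).
  pose proof (locally_2d_wet eta x t Deta Hwi) as Hloc.
  destruct Deta as (a & b & Deta). destruct Du as (p & w & Du).
  pose proof (cg_sigma_differentiable _ _ _ _ _ Deta) as Dsig.
  pose proof (cg_tau_differentiable _ _ _ _ _ Du) as Dta.
  destruct (Hcg x t Hw) as [Ephi Epsi].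
  subst sigma tau.
  pose proof (differentiable_pt_lim_comp phi _ _ _ _ _ _ _ _ _ _
    (halfplane_differentiable phi _ _ Hsigma Hphi) Dsig Dta) as Cphi.
  pose proof (differentiable_pt_lim_comp psi _ _ _ _ _ _ _ _ _ _
    (halfplane_differentiable psi _ _ Hsigma Hpsi) Dsig Dta) as Cpsi.
  apply (differentiable_pt_lim_ext _ u) in Cphi;
    [| revert Hloc; apply locally_2d_impl, locally_2d_forall; intros y s H;
       now apply Hcg].
  apply (differentiable_pt_lim_ext _ (fun x t => eta x t + / 2 * (u x t) ^ 2)) in Cpsi;
    [| revert Hloc; apply locally_2d_impl, locally_2d_forall; intros y s H;
       now apply Hcg].
  destruct (differentiable_pt_lim_inj _ _ _ _ _ _ _ Du Cphi) as [E1 E2].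
  destruct (differentiable_pt_lim_inj _ _ _ _ _ _ _
    (bernoulli_differentiable _ _ _ _ _ _ _ _ Deta Du) Cpsi) as [E3 E4].
  destruct (differentiable_pt_lim_unique _ _ _ _ _ Deta) as [Pa Pb].
  destruct (differentiable_pt_lim_unique _ _ _ _ _ Du) as [Pp Pw].
  destruct (differentiable_pt_lim_unique _ _ _ _ _ Dsig) as [Psa Psb].
  destruct (differentiable_pt_lim_unique _ _ _ _ _ Dta) as [Pta Ptb].
  unfold cg_jacobian, partial_x, partial_t in *.
  fold (cg_sigma eta) in S1. rewrite Pb, Pp in S1.
  change (fun y : R => y + eta y t) with (fun y : R => cg_sigma eta y t) in S1.
  rewrite Psa in S1. rewrite Pw, Pp, Pa in S2. rewrite Psa, Psb, Pta, Ptb in HJ.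
  rewrite Ephi.
  apply (cg_cramer (1 + a) b p w (cg_sigma eta x t) (m / (m + 1)) (u x t)); auto; lra. }
(* On [sigma = 0] the equations follow by continuity: along [sigma = l ^ 2] their left sides are
   continuous in [l] and vanish for [l > 0]. *)
intros sigma tau [Hsigma | <-]; [now apply Hint |].
assert (Hcont : forall G, continuous_halfplane G -> continuous (fun l => G (l ^ 2) tau) 0).
{ intros G HG. pose proof (continuous_halfplane_sqr G 1 HG) as HG2.
  apply continuous_ext with (f := fun l => G (l ^ 2) (1 * tau)).
  - intros l. now rewrite Rmult_1_l.
  - apply (continuous_2d_comp (fun l y => G (l ^ 2) (1 * y)) (fun l => l) (fun _ => tau));
      [apply HG2 | apply continuous_id | apply continuous_const]. }
destruct Hpsi as (Hpsi & _ & [Hpsis _] & [Hpsit _]).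
destruct Hphi as (Hphi & _ & [Hphis _] & [Hphit _]).
split.
- pose proof (continuous_zero_right (fun l => Dtau psi (l ^ 2) tau
    + m / (m + 1) * l ^ 2 * Dsigma phi (l ^ 2) tau + phi (l ^ 2) tau)) as H.
  cbv beta in H. replace (0 ^ 2) with 0 in H by ring. apply H.
  + apply (continuous_plus (V := R_NormedModule) (fun l => Dtau psi (l ^ 2) tau
      + m / (m + 1) * l ^ 2 * Dsigma phi (l ^ 2) tau)); [| now apply Hcont].
    apply (continuous_plus (V := R_NormedModule) (fun l => Dtau psi (l ^ 2) tau));
      [now apply Hcont |].
    apply continuous_Rmult; [| now apply Hcont].
    apply (ex_derive_continuous (fun l => m / (m + 1) * l ^ 2)). auto_derive. easy.
  + intros l Hl. apply Hint. nra.
- pose proof (continuous_zero_right (fun l => Dtau phi (l ^ 2) tau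
    + Dsigma psi (l ^ 2) tau)) as H.
  cbv beta in H. replace (0 ^ 2) with 0 in H by ring. apply H.
  + apply (continuous_plus (V := R_NormedModule) (fun l => Dtau phi (l ^ 2) tau));
      now apply Hcont.
  + intros l Hl. apply Hint. nra.
Qed.

(** * The shoreline *)

Lemma is_dsigma_cg_x (psi phi : R -> R -> R) (sigma tau a b : R) : 0 <= sigma ->
  is_dsigma psi sigma tau a -> is_dsigma phi sigma tau b ->
  is_dsigma (cg_x psi phi) sigma tau (1 - a + phi sigma tau * b).
Proof.
intros Hsigma Ha Hb. rewrite is_dsigma_eps in Ha, Hb |- * by easy.
intros eps Heps. set (N := 1 + Rabs (phi sigma tau) + (1 + Rabs b) * (1 + Rabs b)).
pose proof (Rabs_pos (phi sigma tau)) as Hp0. pose proof (Rabs_pos b) as Hb0.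
assert (HN : 1 <= N) by (unfold N; nra).
set (e := Rmin (eps / (4 * N)) 1).
assert (He : 0 < e)
  by (apply Rmin_glb_lt; [apply Rdiv_lt_0_compat; lra | lra]).
assert (HeN : e * N <= eps / 4).
{ apply Rle_trans with (eps / (4 * N) * N).
  - apply Rmult_le_compat_r; [lra | apply Rmin_l].
  - right. field. lra. }
assert (He1 : e <= 1) by apply Rmin_r.
destruct (Ha e He) as (d1 & Hd1 & H1). destruct (Hb e He) as (d2 & Hd2 & H2).
exists (Rmin (Rmin d1 d2) e). split; [apply Rmin_glb_lt; [now apply Rmin_glb_lt | easy] |].
intros s Hs Hsd.
pose proof (Rmin_l (Rmin d1 d2) e). pose proof (Rmin_r (Rmin d1 d2) e).
pose proof (Rmin_l d1 d2). pose proof (Rmin_r d1 d2).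
specialize (H1 s Hs ltac:(lra)). specialize (H2 s Hs ltac:(lra)).
set (h := s - sigma) in *. unfold cg_x.
set (A := psi s tau - psi sigma tau - h * a) in *.
set (B := phi s tau - phi sigma tau - h * b) in *.
assert (HD : Rabs (phi s tau - phi sigma tau) <= (1 + Rabs b) * Rabs h).
{ replace (phi s tau - phi sigma tau) with (B + h * b) by (unfold B; ring).
  eapply Rle_trans; [apply Rabs_triang |]. rewrite Rabs_mult.
  pose proof (Rabs_pos h). nra. }
(* [phi ^ 2 / 2] changes by [phi * dphi + dphi ^ 2 / 2]. The three coefficients of the error terms
   add up to at most [N], and [Rabs h < e] turns the quadratic term into one of order
   [e * Rabs h]. *)
replace (_ - _) with (- A + phi sigma tau * B
  + / 2 * ((phi s tau - phi sigma tau) * (phi s tau - phi sigma tau)))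
  by (unfold A, B, h; field).
eapply Rle_trans; [apply Rabs_triang |].
eapply Rle_trans; [apply Rplus_le_compat_r, Rabs_triang |].
rewrite Rabs_Ropp, 3!Rabs_mult, (Rabs_pos_eq (/ 2)) by lra.
pose proof (Rabs_pos h) as Hh.
assert (T1 : Rabs (phi sigma tau) * Rabs B <= Rabs (phi sigma tau) * (e * Rabs h))
  by (apply Rmult_le_compat_l; lra).
assert (T2 : Rabs (phi s tau - phi sigma tau) * Rabs (phi s tau - phi sigma tau)
  <= ((1 + Rabs b) * Rabs h) * ((1 + Rabs b) * Rabs h))
  by (apply Rmult_le_compat; try apply Rabs_pos; easy).
assert (T3 : ((1 + Rabs b) * Rabs h) * ((1 + Rabs b) * Rabs h)
  <= (1 + Rabs b) * (1 + Rabs b) * (e * Rabs h)).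
{ replace ((1 + Rabs b) * Rabs h * ((1 + Rabs b) * Rabs h))
    with ((1 + Rabs b) * (1 + Rabs b) * (Rabs h * Rabs h)) by ring.
  apply Rmult_le_compat_l; [nra |]. apply Rmult_le_compat_r; lra. }
assert (T4 : e * N * Rabs h <= eps / 4 * Rabs h) by (apply Rmult_le_compat_r; lra).
unfold N in T4.
assert (0 <= eps * Rabs h) by (apply Rmult_le_pos; lra).
assert (0 <= e * Rabs h) by (apply Rmult_le_pos; lra).
assert (0 <= (1 + Rabs b) * (1 + Rabs b) * (e * Rabs h)) by (apply Rmult_le_pos; nra).
lra.
Qed.

(* At [sigma = 0] the system gives [psi_tau = - phi] and [psi_sigma = - phi_tau],
   so the Jacobian reduces to [(1 + phi_tau)^2]. *)
Lemma cg_inverse_jacobian_shoreline (m : R) (psi phi : R -> R -> R) (tau : R) :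
  Ck_halfplane 1 psi -> Ck_halfplane 1 phi -> linear_system m psi phi ->
  cg_inverse_jacobian psi phi 0 tau = (1 + Dtau phi 0 tau) ^ 2.
Proof.
intros (_ & Hpsi & _) (_ & Hphi & _) Hsys.
destruct (Hpsi 0 tau (Rle_refl 0)) as [Hps Hpt].
destruct (Hphi 0 tau (Rle_refl 0)) as [Hfs Hft].
apply Dsigma_correct in Hps, Hfs; try apply Rle_refl.
apply Derive_correct in Hpt, Hft. fold (Dtau psi 0 tau) in Hpt. fold (Dtau phi 0 tau) in Hft.
destruct (Hsys 0 tau (Rle_refl 0)) as [E1 E2].
unfold cg_inverse_jacobian.
rewrite (Dsigma_eq (cg_x psi phi) 0 tau _ (Rle_refl 0)
  (is_dsigma_cg_x psi phi 0 tau _ _ (Rle_refl 0) Hps Hfs)).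
rewrite (Dsigma_eq (cg_t phi) 0 tau (Dsigma phi 0 tau) (Rle_refl 0)).
2:{ rewrite is_dsigma_eps in Hfs |- * by lra. unfold cg_t.
  intros eps Heps. destruct (Hfs eps Heps) as (d & Hd & H). exists d.
  split; [easy |]. intros s Hs Hsd.
  replace (tau + phi s tau - (tau + phi 0 tau)) with (phi s tau - phi 0 tau) by ring.
  auto. }
assert (Ht : Dtau (cg_t phi) 0 tau = 1 + Dtau phi 0 tau).
{ apply is_derive_unique. unfold cg_t.
  apply (is_derive_plus (V := R_NormedModule) (fun t : R => t) (phi 0));
    [apply is_derive_Rid | exact Hft]. }
assert (Hx : Dtau (cg_x psi phi) 0 tau
  = - Dtau psi 0 tau + phi 0 tau * Dtau phi 0 tau).
{ apply is_derive_unique. unfold cg_x.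
  assert (He1 : ex_derive (psi 0) tau) by (eexists; exact Hpt).
  assert (He2 : ex_derive (phi 0) tau) by (eexists; exact Hft).
  auto_derive; [repeat apply conj; easy |].
  unfold Dtau. change (Derive (fun x => psi 0 x) tau) with (Derive (psi 0) tau).
  change (Derive (fun x => phi 0 x) tau) with (Derive (phi 0) tau).
  change (Derive (fun t => psi 0 t) tau) with (Derive (psi 0) tau).
  change (Derive (fun t => phi 0 t) tau) with (Derive (phi 0) tau).
  field. }
rewrite Ht, Hx. rewrite Rmult_0_r, Rmult_0_l, Rplus_0_r in E1.
replace (Dtau psi 0 tau) with (- phi 0 tau) by lra.
replace (Dsigma psi 0 tau) with (- Dtau phi 0 tau) by lra. ring.
Qed.

Lemma entire_on_reals_ex_derive (f : R -> R) (t : R) :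
  entire_on_reals f -> ex_derive f t.
Proof.
intros (a & Hcv & Hf). apply ex_derive_ext with (f := PSeries a).
- intros s. now apply is_pseries_unique.
- apply ex_derive_PSeries. now rewrite Hcv.
Qed.

(** The shoreline velocity [U] is unknown at first: [eta] and [u] are differentiable only inside the
    wet region, so the motion of the shoreline cannot be differentiated through them. The value
    [U = - R'] is extracted from the traces of [psi] and [phi], which are smooth in [tau]. *)
Theorem nonbreaking_wave_trace (m : R) (R0 : R -> R) (eta u : R -> R -> R)
    (eta0 u0 : R -> R) (psi phi : R -> R -> R) (gamma : R -> R) :
  nonbreaking_wave m R0 eta u eta0 u0 psi phi gamma ->
  (forall tau, exists! t, tau = t + Derive R0 t) /\
  (forall t, psi 0 (t + Derive R0 t) = R0 t + / 2 * (Derive R0 t) ^ 2 /\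
     phi 0 (t + Derive R0 t) = - Derive R0 t).
Proof.
intros H. pose proof (nonbreaking_wave_linear_system _ _ _ _ _ _ _ _ _ H) as Hsys.
destruct H as [_ _ _ [Hex Hrun] Hent Hcg Hpsi Hphi [_ Honto _ HJ] _].
specialize (Hpsi 1%nat). specialize (Hphi 1%nat).
assert (Hshore : forall t, exists U, phi 0 (t - U) = U /\ psi 0 (t - U) = R0 t + / 2 * U ^ 2).
{ intros t. destruct (Hex t) as [x Hx]. exists (u x t).
  rewrite (Hrun x t Hx). unfold shoreline in Hx.
  assert (Hw : wet eta x t) by (unfold wet; lra).
  pose proof (Hcg x t Hw) as E. unfold cg_sigma in E. rewrite Hx in E. exact E. }
assert (Hback : forall tau, psi 0 tau = R0 (tau + phi 0 tau) + / 2 * (phi 0 tau) ^ 2).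
{ intros tau. destruct (Honto 0 tau (Rle_refl 0)) as (x & t & Hw & Hs & Ht).
  destruct (Hcg x t Hw) as [E1 E2]. rewrite Hs, Ht in E1, E2.
  rewrite E2, E1. unfold cg_tau in Ht. replace (tau + u x t) with t by lra.
  now rewrite (Hrun x t Hs). }
assert (HR0 : forall tau, Derive R0 (tau + phi 0 tau) = - phi 0 tau).
{ intros tau. pose proof (HJ 0 tau (Rle_refl 0)) as HJ0.
  rewrite (cg_inverse_jacobian_shoreline m) in HJ0 by easy.
  destruct Hpsi as (_ & Hpsi & _). destruct Hphi as (_ & Hphi & _).
  destruct (Hpsi 0 tau (Rle_refl 0)) as [_ Hpt].
  destruct (Hphi 0 tau (Rle_refl 0)) as [_ Hft].
  apply Derive_correct in Hpt, Hft.
  fold (Dtau psi 0 tau) in Hpt. fold (Dtau phi 0 tau) in Hft.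
  pose proof (Derive_correct _ _ (entire_on_reals_ex_derive R0 (tau + phi 0 tau) Hent)) as HR.
  assert (Hd : is_derive (fun s => R0 (s + phi 0 s) + / 2 * phi 0 s ^ 2) tau
    ((1 + Dtau phi 0 tau) * Derive R0 (tau + phi 0 tau) + phi 0 tau * Dtau phi 0 tau)).
  { apply (is_derive_plus (V := R_NormedModule) (fun s => R0 (s + phi 0 s))
      (fun s => / 2 * phi 0 s ^ 2)).
    - apply (is_derive_comp (K := R_AbsRing) (V := R_NormedModule) R0
        (fun s => s + phi 0 s)); [exact HR |].
      apply (is_derive_plus (V := R_NormedModule) (fun s : R => s) (phi 0));
        [apply is_derive_Rid | exact Hft].
    - replace (phi 0 tau * Dtau phi 0 tau) with (scal (Dtau phi 0 tau) (phi 0 tau))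
        by apply Rmult_comm.
      apply (is_derive_comp (K := R_AbsRing) (V := R_NormedModule)
        (fun v => / 2 * v ^ 2) (phi 0)); [| exact Hft].
      auto_derive; [easy | field]. }
  apply (is_derive_ext _ (psi 0)) in Hd; [| intros s; symmetry; apply Hback].
  apply is_derive_unique in Hd. fold (Dtau psi 0 tau) in Hd.
  change (Derive (psi 0) tau) with (Dtau psi 0 tau) in Hd.
  destruct (Hsys 0 tau (Rle_refl 0)) as [E1 _].
  rewrite Rmult_0_r, Rmult_0_l, Rplus_0_r in E1.
  apply Rmult_eq_reg_l with (1 + Dtau phi 0 tau); [| intros Hz; apply HJ0; rewrite Hz; ring].
  lra. }
assert (Hfwd : forall t, phi 0 (t + Derive R0 t) = - Derive R0 t /\
  psi 0 (t + Derive R0 t) = R0 t + / 2 * (Derive R0 t) ^ 2).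
{ intros t. destruct (Hshore t) as (U & EU & EP).
  pose proof (HR0 (t - U)) as E. rewrite EU in E.
  replace (t - U + U) with t in E by ring. rewrite E.
  replace (t + - U) with (t - U) by ring. split; [lra |]. rewrite EP. ring. }
split.
(* The witness is [cg_t phi 0 tau], the physical time of the shoreline point with coordinate
   [tau]. *)
- intros tau. exists (tau + phi 0 tau). split.
  + rewrite HR0. ring.
  + intros t ->. destruct (Hfwd t) as [-> _]. ring.
- intros t. destruct (Hfwd t) as [E1 E2]. now rewrite E2, E1.
Qed.

(** * The recovery formulas *)

(** The weight is even and [sin] is odd, so folding the interval at 0 leaves only the even component
    of the trace. The center of the mean is 0 because the data sought lie on [tau = 0]. *)
Lemma RInt_cosw_even_part (q : R) (g : R -> R) (l : R) :
  0 < q -> (forall x, continuous g x) ->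
  RInt (fun th => cosw q th * g (0 + l * sin th)) (- (PI / 2)) (PI / 2)
  = 2 * RInt (fun th => cosw q th * even_part g (l * sin th)) 0 (PI / 2).
Proof.
intros Hq Hg.
assert (Hc : forall s x, continuous (fun th => cosw q th * g (0 + s * sin th)) x).
{ intros s x. apply continuous_Rmult; [now apply continuous_cosw |].
  now apply continuous_sin_shift. }
rewrite <- RInt_Rmult.
- rewrite (RInt_eq (fun x => 2 * (cosw q x * even_part g (l * sin x)))
    (fun x => cosw q x * g (0 + l * sin x) + cosw q x * g (0 + - l * sin x))).
  + rewrite RInt_symmetric by auto. apply RInt_eq. intros x.
    rewrite cosw_even, sin_neg. do 3 f_equal. ring.
  + intros x. unfold even_part. rewrite 2!Rplus_0_l, Ropp_mult_distr_l. field.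
- apply ex_RInt_cont. intros x.
  apply continuous_ext with (f := fun x =>
    / 2 * (cosw q x * g (0 + l * sin x) + cosw q x * g (0 + - l * sin x))).
  + intros t. unfold even_part. rewrite 2!Rplus_0_l, Ropp_mult_distr_l. eqR. ring.
  + apply continuous_Rmult; [apply continuous_const |].
    now apply (continuous_plus (V := R_NormedModule)).
Qed.

(** Substitution [xi = b * sin th]: the kernel contributes [cos ^ (2 e)] and the differential one
    more [cos]. A kernel unbounded at [b] becomes a weight that is continuous, thanks to
    [0 < 2 * e + 1]. *)
Lemma is_RInt_left_sin (e b : R) (G : R -> R) :
  0 < 2 * e + 1 -> 0 < b -> (forall x, continuous G x) ->
  is_RInt_left (fun xi => Rpower (1 - (xi / b) ^ 2) e * G xi) 0 b
    (b * RInt (fun th => cosw (2 * e + 1) th * G (b * sin th)) 0 (PI / 2)).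
Proof.
intros He Hb HG. pose proof PI_RGT_0 as HPI.
set (q := 2 * e + 1) in *.
set (f := fun xi => Rpower (1 - (xi / b) ^ 2) e * G xi).
set (w := fun th => b * (cosw q th * G (b * sin th))).
assert (Hw0 : forall x, continuous (fun th => cosw q th * G (b * sin th)) x).
{ intros x. apply continuous_ext with (f := fun th => cosw q th * G (0 + b * sin th)).
  - intros t. now rewrite Rplus_0_l.
  - apply continuous_Rmult; [now apply continuous_cosw | now apply continuous_sin_shift]. }
assert (Hw : forall x, continuous w x)
  by (intros x; apply continuous_Rmult; [apply continuous_const | apply Hw0]).
rewrite <- RInt_Rmult by now apply ex_RInt_cont. fold w.
assert (Hsub : forall th, 0 <= th < PI / 2 -> is_RInt f 0 (b * sin th) (RInt w 0 th)).
{ intros th Hth.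
  assert (Hf : forall x, 0 <= x <= th -> continuous f (b * sin x)).
  { intros x Hx. unfold f. apply continuous_Rmult; [| apply HG].
    apply (continuous_comp (fun xi => 1 - (xi / b) ^ 2) (fun z => Rpower z e)).
    - apply (ex_derive_continuous (fun xi => 1 - (xi / b) ^ 2)). auto_derive. easy.
    - apply continuous_Rpower. replace (b * sin x / b) with (sin x) by (field; lra).
      pose proof (sin2_cos2 x) as E. unfold Rsqr in E.
      assert (0 < cos x) by (apply cos_gt_0; lra). nra. }
  assert (Hcomp := is_RInt_comp (V := R_CompleteNormedModule) f
    (fun x => b * sin x) (fun x => b * cos x) 0 th).
  rewrite Rmin_left, Rmax_right in Hcomp by lra.
  assert (Hex : ex_RInt f 0 (b * sin th)).
  { apply (ex_RInt_continuous (V := R_CompleteNormedModule)). intros z.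
    assert (0 <= sin th) by (apply sin_ge_0; lra).
    rewrite Rmin_left, Rmax_right by nra. intros Hz.
    assert (Hsin1 : sin th <= 1) by apply SIN_bound.
    assert (Hzb : 0 <= z / b <= sin th).
    { split; [apply Rdiv_le_0_compat; lra | apply Rle_div_l; lra]. }
    replace z with (b * sin (asin (z / b))) by (rewrite sin_asin by lra; field; lra).
    apply Hf. pose proof (asin_bound (z / b)). split.
    - apply Rnot_lt_le. intros Hneg.
      assert (sin (asin (z / b)) < 0) by (apply sin_lt_0_var; lra).
      rewrite sin_asin in *; lra.
    - apply sin_incr_0; try lra. rewrite sin_asin; lra. }
  apply (RInt_correct (V := R_CompleteNormedModule)) in Hex.
  replace (RInt w 0 th) with (RInt f 0 (b * sin th)); [exact Hex |].
  symmetry. apply (is_RInt_unique (V := R_CompleteNormedModule)).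
  rewrite sin_0, Rmult_0_r in Hcomp.
  apply (is_RInt_ext (V := R_NormedModule)
    (fun y => scal (b * cos y) (f (b * sin y)))).
  - intros x. rewrite Rmin_left, Rmax_right by lra. intros Hx.
    unfold scal; simpl. unfold mult; simpl. unfold f, w, cosw.
    replace (b * sin x / b) with (sin x) by (field; lra).
    assert (Hcx : 0 < cos x) by (apply cos_gt_0; lra).
    rewrite pw_pos by easy.
    replace (1 - sin x ^ 2) with (cos x * cos x)
      by (pose proof (sin2_cos2 x) as E; unfold Rsqr in E; lra).
    rewrite <- Rpower_mult_distr by easy. unfold q.
    replace (2 * e + 1) with (e + e + 1) by ring. rewrite 2!Rpower_plus, Rpower_1 by easy.
    eqR. ring.
  - apply Hcomp; intros x Hx; [now apply Hf | split].
    + auto_derive; [easy | ring].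
    + apply (ex_derive_continuous (fun x => b * cos x)). auto_derive. easy. }
intros P HP.
(* The improper limit at [b] is the continuity at [PI / 2] of the transformed integral, pulled back
   by [asin]. Below, [th0] lies within [d] of [PI / 2], and the cap [PI / 4] keeps it positive. *)
assert (HJ : continuous (fun th => RInt w 0 th) (PI / 2)).
{ apply (continuous_RInt_1 (V := R_NormedModule) w 0).
  apply filter_forall. intros z. apply (RInt_correct (V := R_CompleteNormedModule)).
  now apply ex_RInt_cont. }
destruct (HJ P HP) as [d Hd].
set (th0 := PI / 2 - Rmin d (PI / 4)).
pose proof (cond_pos d) as Hd0.
assert (Hm : 0 < Rmin d (PI / 4)) by (apply Rmin_glb_lt; lra).
pose proof (Rmin_l d (PI / 4)). pose proof (Rmin_r d (PI / 4)).
assert (Hth0 : 0 < th0 < PI / 2) by (unfold th0; lra).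
assert (Hs1 : sin th0 < 1).
{ rewrite <- sin_PI2. apply sin_increasing_1; lra. }
assert (Hs0 : 0 < sin th0) by (apply sin_gt_0; lra).
exists (fun a => a = 0) (fun xi => b * sin th0 < xi < b).
- reflexivity.
- assert (Hgap : 0 < b - b * sin th0) by nra.
  exists (mkposreal _ Hgap). intros xi Hxi Hlt. split; [| easy].
  apply Rabs_lt_between in Hxi. unfold minus, plus, opp in Hxi; simpl in Hxi. lra.
- intros a xi -> Hxi. simpl.
  assert (Hx : sin th0 < xi / b < 1).
  { split; [apply Rlt_div_r; lra | apply Rlt_div_l; lra]. }
  pose proof (asin_bound (xi / b)) as Has.
  pose proof (sin_asin (xi / b) ltac:(lra)) as Hsa.
  assert (Hlo : th0 < asin (xi / b)) by (apply sin_increasing_0; lra).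
  assert (Hhi : asin (xi / b) < PI / 2).
  { destruct (proj2 Has) as [Hlt | Heq]; [easy |].
    rewrite Heq, sin_PI2 in Hsa. lra. }
  exists (RInt w 0 (asin (xi / b))). split.
  + replace xi with (b * sin (asin (xi / b))) at 1 by (rewrite Hsa; field; lra).
    apply Hsub. lra.
  + apply Hd. apply Rabs_lt_between. unfold minus, plus, opp; simpl.
    unfold th0 in Hlo. lra.
Qed.

Lemma trace_continuous (f : R -> R -> R) : Ck_halfplane 1 f ->
  forall x, continuous (f 0) x.
Proof.
intros (_ & Hex & _) x. apply (ex_derive_continuous (f 0)). now apply Hex, Rle_refl.
Qed.

Lemma continuous_even_part (g : R -> R) (c x : R) :
  (forall x, continuous g x) -> continuous (fun y => even_part g (c * y)) x.
Proof.
intros Hg. unfold even_part. apply continuous_Rmult; [apply continuous_const |].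
apply (continuous_plus (V := R_NormedModule)).
- apply (continuous_comp (fun y => c * y) g); [| apply Hg].
  apply (ex_derive_continuous (fun y => c * y)). auto_derive. easy.
- apply (continuous_comp (fun y => - (c * y)) g); [| apply Hg].
  apply (ex_derive_continuous (fun y => - (c * y))). auto_derive. easy.
Qed.

Theorem psi_recovery (m : R) (psi phi : R -> R -> R) (lambda : R) :
  0 < m -> Ck_halfplane 1 psi -> Ck_halfplane 1 phi -> linear_system m psi phi ->
  0 < lambda ->
  exists I : R,
    is_RInt_left
      (fun xi : R =>
         Rpower (1 - (PI * xi / lambda) ^ 2) (1 / m - / 2)
         * even_part (psi 0) (bay_q m * xi))
      0 (lambda / PI) I /\
    psi (lambda ^ 2) 0 =
      2 * sqrt PI * Gamma (1 + 1 / m) / (lambda * Gamma (1 / m + / 2)) * I.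
Proof.
intros Hm Hpsi Hphi Hsys Hl. pose proof PI_RGT_0 as HPI.
pose proof (cg_kappa_gt_0 m Hm) as Hk. pose proof (bay_omega_gt_0 m Hm) as Ho.
assert (Hq : 0 < 2 / m) by (apply Rdiv_lt_0_compat; lra).
assert (Hm1 : 0 < 1 / m) by (apply Rdiv_lt_0_compat; lra).
assert (Hb : 0 < lambda / PI) by now apply Rdiv_lt_0_compat.
pose proof (trace_continuous psi Hpsi) as Hc.
set (J := RInt (fun th => cosw (2 / m) th
  * even_part (psi 0) (bay_q m * (lambda / PI * sin th))) 0 (PI / 2)).
exists (lambda / PI * J). split.
- pose proof (is_RInt_left_sin (1 / m - / 2) (lambda / PI)
    (fun xi => even_part (psi 0) (bay_q m * xi))) as H.
  replace (2 * (1 / m - / 2) + 1) with (2 / m) in H by (field; lra).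
  specialize (H Hq Hb (fun x => continuous_even_part (psi 0) (bay_q m) x Hc)).
  fold J in H. revert H.
  apply (is_RInt_gen_ext (V := R_NormedModule)). apply filter_forall.
  intros ab x _. now replace (PI * x / lambda) with (x / (lambda / PI)) by (field; lra).
- pose proof (linear_system_lift m psi phi Hm Hpsi Hphi Hsys) as Hlift.
  pose proof (lifted_system_mean_p (2 / m) _ _ Hq Hlift lambda 0) as H. cbv beta in H.
  replace (0 ^ 2) with 0 in H by ring. rewrite Rmult_0_r in H.
  rewrite (RInt_cosw_even_part (2 / m) (fun y => psi 0 (cg_kappa m * y))) in H.
  2: easy.
  2:{ intros x. apply (continuous_comp (fun y => cg_kappa m * y) (psi 0)); [| apply Hc].
      apply (ex_derive_continuous (fun y => cg_kappa m * y)). auto_derive. easy. }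
  rewrite (RInt_eq _ (fun th => cosw (2 / m) th
    * even_part (psi 0) (bay_q m * (lambda / PI * sin th)))) in H.
  2:{ intros x. unfold even_part, bay_q, cg_kappa.
      replace (2 * PI / bay_omega m * (lambda / PI * sin x))
        with (2 / bay_omega m * (lambda * sin x)) by (field; lra).
      now rewrite <- Ropp_mult_distr_r. }
  fold J in H.
  rewrite cosw_mass_wallis, wallis_eq_Gamma in H by easy.
  replace (2 / m / 2 + / 2) with (1 / m + / 2) in H by (field; lra).
  replace (2 / m / 2 + 1) with (1 + 1 / m) in H by (field; lra).
  pose proof (Gamma_gt_0 (1 / m + / 2) ltac:(lra)) as G1.
  pose proof (Gamma_gt_0 (1 + 1 / m) ltac:(lra)) as G2.
  pose proof (sqrt_lt_R0 PI HPI) as Hs. pose proof (sqrt_sqrt PI ltac:(lra)) as Hss.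
  set (g1 := Gamma (1 / m + / 2)) in *. set (g2 := Gamma (1 + 1 / m)) in *.
  (* The mass of the weight is [sqrt PI * g1 / g2] and folding gave a factor 2. Writing [PI] as
     [sqrt PI * sqrt PI] in the witness [lambda / PI * J] then produces the stated constant. *)
  replace (psi (lambda ^ 2) 0) with (2 * g2 / (sqrt PI * g1) * J).
  + rewrite <- Hss at 3. field. lra.
  + apply Rmult_eq_reg_l with (2 * (sqrt PI / 2 * g1 / g2)).
    * rewrite H. field. lra.
    * apply Rgt_not_eq. apply Rmult_lt_0_compat; [lra |].
      apply Rdiv_lt_0_compat; [| easy]. apply Rmult_lt_0_compat; lra.
Qed.

Theorem phi_recovery (m : R) (psi phi : R -> R -> R) (lambda : R) :
  0 < m -> Ck_halfplane 1 psi -> Ck_halfplane 1 phi -> linear_system m psi phi ->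
  0 < lambda ->
  exists I : R,
    is_RInt_left
      (fun xi : R =>
         Rpower (lambda ^ 2 - PI ^ 2 * xi ^ 2) (1 / m + / 2)
         * even_part (phi 0) (bay_q m * xi))
      0 (lambda / PI) I /\
    phi (lambda ^ 2) 0 =
      2 * sqrt PI * Gamma (2 + 1 / m)
        / (Rpower lambda (2 + 2 / m) * Gamma (3 / 2 + 1 / m)) * I.
Proof.
intros Hm Hpsi Hphi Hsys Hl. pose proof PI_RGT_0 as HPI.
pose proof (cg_kappa_gt_0 m Hm) as Hk. pose proof (bay_omega_gt_0 m Hm) as Ho.
assert (Hq : 0 < 2 / m) by (apply Rdiv_lt_0_compat; lra).
assert (Hq2 : 0 < 2 / m + 2) by lra.
assert (Hm1 : 0 < 1 / m) by (apply Rdiv_lt_0_compat; lra).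
assert (Hb : 0 < lambda / PI) by now apply Rdiv_lt_0_compat.
pose proof (trace_continuous phi Hphi) as Hc.
set (e := 1 / m + / 2).
set (J := RInt (fun th => cosw (2 / m + 2) th
  * even_part (phi 0) (bay_q m * (lambda / PI * sin th))) 0 (PI / 2)).
exists (Rpower (lambda * lambda) e * (lambda / PI * J)). split.
- pose proof (is_RInt_left_sin e (lambda / PI)
    (fun xi => even_part (phi 0) (bay_q m * xi))) as H.
  replace (2 * e + 1) with (2 / m + 2) in H by (unfold e; field; lra).
  specialize (H Hq2 Hb (fun x => continuous_even_part (phi 0) (bay_q m) x Hc)).
  fold J in H.
  apply (is_RInt_gen_scal (V := R_NormedModule) _ (Rpower (lambda * lambda) e)) in H.
  (* Pulling [lambda ^ 2] out of the kernel uses multiplicativity of [Rpower], valid for positive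
     bases; hence the two integrands are compared only on [0 < x < lambda / PI]. *)
  revert H. apply (is_RInt_gen_ext (V := R_NormedModule)).
  exists (fun a => a = 0) (fun xi => 0 < xi < lambda / PI).
  + reflexivity.
  + exists (mkposreal _ Hb). intros xi Hxi Hlt. split; [| easy].
    apply Rabs_lt_between in Hxi. unfold minus, plus, opp in Hxi; simpl in Hxi. lra.
  + intros a xi -> Hxi x. simpl fst. simpl snd. rewrite Rmin_left, Rmax_right by lra.
    intros Hx.
    assert (Hx1 : 0 < x / (lambda / PI) < 1).
    { split; [apply Rdiv_lt_0_compat; lra | apply Rlt_div_l; lra]. }
    unfold scal; simpl. unfold mult; simpl.
    rewrite <- Rmult_assoc, Rpower_mult_distr by nra. do 2 f_equal. field. lra.
- pose proof (linear_system_lift m psi phi Hm Hpsi Hphi Hsys) as Hlift.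
  assert (Hl0 : lambda <> 0) by lra.
  pose proof (lifted_system_mean_f (2 / m) _ _ Hq Hlift lambda 0 Hl0) as H. cbv beta in H.
  replace (0 ^ 2) with 0 in H by ring. rewrite Rmult_0_r in H.
  rewrite (RInt_eq _ (fun th => 2 / cg_kappa m *
    (cosw (2 / m + 2) th * phi 0 (cg_kappa m * (0 + lambda * sin th))))) in H
    by (intros; ring).
  assert (Hkc : forall x, continuous (fun y => phi 0 (cg_kappa m * y)) x).
  { intros x. apply (continuous_comp (fun y => cg_kappa m * y) (phi 0)); [| apply Hc].
    apply (ex_derive_continuous (fun y => cg_kappa m * y)). auto_derive. easy. }
  rewrite RInt_Rmult in H.
  2:{ apply ex_RInt_cont. intros x. apply continuous_Rmult; [now apply continuous_cosw |].
      now apply (continuous_sin_shift (fun y => phi 0 (cg_kappa m * y))). }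
  rewrite (RInt_cosw_even_part (2 / m + 2) (fun y => phi 0 (cg_kappa m * y))) in H by easy.
  rewrite (RInt_eq _ (fun th => cosw (2 / m + 2) th
    * even_part (phi 0) (bay_q m * (lambda / PI * sin th)))) in H.
  2:{ intros x. unfold even_part, bay_q, cg_kappa.
      replace (2 * PI / bay_omega m * (lambda / PI * sin x))
        with (2 / bay_omega m * (lambda * sin x)) by (field; lra).
      now rewrite <- Ropp_mult_distr_r. }
  fold J in H.
  rewrite cosw_mass_wallis, wallis_eq_Gamma in H by easy.
  replace ((2 / m + 2) / 2 + / 2) with (3 / 2 + 1 / m) in H by (field; lra).
  replace ((2 / m + 2) / 2 + 1) with (2 + 1 / m) in H by (field; lra).
  pose proof (Gamma_gt_0 (3 / 2 + 1 / m) ltac:(lra)) as G1.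
  pose proof (Gamma_gt_0 (2 + 1 / m) ltac:(lra)) as G2.
  pose proof (sqrt_lt_R0 PI HPI) as Hs. pose proof (sqrt_sqrt PI ltac:(lra)) as Hss.
  set (g1 := Gamma (3 / 2 + 1 / m)) in *. set (g2 := Gamma (2 + 1 / m)) in *.
  (* [2 + 2 / m = 2 * e + 1]: the factor [lambda ^ (2 e)] cancels against the kernel, the remaining
     [lambda] against the length of the interval. *)
  assert (Hpow : Rpower lambda (2 + 2 / m) = Rpower (lambda * lambda) e * lambda).
  { rewrite <- Rpower_mult_distr by easy. rewrite <- (Rpower_1 lambda) at 4 by easy.
    rewrite <- 2!Rpower_plus. f_equal. unfold e. field. lra. }
  rewrite Hpow. pose proof (Rpower_gt_0 (lambda * lambda) e) as Hr.
  replace (phi (lambda ^ 2) 0) with (2 * g2 / (sqrt PI * g1) * J).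
  + rewrite <- Hss at 3. field. lra.
  + apply Rmult_eq_reg_l with (2 / cg_kappa m * (2 * (sqrt PI / 2 * g1 / g2))).
    * replace (2 / cg_kappa m * (2 * (sqrt PI / 2 * g1 / g2)) * phi (lambda ^ 2) 0)
        with (2 * (sqrt PI / 2 * g1 / g2) * (2 / cg_kappa m * phi (lambda ^ 2) 0)) by ring.
      rewrite H. field. lra.
    * apply Rgt_not_eq. apply Rmult_lt_0_compat; [apply Rdiv_lt_0_compat; lra |].
      apply Rmult_lt_0_compat; [lra |].
      apply Rdiv_lt_0_compat; [| easy]. apply Rmult_lt_0_compat; lra.
Qed.

(** * The initial data *)

(** [tau + phi sigma tau] is the physical time [t], so the fixed-point equation says [t = 0]. By
    surjectivity each of its solutions is the image of a point at time 0, hence lies on the graph of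
    [gamma]. *)
Theorem initial_curve (m : R) (R0 : R -> R) (eta u : R -> R -> R)
    (eta0 u0 : R -> R) (psi phi : R -> R -> R) (gamma : R -> R) (sigma : R) :
  nonbreaking_wave m R0 eta u eta0 u0 psi phi gamma -> 0 <= sigma ->
  gamma sigma = - phi sigma (gamma sigma) /\
  forall tau, tau = - phi sigma tau -> tau = gamma sigma.
Proof.
intros [_ _ _ _ _ Hcg _ _ [_ Honto _ _] Hgam] Hsigma. split.
- destruct (proj2 (Hgam sigma (gamma sigma) Hsigma) eq_refl) as (x & Hw & Hs & Ht).
  destruct (Hcg x 0 Hw) as [E _]. rewrite Hs, Ht in E. rewrite E, <- Ht.
  unfold cg_tau. ring.
- intros tau Htau. apply (Hgam sigma tau Hsigma).
  destruct (Honto sigma tau Hsigma) as (x & t & Hw & Hs & Ht).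
  destruct (Hcg x t Hw) as [E _]. rewrite Hs, Ht in E. unfold cg_tau in Ht.
  assert (t = 0) as -> by lra. now exists x.
Qed.

Lemma initial_point (m : R) (R0 : R -> R) (eta u : R -> R -> R)
    (eta0 u0 : R -> R) (psi phi : R -> R -> R) (gamma : R -> R) (sigma : R) :
  nonbreaking_wave m R0 eta u eta0 u0 psi phi gamma -> 0 <= sigma ->
  cg_x psi phi sigma (gamma sigma) + eta0 (cg_x psi phi sigma (gamma sigma)) = sigma /\
  u0 (cg_x psi phi sigma (gamma sigma)) = phi sigma (gamma sigma).
Proof.
intros [_ Heta0 Hu0 _ _ Hcg _ _ _ Hgam] Hsigma.
destruct (proj2 (Hgam sigma (gamma sigma) Hsigma) eq_refl) as (x & Hw & Hs & Ht).
destruct (Hcg x 0 Hw) as [E1 E2]. rewrite Hs, Ht in E1, E2.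
assert (Hx : cg_x psi phi sigma (gamma sigma) = x).
{ unfold cg_x. rewrite E1, E2. unfold cg_sigma in Hs. lra. }
rewrite Hx, <- Heta0, <- Hu0, E1. easy.
Qed.

(** Together with [initial_point] this makes [x + eta0 x] and [cg_x psi phi sigma (gamma sigma)]
    inverse bijections between the initial wet region and [sigma >= 0]. *)
Lemma initial_wet (m : R) (R0 : R -> R) (eta u : R -> R -> R)
    (eta0 u0 : R -> R) (psi phi : R -> R -> R) (gamma : R -> R) (x : R) :
  nonbreaking_wave m R0 eta u eta0 u0 psi phi gamma -> 0 <= x + eta0 x ->
  x = cg_x psi phi (x + eta0 x) (gamma (x + eta0 x)).
Proof.
intros [_ Heta0 _ _ _ Hcg _ _ _ Hgam] Hx.
assert (Hw : wet eta x 0) by (unfold wet; now rewrite Heta0).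
rewrite <- Heta0 in Hx |- *.
assert (Hg : cg_tau u x 0 = gamma (x + eta x 0)).
{ apply (Hgam _ _ Hx). now exists x. }
rewrite <- Hg. destruct (Hcg x 0 Hw) as [E1 E2]. unfold cg_sigma in E1, E2.
unfold cg_x. rewrite E1, E2. ring.
Qed.

Theorem mainTheorem3 (m : R) (R0 : R -> R) (eta u : R -> R -> R)
    (eta0 u0 : R -> R) (psi phi : R -> R -> R) (gamma : R -> R)
    (hm : 0 < m)
    (hwave : nonbreaking_wave m R0 eta u eta0 u0 psi phi gamma) :
  (* shoreline traces read off from the run-up *)
  (forall tau : R, exists! t : R, tau = t + Derive R0 t) /\
  (forall t : R,
     psi 0 (t + Derive R0 t) = R0 t + / 2 * (Derive R0 t) ^ 2 /\
     phi 0 (t + Derive R0 t) = - Derive R0 t) /\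
  (* recovery of psi and phi on the line tau = 0 *)
  (forall lambda : R, 0 < lambda ->
     exists I : R,
       is_RInt_left
         (fun xi : R =>
            Rpower (1 - (PI * xi / lambda) ^ 2) (1 / m - / 2)
            * even_part (psi 0) (bay_q m * xi))
         0 (lambda / PI) I /\
       psi (lambda ^ 2) 0 =
         2 * sqrt PI * Gamma (1 + 1 / m)
           / (lambda * Gamma (1 / m + / 2)) * I) /\
  (forall lambda : R, 0 < lambda ->
     exists I : R,
       is_RInt_left
         (fun xi : R =>
            Rpower (lambda ^ 2 - PI ^ 2 * xi ^ 2) (1 / m + / 2)
            * even_part (phi 0) (bay_q m * xi))
         0 (lambda / PI) I /\
       phi (lambda ^ 2) 0 =
         2 * sqrt PI * Gamma (2 + 1 / m)
           / (Rpower lambda (2 + 2 / m) * Gamma (3 / 2 + 1 / m)) * I) /\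
  (* psi and phi are the solution of the linear system with these data *)
  linear_system m psi phi /\
  (forall psi' phi' : R -> R -> R,
     smooth_halfplane psi' -> smooth_halfplane phi' ->
     linear_system m psi' phi' ->
     (forall sigma : R, 0 <= sigma ->
        psi' sigma 0 = psi sigma 0 /\ phi' sigma 0 = phi sigma 0) ->
     forall sigma tau : R, 0 <= sigma ->
       psi' sigma tau = psi sigma tau /\ phi' sigma tau = phi sigma tau) /\
  (* the curve t = 0 *)
  (forall sigma : R, 0 <= sigma ->
     gamma sigma = - phi sigma (gamma sigma) /\
     forall tau : R, tau = - phi sigma tau -> tau = gamma sigma) /\
  (* parametric form of the initial data, covering the initial wet region *)
  (forall sigma : R, 0 <= sigma ->
     eta0 (cg_x psi phi sigma (gamma sigma))
       = psi sigma (gamma sigma) - / 2 * (phi sigma (gamma sigma)) ^ 2 /\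
     u0 (cg_x psi phi sigma (gamma sigma)) = phi sigma (gamma sigma)) /\
  (forall x : R, 0 <= x + eta0 x ->
     exists! sigma : R,
       0 <= sigma /\ x = cg_x psi phi sigma (gamma sigma)) /\
  (* the initial data are determined by the run-up *)
  (forall (eta' u' : R -> R -> R) (eta0' u0' : R -> R)
          (psi' phi' : R -> R -> R) (gamma' : R -> R),
     nonbreaking_wave m R0 eta' u' eta0' u0' psi' phi' gamma' ->
     forall x : R,
       (0 <= x + eta0' x <-> 0 <= x + eta0 x) /\
       (0 <= x + eta0 x -> eta0' x = eta0 x /\ u0' x = u0 x)).
Proof.
pose proof (nonbreaking_wave_linear_system _ _ _ _ _ _ _ _ _ hwave) as Hsys.
destruct (nonbreaking_wave_trace _ _ _ _ _ _ _ _ _ hwave) as [Htau Htrace].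
pose proof (wave_psi_smooth _ _ _ _ _ _ _ _ _ hwave 1%nat) as Hpsi.
pose proof (wave_phi_smooth _ _ _ _ _ _ _ _ _ hwave 1%nat) as Hphi.
split; [exact Htau |]. split; [exact Htrace |].
split; [intros lambda Hl; now apply psi_recovery with (phi := phi) |].
split; [intros lambda Hl; now apply phi_recovery with (psi := psi) |].
split; [exact Hsys |].
split.
{ intros psi' phi' Hpsi' Hphi' Hsys' Hini.
  apply (linear_system_cauchy_unique m); auto. }
split.
{ intros sigma Hsigma. exact (initial_curve _ _ _ _ _ _ _ _ _ sigma hwave Hsigma). }
split.
{ intros sigma Hsigma.
  destruct (initial_point _ _ _ _ _ _ _ _ _ sigma hwave Hsigma) as [E1 E2].
  split; [| exact E2]. unfold cg_x in E1 at 1. lra. }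
split.
{ intros x Hx. exists (x + eta0 x). split.
  - split; [exact Hx |]. exact (initial_wet _ _ _ _ _ _ _ _ _ x hwave Hx).
  - intros sigma [Hsigma ->].
    now destruct (initial_point _ _ _ _ _ _ _ _ _ sigma hwave Hsigma). }
intros eta' u' eta0' u0' psi' phi' gamma' hwave'.
pose proof (nonbreaking_wave_linear_system _ _ _ _ _ _ _ _ _ hwave') as Hsys'.
destruct (nonbreaking_wave_trace _ _ _ _ _ _ _ _ _ hwave') as [_ Htrace'].
pose proof (wave_psi_smooth _ _ _ _ _ _ _ _ _ hwave' 1%nat) as Hpsi'.
pose proof (wave_phi_smooth _ _ _ _ _ _ _ _ _ hwave' 1%nat) as Hphi'.
(* Every [tau] has the form [t + Derive R0 t], and there both traces of [psi] are given by the same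
   expression in [R0]; equal traces force equal solutions. *)
assert (Heq : forall sigma tau, 0 <= sigma ->
  psi' sigma tau = psi sigma tau /\ phi' sigma tau = phi sigma tau).
{ apply (linear_system_trace_unique m); auto. intros tau.
  destruct (Htau tau) as [t [-> _]].
  destruct (Htrace t) as [-> _]. now destruct (Htrace' t). }
(* [gamma' sigma] solves the fixed-point equation of the second wave, which is now that of the
   first, whose solution is unique. *)
assert (Hgam : forall sigma, 0 <= sigma -> gamma' sigma = gamma sigma).
{ intros sigma Hsigma.
  apply (initial_curve _ _ _ _ _ _ _ _ _ sigma hwave Hsigma).
  destruct (Heq sigma (gamma' sigma) Hsigma) as [_ <-].
  now apply (initial_curve _ _ _ _ _ _ _ _ _ sigma hwave'). }
assert (Hx : forall sigma, 0 <= sigma ->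
  cg_x psi' phi' sigma (gamma' sigma) = cg_x psi phi sigma (gamma sigma)).
{ intros sigma Hsigma. rewrite Hgam by easy. unfold cg_x.
  now destruct (Heq sigma (gamma sigma) Hsigma) as [-> ->]. }
intros x.
(* If [x] is wet for the second wave, it is the position assigned to [sigma = x + eta0' x] by both
   waves, so its depth is [sigma] for the first one too. *)
assert (Hback : 0 <= x + eta0' x -> x + eta0 x = x + eta0' x).
{ intros H. pose proof (initial_wet _ _ _ _ _ _ _ _ _ x hwave' H) as E.
  destruct (initial_point _ _ _ _ _ _ _ _ _ _ hwave H) as [E1 _].
  rewrite <- Hx, <- E in E1 by easy. exact E1. }
assert (Hforth : 0 <= x + eta0 x -> x + eta0' x = x + eta0 x /\ u0' x = u0 x).
{ intros H. pose proof (initial_wet _ _ _ _ _ _ _ _ _ x hwave H) as E.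
  destruct (initial_point _ _ _ _ _ _ _ _ _ _ hwave H) as [_ E2].
  destruct (initial_point _ _ _ _ _ _ _ _ _ _ hwave' H) as [E1' E2'].
  rewrite Hx, <- E in E1', E2' by easy. rewrite <- E in E2.
  split; [exact E1' |]. rewrite E2', E2, Hgam by easy. now apply Heq. }
split.
- split; intros H; [rewrite Hback | destruct (Hforth H) as [-> _]]; easy.
- intros H. destruct (Hforth H). split; [lra | easy].
Qed.
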